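(* Let $N\ge2$, let $\mathcal{X}_1,\dots,\mathcal{X}_N\subset\mathbb{R}^d$ be compact convex sets and $\mathcal{X}=\prod_{i=1}^N\mathcal{X}_i$. For $k\in\mathbb{N}^*$, assume that $c\in\mathcal{C}^{k+1}(\mathcal{X})$. Then the Schrödinger map $S:\prod_{i=1}^N\mathcal{P}(\mathcal{X}_i)\to\tilde{\mathcal{C}}^k$ is Lipschitz continuous, i.e. there exists $C>0$ such that for all $\boldsymbol{\mu},\boldsymbol{\nu}\in\prod_{i=1}^N\mathcal{P}(\mathcal{X}_i)$, $$\Vert S(\boldsymbol{\mu})-S(\boldsymbol{\nu})\Vert_{\tilde{\mathcal{C}}^k}\leq C\,\boldsymbol{W_2}(\boldsymbol{\mu},\boldsymbol{\nu}).$$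
   Context: $\mathbb{N}^*=\mathbb{N}\setminus\{0\}$; $\mathcal{P}(K)$ denotes Borel probability measures on $K$. For compact convex $K\subset\mathbb{R}^m$, $\mathcal{C}^k(K)$ is the Banach space of functions on $K$ admitting a $\mathcal{C}^k$ extension to $\mathbb{R}^m$, with norm $\Vert f\Vert_{\mathcal{C}^k}=\inf_{\tilde f}\sup_{|\alpha|\le k}\Vert\partial^\alpha\tilde f\Vert_\infty$ over such extensions. Quotient space: $\tilde{\mathcal{C}}^k=\big(\prod_{i=1}^N\mathcal{C}^k(\mathcal{X}_i)\big)/\sim$ where $\boldsymbol{\phi}\sim\boldsymbol{\psi}$ iff there is $\kappa\in\mathbb{R}^N$ with $\sum_i\kappa_i=0$ and $\phi_i=\psi_i+\kappa_i$ for all $i$; it is endowed with the quotient norm (infimum over representatives of $\sum_i\Vert\phi_i\Vert_{\mathcal{C}^k}$). Write $\mathcal{X}_{-i}=\prod_{j\ne i}\mathcal{X}_j$, $x=(x_i,x_{-i})$, $\mu_{-i}=\otimes_{j\ne i}\mu_j$. Schrödinger map: for $\boldsymbol{\mu}\in\prod_i\mathcal{P}(\mathcal{X}_i)$, $S(\boldsymbol{\mu})\in\tilde{\mathcal{C}}^k$ is the unique class of $\boldsymbol{\phi}$ such that for every $i\in\{1,\dots,N\}$ and every $x_i\in\mathcal{X}_i$, $$\log\Big(\int_{\mathcal{X}_{-i}}e^{\sum_{j=1}^N\phi_j(x_j)-c(x_i,x_{-i})}\,d\mu_{-i}(x_{-i})\Big)=0.$$ $W_2$ is the $L^2$-Wasserstein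 distance (Euclidean ground cost) and $\boldsymbol{W_2}(\boldsymbol{\mu},\boldsymbol{\nu})=\big(\sum_{i=1}^NW_2(\mu_i,\nu_i)^2\big)^{1/2}$. *)

(* Defs.v *)
From HB Require Import structures.
From mathcomp Require Import all_boot all_order all_algebra.
From mathcomp Require Import all_classical all_reals all_analysis.

Set Implicit Arguments.
Unset Strict Implicit.
Unset Printing Implicit Defensive.

Import Order.TTheory GRing.Theory Num.Theory.
Import numFieldNormedType.Exports.

Local Open Scope classical_set_scope.
Local Open Scope ring_scope.

(* R^m is represented by matrices 'M[R]_(p, q) with p * q = m: row vectors for
   R^d, and N x d matrices (one row per factor) for (R^d)^N. *)
Section Ck_functions.
Context {R : realType} {p q : nat}.
Implicit Types (f g : 'M[R]_(p, q) -> R) (K : set 'M[R]_(p, q)).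

Definition pderiv (ij : 'I_p * 'I_q) f : 'M[R]_(p, q) -> R :=
  fun x => 'D_(delta_mx ij.1 ij.2) f x.

Fixpoint is_Ck (k : nat) f : Prop :=
  if k is k'.+1 then
    continuous f /\
    forall ij, (forall x, derivable f x (delta_mx ij.1 ij.2)) /\
               is_Ck k' (pderiv ij f)
  else continuous f.

Definition multi_index := {ffun 'I_p * 'I_q -> nat}.

Definition mi_order (alpha : multi_index) : nat := (\sum_ij alpha ij)%N.

(* The order in which the coordinates are differentiated is fixed by the
   enumeration; it is immaterial for the C^k functions used below. *)
Definition partial (alpha : multi_index) f : 'M[R]_(p, q) -> R :=
  foldr (fun ij g => iter (alpha ij) (pderiv ij) g) f
    (enum {: 'I_p * 'I_q}).

Definition Ck_extension (k : nat) K f g := is_Ck k g /\ {in K, f =1 g}.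

(* Elements of C^k(K) are given by total functions, of which only the
   restriction to K is relevant. *)
Definition Ck_on (k : nat) K f := exists g, Ck_extension k K f g.

Definition Ck_norm (k : nat) K f : \bar R :=
  ereal_inf [set ereal_sup
      [set `|partial a.1 g a.2|%:E | a in
        [set a : multi_index * 'M[R]_(p, q) | (mi_order a.1 <= k)%N]]
    | g in Ck_extension k K f].

End Ck_functions.

Section Ck_closed.
Context {R : realType} {p q : nat}.

Lemma is_Ck0 k : is_Ck k (0 : 'M[R]_(p, q) -> R).
Proof.
elim: k => [|k IH] /=; first by move=> x; exact: cst_continuous.
split; first by move=> x; exact: cst_continuous.
move=> ij; split; first by move=> x; exact: derivable_cst.
suff -> : pderiv ij (0 : 'M[R]_(p, q) -> R) = 0 by [].
by apply/funext => x; rewrite /pderiv derive_cst.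
Qed.

Lemma is_CkB k (f g : 'M[R]_(p, q) -> R) :
  is_Ck k f -> is_Ck k g -> is_Ck k (f - g).
Proof.
elim: k f g => [|k IH] f g /=.
  by move=> cf cg x; apply: continuousB; [exact: cf|exact: cg].
move=> [cf df] [cg dg]; split.
  by move=> x; apply: continuousB; [exact: cf|exact: cg].
move=> ij; have [dfij Cf] := df ij; have [dgij Cg] := dg ij.
split; first by move=> x; exact: derivableB.
suff -> : pderiv ij (f - g) = pderiv ij f - pderiv ij g by exact: IH.
by apply/funext => x; rewrite /pderiv deriveB.
Qed.

End Ck_closed.

Section quotient_space.
Context {R : realType} {N d : nat} (k : nat) (X : 'I_N -> set 'rV[R]_d).

Definition Ck_family : {pred 'I_N -> 'rV[R]_d -> R} :=
  fun phi => `[< forall i, Ck_on k (X i) (phi i) >].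

Lemma Ck_family_zmod_closed : zmod_closed Ck_family.
Proof.
split=> [|phi psi /asboolP Cphi /asboolP Cpsi]; apply/asboolP => i.
  by exists 0; split; [exact: is_Ck0|].
have [f [Cf ef]] := Cphi i; have [g [Cg eg]] := Cpsi i.
exists (f - g); split; first exact: is_CkB.
by move=> x xX; rewrite !fctE (ef _ xX) (eg _ xX).
Qed.

HB.instance Definition _ :=
  GRing.isZmodClosed.Build _ Ck_family Ck_family_zmod_closed.

Record Ck_prod := MkCkProd {
  Ck_val :> 'I_N -> 'rV[R]_d -> R;
  _ : Ck_val \in Ck_family }.

HB.instance Definition _ := [isSub for Ck_val].
HB.instance Definition _ := [Choice of Ck_prod by <:].
HB.instance Definition _ := [SubChoice_isSubZmodule of Ck_prod by <:].

(* phi ~ psi iff phi - psi is null_shift; the equality is only required on the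
   X i, so that values of representatives outside the X i are also quotiented
   out. *)
Definition null_shift : {pred Ck_prod} :=
  fun phi => `[< exists kappa : 'I_N -> R, \sum_i kappa i = 0 /\
    forall i, {in X i, forall x, phi i x = kappa i} >].

Lemma null_shift_zmod_closed : zmod_closed null_shift.
Proof.
split=> [|phi psi /asboolP[a [a0 ea]] /asboolP[b [b0 eb]]]; apply/asboolP.
  by exists (fun=> 0); split; [rewrite big1|].
exists (fun i => a i - b i); split; first by rewrite sumrB a0 b0 subrr.
by move=> i x xX; rewrite /= -(ea i x xX) -(eb i x xX).
Qed.

HB.instance Definition _ :=
  GRing.isZmodClosed.Build _ null_shift null_shift_zmod_closed.

Definition Ck_tilde := Quotient.quot null_shift.
HB.instance Definition _ := GRing.Zmodule.on Ck_tilde.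

Definition Ck_class (phi : Ck_prod) : Ck_tilde := \pi_Ck_tilde%qT phi.

Definition Ck_tilde_norm (a : Ck_tilde) : \bar R :=
  ereal_inf [set (\sum_i Ck_norm k (X i) (phi i))%E
    | phi in [set phi : Ck_prod | Ck_class phi = a]].

End quotient_space.

Section product_probability.
Context {dT : measure_display} {T : measurableType dT} {R : realType}.

Definition tuple_cons n (z : T * n.-tuple T) : n.+1.-tuple T :=
  [tuple of z.1 :: z.2].

Lemma measurable_tuple_cons n : measurable_fun [set: T * n.-tuple T] (@tuple_cons n).
Proof. by apply: measurable_cons. Qed.

HB.instance Definition _ n :=
  isMeasurableFun.Build _ _ _ _ (@tuple_cons n) (@measurable_tuple_cons n).

Fixpoint tuple_prob n : ('I_n -> probability T R) -> probability (n.-tuple T) R :=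
  match n with
  | 0 => fun=> \d_[tuple]
  | m.+1 => fun mu =>
      distribution (mu ord0 \x @tuple_prob m (fun j : 'I_m => mu (lift ord0 j)))%E
        (@tuple_cons m)
  end.

End product_probability.

Notation borel_rV R d := (g_sigma_algebraType (@open 'rV[R]_d)).

Section Schrodinger_map.
Context {R : realType} {N d : nat}.
Implicit Types (X : 'I_N -> set 'rV[R]_d)
  (mu nu : 'I_N -> probability (borel_rV R d) R).

Definition prod_set X : set 'M[R]_(N, d) := [set x | forall i, X i (row i x)].

(* Borel probability measures on K are seen as Borel probability measures on
   the ambient space giving full mass to K. *)
Definition prob_on (K : set 'rV[R]_d) : set (probability (borel_rV R d) R) :=
  [set P | P K = 1%E].

Definition prod_set_but X (i : 'I_N) : set (N.-1.-tuple (borel_rV R d)) :=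
  [set t | forall j, X (lift i j) (tnth t j)].

Definition prod_prob_but mu (i : 'I_N) :
    probability (N.-1.-tuple (borel_rV R d)) R :=
  tuple_prob (fun j => mu (lift i j)).

(* the point (x_i, x_{-i}) *)
Definition insert_at (i : 'I_N) (xi : 'rV[R]_d)
    (t : N.-1.-tuple (borel_rV R d)) : 'M[R]_(N, d) :=
  \matrix_(j < N) (oapp (tnth t) xi (unlift i j) : 'rV[R]_d).

(* lne is the extended logarithm (lne 0 = -oo, lne +oo = +oo), so the equation
   really says that the integral equals 1. *)
Definition Schrodinger_system X (c : 'M[R]_(N, d) -> R) mu
    (phi : 'I_N -> 'rV[R]_d -> R) : Prop :=
  forall i, {in X i, forall xi,
    lne (\int[prod_prob_but mu i]_(t in prod_set_but X i)
      (expR ((\sum_j phi j (row j (insert_at i xi t)))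
             - c (insert_at i xi t)))%:E) = 0%E}.

(* The class solving the system is unique; the default value 0 of xget would
   only be taken if there were none. *)
Definition Schrodinger_map (k : nat) X (c : 'M[R]_(N, d) -> R) mu :
    Ck_tilde k X :=
  xget 0 [set a | exists phi : Ck_prod k X,
    Ck_class phi = a /\ Schrodinger_system X c mu phi].

End Schrodinger_map.

Section Wasserstein.
Context {R : realType} {d : nat}.
Local Open Scope ereal_scope.

Definition coupling (mu nu : probability (borel_rV R d) R) :
    set (probability (borel_rV R d * borel_rV R d)%type R) :=
  [set P | forall A : set (borel_rV R d), measurable A ->
    pushforward P fst A = mu A /\ pushforward P snd A = nu A].

Definition sqdist (x y : 'rV[R]_d) : R :=
  (\sum_(l < d) (x ord0 l - y ord0 l) ^+ 2)%R.

Definition W2 (mu nu : probability (borel_rV R d) R) : \bar R :=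
  (ereal_inf [set \int[P]_z (sqdist z.1 z.2)%:E | P in coupling mu nu])
    `^ 2^-1.

Definition prod_W2 {N : nat} (mu nu : 'I_N -> probability (borel_rV R d) R) :
    \bar R :=
  (\sum_i W2 (mu i) (nu i) ^+ 2) `^ 2^-1.

End Wasserstein.

(* Main.v *)
Require Import Defs.
From HB Require Import structures.
From mathcomp Require Import all_boot all_order all_algebra.
From mathcomp Require Import all_classical all_reals all_analysis.
From mathcomp Require Import ring lra measurable_realfun.

(** The cost enters the system only through the kernel K = exp(-g), where g is a
compactly supported C^(k+1) function equal to the cost on the product of the
compact sets ([Ck_bounded_extension]). All derivatives of K of order at most k
are then bounded and Lipschitz, and the system makes sense at every point of
R^d: a family of potentials solves it when exp(phi_i(y)) A_i(y) = 1 for all y,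
A_i(y) being the integral of exp(sum_(j <> i) phi_j(x_j) - g(y, x_-i)) against
the other marginals ([solves]). Every solution on the compact sets extends to
such a global one ([system_bl_solution]).

Integration against the j-th marginal acts on bounded Lipschitz functions of
the whole point as an averaging operator in row j ([avg]). These operators
commute, are monotone, and pull out factors which do not see row j; almost
everything below is a computation with them. Differentiation in row i commutes
with the averages over the other rows ([pderiv_avg]), so that the derivatives
of A_i fall on K alone.

The update -ln A_i has an oscillation and a Lipschitz constant that do not
depend on the potentials ([sinkhorn_regular]). A solution equals its own
update; after constants of zero sum are added to its components to make their
means equal, it is bounded by a constant depending only on N and the bound on
g ([admissible_bound]).

The quantitative core is [key_inequality]. Let u = phi - psi, U = sum_i u_i,
and let r_i be the average over the rows other than i of the density
exp(sum_j phi_j - g). As the exponential is strongly monotone on bounded sets,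
  delta (E|U|)^2 <= sum_i E[u_i (r_i^phi - r_i^psi)],
and with equal means E|u_i| <= 2 E|U| ([equal_means_pdiff]).

Stability. If phi solves the system for mu and psi the one for nu, then
r_i^phi = 1, and r_i^psi, averaged with mu, differs from 1 by at most a
constant times the sum of the bounded Lipschitz distances between the
marginals. The key inequality then bounds E|u_i| linearly in that sum, hence
also A_i^phi - A_i^psi with its derivatives up to order k, and taking
logarithms yields [stability]. As this holds for any two solutions,
it applies to the representatives of the classes S(mu) and S(nu).

Existence. The potentials maximize the concave dual functional E[sum phi] -
E[density]. Replacing phi_i by its update raises it by at least
E[(1 - exp(-s/2))^2], where s is the increment of phi_i ([dual_value_step_ge]),
so near-maximizers nearly solve the system. The key inequality turns this into
a Cauchy estimate for the functions A_i, uniform in y ([approx_cauchy]), and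
their limit gives a solution ([solution_exists]).

Finally a coupling of square transport cost at most w^2 bounds the bounded
Lipschitz distance by a multiple of w ([coupling_BL_dist]), which brings in
the Wasserstein distance. *)

Set Implicit Arguments.
Unset Strict Implicit.
Unset Printing Implicit Defensive.

Import Order.TTheory GRing.Theory Num.Theory.
Import numFieldNormedType.Exports.

Local Open Scope classical_set_scope.
Local Open Scope ring_scope.

(** * Functions with bounds on their partial derivatives *)

Section smooth_classes.
Context {R : realType} {p q : nat}.
Notation mx := 'M[R]_(p, q).
Implicit Types (f g h : mx -> R) (S : pred ('I_p * 'I_q)) (P : (mx -> R) -> Prop).

(** The l1 distance is the convenient one here, because a path changing one entry
at a time has exactly this length. *)
Definition dist1 {p' q'} (x y : 'M[R]_(p', q')) : R :=
  \sum_i \sum_j `|x i j - y i j|.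

Definition BL (M : R) f : Prop :=
  (forall x, `|f x| <= M) /\ (forall x y, `|f x - f y| <= M * dist1 x y).

Definition CB0 (M : R) f : Prop := continuous f /\ forall x, `|f x| <= M.

(** One notion covers the three needed below: [P] is asked of all derivatives of
order at most [k] along the directions in [S]. It is used with [P] continuity
(the C^k functions), with [P] a uniform bound, and with [P] a bounded Lipschitz
condition, [S] being either all directions or those of a single row. *)
Fixpoint smooth S P (k : nat) f : Prop :=
  P f /\ (if k is k'.+1 then forall ij, S ij ->
    (forall x, derivable f x (delta_mx ij.1 ij.2)) /\ smooth S P k' (pderiv ij f)
    else True).

Lemma smooth0 S P k f : smooth S P k f -> P f.
Proof. by case: k => [|k] []. Qed.

Lemma smooth_impl S S' P Q k f : (forall g, P g -> Q g) ->
  (forall ij, S' ij -> S ij) -> smooth S P k f -> smooth S' Q k f.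
Proof.
move=> PQ SS; elim: k f => [|k IH] f [Pf df]; split=> //; try exact: PQ.
by move=> ij /SS /df[d s]; split=> //; exact: IH.
Qed.

Lemma smoothW S P k f : smooth S P k.+1 f -> smooth S P k f.
Proof.
elim: k f => [|k IH] f [Pf df]; split=> //.
by move=> ij /df[d s]; split=> //; exact: IH.
Qed.

Lemma smooth_deriv S P k f ij : smooth S P k.+1 f -> S ij ->
  (forall x, derivable f x (delta_mx ij.1 ij.2)) /\ smooth S P k (pderiv ij f).
Proof. by case=> _ H /H. Qed.

Lemma is_CkE k f : is_Ck k f <-> smooth predT (fun g => continuous g) k f.
Proof.
elim: k f => [|k IH] f /=; first by split=> [|[]].
split=> -[cf df]; split=> // ij; first by move=> _; have [d s] := df ij; split=> //; exact/IH.
by have [d s] := df ij isT; split=> //; exact/IH.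
Qed.

Lemma pderivD ij f g : (forall x, derivable f x (delta_mx ij.1 ij.2)) ->
  (forall x, derivable g x (delta_mx ij.1 ij.2)) ->
  pderiv ij (f + g) = pderiv ij f + pderiv ij g.
Proof. by move=> df dg; apply/funext => x; rewrite /pderiv deriveD. Qed.

Lemma pderivB ij f g : (forall x, derivable f x (delta_mx ij.1 ij.2)) ->
  (forall x, derivable g x (delta_mx ij.1 ij.2)) ->
  pderiv ij (f - g) = pderiv ij f - pderiv ij g.
Proof. by move=> df dg; apply/funext => x; rewrite /pderiv deriveB. Qed.

Lemma pderivM ij f g : (forall x, derivable f x (delta_mx ij.1 ij.2)) ->
  (forall x, derivable g x (delta_mx ij.1 ij.2)) ->
  pderiv ij (f * g) = pderiv ij f * g + f * pderiv ij g.
Proof.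
move=> df dg; apply/funext => x; rewrite /pderiv deriveM// addrC.
by congr (_ + _); exact: mulrC.
Qed.

Lemma pderiv_cst ij (c : R) : pderiv ij (cst c : mx -> R) = cst 0.
Proof. by apply/funext => x; rewrite /pderiv derive_cst. Qed.

Lemma smooth_cst S P k (c : R) : P (cst c) -> P (cst 0) -> smooth S P k (cst c).
Proof.
elim: k c => [|k IH] c Pc P0 /=; split=> // ij _; split=> [x|]; first exact: derivable_cst.
by rewrite pderiv_cst; exact: IH.
Qed.

Lemma smoothD S P Q W k f g : (forall f g, P f -> Q g -> W (f + g)) ->
  smooth S P k f -> smooth S Q k g -> smooth S W k (f + g).
Proof.
move=> PQW; elim: k f g => [|k IH] f g [Pf df] [Qg dg]; split=> //; try exact: PQW.
move=> ij Sij; have [dfij sf] := df ij Sij; have [dgij sg] := dg ij Sij.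
split=> [x|]; first exact: derivableD.
rewrite (pderivD dfij dgij); exact: IH.
Qed.

Lemma smoothB S P Q W k f g : (forall f g, P f -> Q g -> W (f - g)) ->
  smooth S P k f -> smooth S Q k g -> smooth S W k (f - g).
Proof.
move=> PQW; elim: k f g => [|k IH] f g [Pf df] [Qg dg]; split=> //; try exact: PQW.
move=> ij Sij; have [dfij sf] := df ij Sij; have [dgij sg] := dg ij Sij.
split=> [x|]; first exact: derivableB.
rewrite (pderivB dfij dgij); exact: IH.
Qed.

Lemma CB0W M M' f : M <= M' -> CB0 M f -> CB0 M' f.
Proof. by move=> MM [cf bf]; split=> // x; exact: le_trans (bf x) MM. Qed.

Lemma CBW S M M' k f : M <= M' -> smooth S (CB0 M) k f -> smooth S (CB0 M') k f.
Proof. by move=> MM; apply: smooth_impl => // g; exact: CB0W. Qed.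

Lemma CBD S M M' k f g : smooth S (CB0 M) k f -> smooth S (CB0 M') k g ->
  smooth S (CB0 (M + M')) k (f + g).
Proof.
apply: smoothD => {f g} f g [cf bf] [cg bg]; split=> x.
  by apply: continuousD; [exact: cf|exact: cg].
by rewrite fctE (le_trans (ler_normD _ _))// lerD.
Qed.

(** The factor [2 ^+ k] accounts for the two terms of the product rule at each of
the [k] differentiations. *)
Lemma CBM S M M' k f g : smooth S (CB0 M) k f -> smooth S (CB0 M') k g ->
  smooth S (CB0 (2 ^+ k * (M * M'))) k (f * g).
Proof.
have base f' g' : CB0 M f' -> CB0 M' g' -> CB0 (M * M') (f' * g').
  move=> [cf bf] [cg bg]; split=> x.
    by apply: continuousM; [exact: cf|exact: cg].
  by rewrite fctE normrM ler_pM.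
elim: k f g => [|k IH] f g.
  by move=> [Pf _] [Qg _]; split=> //; rewrite expr0 mul1r; exact: base.
move=> sf sg; have Pf := smooth0 sf; have Qg := smooth0 sg.
have MM0 : 0 <= M * M'.
  by rewrite mulr_ge0// (le_trans (normr_ge0 _) (Pf.2 0), le_trans (normr_ge0 _) (Qg.2 0)).
split.
  apply: CB0W (base _ _ Pf Qg); rewrite ler_peMl// exprn_ege1//; lra.
move=> ij Sij; have [dfij sf'] := smooth_deriv sf Sij; have [dgij sg'] := smooth_deriv sg Sij.
split=> [x|]; first exact: derivableM.
rewrite (pderivM dfij dgij) exprS mulr2n mulrDl mul1r mulrDl; apply: CBD.
  by apply: IH => //; exact: smoothW.
by apply: IH => //; exact: smoothW.
Qed.

Lemma is_Ck_cst k (c : R) : is_Ck k (cst c : mx -> R).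
Proof. by apply/is_CkE/smooth_cst => x; exact: cst_continuous. Qed.

Lemma is_CkW k f : is_Ck k.+1 f -> is_Ck k f.
Proof. by move=> /is_CkE ?; apply/is_CkE; exact: smoothW. Qed.

Lemma is_Ck_continuous k f : is_Ck k f -> continuous f.
Proof. by move=> /is_CkE /smooth0. Qed.

Lemma is_CkD k f g : is_Ck k f -> is_Ck k g -> is_Ck k (f + g).
Proof.
move=> /is_CkE sf /is_CkE sg; apply/is_CkE.
move: sf sg; apply: smoothD => {f g} f g cf cg x.
by apply: continuousD; [exact: cf|exact: cg].
Qed.

Lemma is_CkM k f g : is_Ck k f -> is_Ck k g -> is_Ck k (f * g).
Proof.
elim: k f g => [|k IH] f g.
  by move=> cf cg x; apply: continuousM; [exact: cf|exact: cg].
move=> sf sg; split.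
  by move=> x; apply: continuousM; [exact: sf.1|exact: sg.1].
move=> ij; have [dfij sf'] := sf.2 ij; have [dgij sg'] := sg.2 ij.
split=> [x|]; first exact: derivableM.
rewrite (pderivM dfij dgij); apply: is_CkD; apply: IH => //; exact: is_CkW.
Qed.

Lemma is_derive_coord (x v : mx) i j :
  is_derive x v (fun M : mx => M i j) (v i j).
Proof.
have dc : derivable (fun M : mx => M i j) x v.
  exact/diff_derivable/differentiable_coord.
apply: DeriveDef => //.
have := @derive_mx R mx p q id x v (@derivable_id _ _ _ _).
by rewrite derive_id => /matrixP/(_ i j); rewrite mxE.
Qed.

Lemma is_Ck_coord k (i : 'I_p) (j : 'I_q) : is_Ck k (fun x : mx => x i j).
Proof.
case: k => [|k]; first exact: coord_continuous.
split; first exact: coord_continuous.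
move=> ij; split=> [x|]; first by have [] := is_derive_coord x (delta_mx ij.1 ij.2) i j.
rewrite (_ : pderiv _ _ = cst (delta_mx ij.1 ij.2 i j)); first exact: is_Ck_cst.
apply/funext => x; rewrite /pderiv.
by have /@derive_val -> := is_derive_coord x (delta_mx ij.1 ij.2) i j.
Qed.

(** Restricting [f] to the line through [x] directed by [v] reduces the claim to
the chain rule in one variable, so [f] need not be differentiable as a
function of several variables. *)
Lemma is_derive_scomp (h : R -> R) f (x v : mx) (dh : R) :
  derivable f x v -> is_derive (f x) 1 h dh ->
  is_derive x v (h \o f) (dh * 'D_v f x).
Proof.
move=> df dhx.
pose g t := f (t *: v + x).
have /derivable1P dg := df.
have Eg (k : mx -> R) : 'D_v k x = 'D_1 (fun t : R => k (t *: v + x)) (0 : R) :> R.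
  rewrite /derive; set g1 := (X in lim (X @ _)); set g2 := (X in _ = lim (X @ _)).
  suff -> : g1 = g2 by [].
  by rewrite funeqE /g1 /g2 => t /=; rewrite addr0 scale0r add0r [_%:A]mulr1.
have g0 : g 0 = f x by rewrite /g scale0r add0r.
have dh' : derivable h (g 0) 1 by rewrite g0; exact: ex_derive.
have dgd : differentiable g 0 by apply/derivable1_diffP; exact: dg.
have dhd : differentiable h (g 0) by apply/derivable1_diffP.
apply: DeriveDef.
  by apply/derivable1P/derivable1_diffP; exact: differentiable_comp dgd dhd.
have E := derive1_comp (dg : derivable g 0 1) dh'.
rewrite !derive1E in E; rewrite (Eg (h \o f)) (Eg f); apply: etrans E _.
by rewrite g0; congr (_ * _); exact: derive_val.
Qed.

Lemma pderiv_comp (h dh : R -> R) f ij :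
  (forall x, derivable f x (delta_mx ij.1 ij.2)) ->
  (forall x, is_derive (f x) 1 h (dh (f x))) ->
  pderiv ij (h \o f) = (dh \o f) * pderiv ij f /\
  forall x, derivable (h \o f) x (delta_mx ij.1 ij.2).
Proof.
move=> df dhf; split=> [|x].
  apply/funext => x; rewrite /pderiv.
  by have := is_derive_scomp (df x) (dhf x); move=> /@derive_val ->.
by have := is_derive_scomp (df x) (dhf x); move=> /@ex_derive.
Qed.

Lemma CB0_cst S k (c : R) : smooth S (CB0 `|c|) k (cst c).
Proof.
apply: smooth_cst; split=> // x; try exact: cst_continuous.
by rewrite /cst normr0.
Qed.

Lemma CBB S M M' k f g : smooth S (CB0 M) k f -> smooth S (CB0 M') k g ->
  smooth S (CB0 (M + M')) k (f - g).
Proof.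
apply: smoothB => {f g} f g [cf bf] [cg bg]; split=> x.
  by apply: continuousB; [exact: cf|exact: cg].
by rewrite fctE (le_trans (ler_normB _ _))// lerD.
Qed.

Lemma smooth_CB_ge0 S M k f : smooth S (CB0 M) k f -> 0 <= M.
Proof. by move=> /smooth0[_ bf]; rewrite (le_trans _ (bf 0)). Qed.

(** The derivative of 1/f is -(1/f)^2 f', so a bound at order [k] gives one at
order [k.+1]. The bound must not depend on [f], since it enters the final
Lipschitz constant. *)
Lemma CB_inv (m M : R) k : 0 < m -> exists M', forall S f,
  smooth S (CB0 M) k f -> (forall x, m <= f x) ->
  smooth S (CB0 M') k (fun x => (f x)^-1).
Proof.
move=> m0.
have dV (x : R) : x != 0 -> is_derive x 1 (fun t => t^-1) (0 - (x^-1 * x^-1)).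
  move=> x0; apply: is_derive_eq (is_deriveV x0 (is_derive_id x 1)) _.
  by rewrite -[RHS]mulr1 sub0r expr2 invfM.
have base S l f : smooth S (CB0 M) l f -> (forall x, m <= f x) ->
    CB0 m^-1 (fun x => (f x)^-1).
  move=> /smooth0[cf _] mf; split=> x.
    apply: continuousV; last exact: cf.
    by rewrite gt_eqF// (lt_le_trans m0).
  rewrite ger0_norm ?invr_ge0; last exact: le_trans (ltW m0) (mf x).
  by rewrite lef_pV2 ?posrE// (lt_le_trans m0).
elim: k => [|k [M' IH]].
  exists m^-1 => S f sf mf; split=> //; exact: (base S 0%N).
exists (m^-1 + (2 ^+ k * ((0 + 2 ^+ k * (M' * M')) * M))) => S f sf mf.
have M'0 : 0 <= M' by exact: smooth_CB_ge0 (IH S f (smoothW sf) mf).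
have M0 := smooth_CB_ge0 sf.
split.
  apply: CB0W (base _ _ _ sf mf).
  by rewrite lerDl; repeat (rewrite ?mulr_ge0 ?addr_ge0 ?exprn_ge0//).
move=> ij Sij; have [df sdf] := smooth_deriv sf Sij.
have fx0 x : f x != 0 by rewrite gt_eqF// (lt_le_trans m0).
have [-> di] := @pderiv_comp (fun t => t^-1) (fun t => 0 - (t^-1 * t^-1)) f ij df
  (fun x => dV _ (fx0 x)).
split=> //.
apply: (@CBW _ (2 ^+ k * ((0 + 2 ^+ k * (M' * M')) * M))).
  by rewrite lerDr invr_ge0 ltW.
apply: CBM => //.
have sI := IH S f (smoothW sf) mf.
have := CBB (CB0_cst S k 0) (CBM sI sI); rewrite normr0; exact.
Qed.

Lemma ln_Lip (m a b : R) : 0 < m -> m <= a -> m <= b ->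
  `|ln a - ln b| <= m^-1 * `|a - b|.
Proof.
move=> m0; wlog ba : a b / b <= a.
  move=> H; have [ba|/ltW ab] := leP b a; first exact: H.
  by move=> ma mb; rewrite distrC (distrC a); exact: H.
move=> ma mb; have b0 := lt_le_trans m0 mb; have a0 := lt_le_trans m0 ma.
rewrite !ger0_norm ?subr_ge0 ?ler_ln ?posrE//.
rewrite -ln_div ?posrE//; apply: (@le_trans _ _ (a / b - 1)).
  rewrite -{1}[a / b](subrK 1) addrC le_ln1Dx//.
  by rewrite ltrBrDl subrr divr_gt0.
rewrite -[X in _ - X](@divff _ b) ?gt_eqF// -mulrBl mulrC ler_wpM2r ?subr_ge0//.
by rewrite lef_pV2 ?posrE.
Qed.

(** The difference of the logarithmic derivatives is
  f'/f - g'/g = ((f' - g') - (f - g) g' / g) / f,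
in which every term contains [f - g] or a derivative of it; hence the bound is
linear in the size [e] of that difference. *)
Lemma CB_lnB (m M : R) k : 0 < m -> exists2 C, (0 : R) <= C & forall S (e : R) f g,
  smooth S (CB0 M) k f -> smooth S (CB0 M) k g ->
  (forall x, m <= f x) -> (forall x, m <= g x) ->
  smooth S (CB0 e) k (f - g) ->
  smooth S (CB0 (C * e)) k ((@ln R \o f) - (@ln R \o g)).
Proof.
move=> m0; have mV0 : 0 <= m^-1 by rewrite invr_ge0 ltW.
have base e f g : CB0 M f -> CB0 M g -> (forall x, m <= f x) ->
    (forall x, m <= g x) -> CB0 e (f - g) -> CB0 (m^-1 * e) ((@ln R \o f) - (@ln R \o g)).
  move=> [cf _] [cg _] mf mg [_ be]; split=> x.
    apply: continuousB; apply: continuous_comp; try exact: cf; try exact: cg;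
    by apply: continuous_ln; rewrite (lt_le_trans m0).
  by rewrite !fctE/= (le_trans (ln_Lip m0 (mf x) (mg x)))// ler_wpM2l//; exact: be.
case: k => [|k].
  by exists m^-1 => // S e f g [cf _] [cg _] mf mg [be _]; split=> //; exact: base.
have [M' HM'] := CB_inv M k m0.
pose D := 2 ^+ k * (`|M'| * (1 + 2 ^+ k * (2 ^+ k * `|M'| * `|M|))).
have D0 : 0 <= D.
  by rewrite /D; repeat (rewrite ?mulr_ge0 ?addr_ge0 ?exprn_ge0//).
exists (m^-1 + D); first exact: addr_ge0.
move=> S e f g sf sg mf mg sfg.
have e0 := smooth_CB_ge0 sfg.
split.
  apply: CB0W (base e f g (smooth0 sf) (smooth0 sg) mf mg (smooth0 sfg)).
  by rewrite ler_wpM2r// lerDl.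
move=> ij Sij; have [df sdf] := smooth_deriv sf Sij.
have [dg sdg] := smooth_deriv sg Sij; have [_ sdfg] := smooth_deriv sfg Sij.
have fx0 x : 0 < f x by rewrite (lt_le_trans m0).
have gx0 x : 0 < g x by rewrite (lt_le_trans m0).
have [Ef dlf] := pderiv_comp df (fun x => is_derive1_ln (fx0 x)).
have [Eg dlg] := pderiv_comp dg (fun x => is_derive1_ln (gx0 x)).
split=> [x|]; first by apply: derivableB; [exact: dlf|exact: dlg].
rewrite (pderivB dlf dlg) Ef Eg; rewrite (pderivB df dg) in sdfg.
have -> : ((fun t : R => t^-1) \o f) * pderiv ij f -
    ((fun t : R => t^-1) \o g) * pderiv ij g =
    (fun x => (f x)^-1) * ((pderiv ij f - pderiv ij g) -
      ((f - g) * (fun x => (g x)^-1)) * pderiv ij g).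
  apply/funext => x; rewrite !fctE/=.
  have /gt_eqF/negbT fn := fx0 x; have /gt_eqF/negbT gn := gx0 x; field.
  by rewrite fn gn.
have sIf := HM' S f (smoothW sf) mf; have sIg := HM' S g (smoothW sg) mg.
have M'0 := smooth_CB_ge0 sIf; have M0 := smooth_CB_ge0 sf.
apply: CBW (CBM sIf (CBB sdfg (CBM (CBM (smoothW sfg) sIg) sdg))).
have -> : 2 ^+ k * (M' * (e + 2 ^+ k * (2 ^+ k * (e * M') * M))) = D * e.
  by rewrite /D !ger0_norm//; ring.
by rewrite ler_wpM2r// lerDr.
Qed.

(** The case of a single function follows by comparing it with the constant 1,
whose logarithm vanishes. *)
Lemma CB_ln (m M : R) k S f : 0 < m -> smooth S (CB0 M) k f ->
  (forall x, m <= f x) -> exists M', smooth S (CB0 M') k (@ln R \o f).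
Proof.
move=> m0 sf mf; pose M1 := Num.max M 1.
have s1 : smooth S (CB0 M1) k (cst 1).
  by apply: CBW (CB0_cst S k 1); rewrite normr1 le_max lexx orbT.
have m' : 0 < Num.min m 1 by rewrite lt_min m0 ltr01.
have [C C0 /(_ S (M + `|1|) f (cst 1))] := CB_lnB M1 k m'.
move=> H; exists (C * (M + `|1|)).
suff -> : @ln R \o f = (@ln R \o f) - (@ln R \o cst (1 : R)).
  apply: H => //; first by apply: CBW sf; rewrite le_max lexx.
  - by move=> x; rewrite (le_trans _ (mf x))// ge_min lexx.
  - by move=> x; rewrite /cst ge_min lexx orbT.
  - exact: CBB sf (CB0_cst _ _ _).
by apply/funext => x; rewrite !fctE/= ln1 subr0.
Qed.

Lemma CB_expR M k : exists M', forall S f, smooth S (CB0 M) k f ->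
  smooth S (CB0 M') k (@expR R \o f).
Proof.
have base S l f : smooth S (CB0 M) l f -> CB0 (expR M) (@expR R \o f).
  move=> /smooth0[cf bf]; split=> x.
    by apply: continuous_comp; [exact: cf|exact: continuous_expR].
  by rewrite ger0_norm ?expR_ge0//= ler_expR (le_trans (ler_norm _)).
elim: k => [|k [M' IH]].
  by exists (expR M) => S f sf; split=> //; exact: base sf.
exists (expR M + 2 ^+ k * (M' * M)) => S f sf.
have M0 := smooth_CB_ge0 sf; have M'0 := smooth_CB_ge0 (IH S f (smoothW sf)).
split.
  apply: CB0W (base _ _ _ sf); rewrite lerDl.
  by rewrite !mulr_ge0// exprn_ge0.
move=> ij Sij; have [df sdf] := smooth_deriv sf Sij.
have [-> di] := pderiv_comp df (fun x => is_derive_expR (f x)).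
split=> //; apply: CBW (CBM (IH S f (smoothW sf)) sdf).
by rewrite lerDr expR_ge0.
Qed.

(** * Cutoffs and bounded extensions *)

(** The function t_+^n is of class C^(n-1) and vanishes on the negative half-line:
this is all that a cutoff of finite smoothness needs. *)
Definition pospow n (t : R) : R := (Num.max t 0) ^+ n.

Lemma continuous_pospow n : continuous (pospow n).
Proof.
move=> t; rewrite /pospow.
apply: (@continuous_comp _ _ _ (fun t : R => Num.max t 0) (fun t : R => t ^+ n)).
  by apply: continuous_max; [exact: cvg_id|exact: cst_continuous].
exact: exprn_continuous.
Qed.

(** At the origin the difference quotient of t_+^(n+2) is t_+^(n+1), which tends to
0; elsewhere the function is locally a monomial or zero. *)
Lemma is_derive_pospow n (t : R) :
  is_derive t 1 (pospow n.+2) (n.+2%:R * pospow n.+1 t).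
Proof.
have [t0|t0|->] := ltgtP t 0.
- have <- : (0 : R) = n.+2%:R * pospow n.+1 t.
    by rewrite /pospow max_r ?(ltW t0)// expr0n/= mulr0.
  apply: (@near_eq_is_derive _ _ _ (cst 0)).
  near=> u; rewrite /pospow max_r ?expr0n//.
  by apply: ltW; near: u; exact: lt_nbhsl.
- have <- : t ^+ n.+1 *+ n.+2 = n.+2%:R * pospow n.+1 t.
    by rewrite /pospow max_l ?(ltW t0)// mulr_natl.
  apply: (@near_eq_is_derive _ _ _ (fun u : R => u ^+ n.+2)).
    near=> u; rewrite /pospow max_l//.
    by apply: ltW; near: u; exact: lt_nbhsr.
  apply: DeriveDef; first exact: exprn_derivable.
  by rewrite exp_derive /GRing.scale/= mulr1 mulr_natl.
- have P0 m : pospow m.+1 0 = 0 by rewrite /pospow maxxx expr0n.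
  rewrite P0 mulr0.
  have H : h^-1 *: (pospow n.+2 (h *: 1 + 0) - pospow n.+2 0) @[h --> 0^'] --> (0 : R).
    have /continuous_withinNx := @continuous_pospow n.+1 0; rewrite P0 => H.
    apply: cvg_trans H; apply: near_eq_cvg; near=> h.
    have h0 : h != 0 by near: h; exact: nbhs_dnbhs_neq.
    rewrite P0 subr0 addr0 /GRing.scale/= mulr1 /pospow.
    have [hl|hg] := leP h 0; first by rewrite !expr0n/= mulr0.
    by rewrite [in RHS]exprS mulKf.
  by apply: DeriveDef; [apply/cvg_ex; exists 0|exact: cvg_lim H].
Unshelve. all: by end_near. Qed.

Lemma is_Ck_pospow k n f : is_Ck k f -> is_Ck k (pospow (k + n).+1 \o f).
Proof.
elim: k n f => [|k IH] n f sf.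
  by move=> x; apply: continuous_comp; [exact: sf|exact: continuous_pospow].
split.
  move=> x; apply: continuous_comp; last exact: continuous_pospow.
  exact: is_Ck_continuous sf x.
move=> ij; have [df sdf] := sf.2 ij.
have [-> di] := @pderiv_comp (pospow (k + n).+2)
  (fun t => (k + n).+2%:R * pospow (k + n).+1 t) f ij df
  (fun x => is_derive_pospow (k + n) (f x)).
split=> //; apply: is_CkM => //.
rewrite (_ : _ \o f = cst (k + n).+2%:R * (pospow (k + n).+1 \o f)); last by apply/funext.
by apply: is_CkM; [exact: is_Ck_cst|apply: IH; exact: is_CkW].
Qed.

(** With s(x) the sum of the squared entries and Q its largest value on the box of
half-width [r], the function (1 - (s(x) - Q)_+^(k+1))_+^(k+1) equals 1 where
s(x) <= Q and vanishes where s(x) >= Q + 1. *)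
Lemma cutoff_exists k (r : R) : exists (chi : mx -> R) (r' : R), [/\ is_Ck k chi,
  (forall x : mx, (forall i j, `|x i j| <= r) -> chi x = 1) &
  (forall (x : mx) i j, r' < `|x i j| -> chi x = 0)].
Proof.
pose sq (x : mx) : R := \sum_i \sum_j x i j ^+ 2.
pose Q : R := \sum_(i < p) \sum_(j < q) r ^+ 2.
have Ck_sum (I : finType) (F : I -> mx -> R) : (forall i, is_Ck k (F i)) ->
    is_Ck k (fun x => \sum_i F i x).
  move=> sF; rewrite (_ : (fun _ => _) = \sum_i F i).
    by elim/big_ind : _ => //; [exact: is_Ck0|exact: is_CkD].
  by apply/funext => x; rewrite fct_sumE.
have sqC : is_Ck k sq.
  apply: (Ck_sum 'I_p) => i; apply: (Ck_sum 'I_q) => j.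
  rewrite (_ : (fun _ => _) = (fun x : mx => x i j) * (fun x => x i j)).
    by apply: is_CkM; exact: is_Ck_coord.
  by apply/funext => x; rewrite expr2.
exists (pospow k.+1 \o (cst 1 - (pospow k.+1 \o (sq - cst Q)))), (Q + 1).
have E0 t : t <= 0 -> pospow k.+1 t = 0.
  by move=> t0; rewrite /pospow max_r// expr0n.
have pC f : is_Ck k f -> is_Ck k (pospow k.+1 \o f).
  by move=> /(is_Ck_pospow 0); rewrite addn0.
split.
- apply: (pC); apply: is_CkB; first exact: is_Ck_cst.
  by apply: pC; apply: is_CkB => //; exact: is_Ck_cst.
- move=> x xr; change (pospow k.+1 (1 - pospow k.+1 (sq x - Q)) = 1).
  rewrite (E0 (sq x - Q)).
    by rewrite subr0 /pospow max_l ?expr1n.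
  rewrite subr_le0; apply: ler_sum => i _; apply: ler_sum => j _.
  by rewrite -real_normK ?num_real// lerXn2r ?nnegrE// (le_trans _ (xr i j)).
- move=> x i j xr; change (pospow k.+1 (1 - pospow k.+1 (sq x - Q)) = 0).
  rewrite E0// subr_le0.
  rewrite /pospow exprn_ege1// le_max lerBrDl; apply/orP; left.
  have Q0 : 0 <= Q by apply: sumr_ge0 => ? _; apply: sumr_ge0 => ? _; rewrite sqr_ge0.
  apply: (@le_trans _ _ (x i j ^+ 2)).
    rewrite -real_normK ?num_real// (le_trans (ltW xr))// expr2 ler_peMr//.
    by rewrite (le_trans _ (ltW xr))// lerDr.
  rewrite /sq (bigD1 i)//= (bigD1 j)//= -addrA lerDl addr_ge0//.
    by apply: sumr_ge0 => ? _; rewrite sqr_ge0.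
  by apply: sumr_ge0 => ? _; apply: sumr_ge0 => ? _; rewrite sqr_ge0.
Qed.

(** Matrices are flattened to row vectors, among which a product of segments is
compact. *)
Lemma continuous_bounded_box f (r : R) : continuous f ->
  exists M, forall x : mx, (forall i j, `|x i j| <= r) -> `|f x| <= M.
Proof.
move=> cf.
have cv : continuous (fun v : 'rV[R]_(p * q) => vec_mx v : mx).
  move=> v A /nbhs_ballP[e e0 eA]; apply/nbhs_ballP; exists e => // w [_ vw].
  by apply: eA; split=> // i j; rewrite !mxE; exact: vw.
pose K : set 'rV[R]_(p * q) := [set v | forall i, `[- r, r]%classic (v ord0 i)].
have cK : compact K.
  by apply: (@rV_compact R _ (fun=> `[- r, r]%classic)) => _; exact: segment_compact.
have cfv : continuous (f \o (fun v : 'rV[R]_(p * q) => vec_mx v : mx)).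
  by move=> v; apply: continuous_comp; [exact: cv|exact: cf].
have := continuous_compact (continuous_subspaceT cfv) cK.
move=> /compact_bounded[M [_ HM]]; exists (M + 1) => x xr.
apply: (HM (M + 1)); first by rewrite ltrDl.
exists (mxvec x); last by rewrite /= mxvecK.
move=> k; case/mxvec_indexP: k => i j.
by rewrite mxvecE/= in_itv/= -ler_norml xr.
Qed.

(** A derivative of a function vanishing outside a box vanishes there too, so
boundedness on the box propagates to all orders. *)
Lemma CB_compact_support k f (r : R) : is_Ck k f ->
  (forall (x : mx) i j, r < `|x i j| -> f x = 0) ->
  exists M, smooth predT (CB0 M) k f.
Proof.
have base f' : continuous f' -> (forall (x : mx) i j, r < `|x i j| -> f' x = 0) ->
    exists M, CB0 M f'.
  move=> cf f0; have [M HM] := continuous_bounded_box r cf.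
  exists `|M|; split=> // x.
  have [H|/existsNP[i /existsNP[j /negP]]] :=
    pselect (forall i j, `|x i j| <= r); first by rewrite (le_trans (HM x H))// ler_norm.
  by rewrite -ltNge => /f0 ->; rewrite normr0.
elim: k f => [|k IH] f sf f0.
  by have [M HM] := base f sf f0; exists M; split.
have [M HM] := base f sf.1 f0.
have /choice[Mij HMij] : forall ij, exists M', smooth predT (CB0 M') k (pderiv ij f).
  move=> ij; apply: IH; first exact: (sf.2 ij).2.
  move=> x i j xr; rewrite /pderiv (@near_eq_derive _ _ _ f (cst 0)) ?derive_cst//.
  near=> y; apply: (f0 _ i j); near: y.
  have ca : {for x, continuous (fun y : mx => `|y i j|)}.
    by apply: continuous_comp; [exact: coord_continuous|exact: norm_continuous].
  exact: (ca _ (lt_nbhsr xr)).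
exists (`|M| + \sum_ij `|Mij ij|).
have S0 : 0 <= \sum_ij `|Mij ij| by apply: sumr_ge0.
split; first by apply: CB0W HM; rewrite (le_trans (ler_norm M))// lerDl.
move=> ij _; split; first exact: (sf.2 ij).1.
apply: CBW (HMij ij); rewrite (le_trans (ler_norm _))//.
by rewrite (bigD1 ij)//= addrCA lerDl addr_ge0// sumr_ge0.
Unshelve. all: by end_near. Qed.

(** Multiplying an arbitrary C^k extension by a cutoff makes all its derivatives
bounded without changing it on the bounded set [K]. *)
Lemma Ck_bounded_extension k (K : set mx) f (r : R) :
  (forall x i j, K x -> `|x i j| <= r) -> Ck_on k K f ->
  exists g M, {in K, f =1 g} /\ smooth predT (CB0 M) k g.
Proof.
move=> Kr [g [sg fg]].
have [chi [r' [schi chi1 chi0]]] := cutoff_exists k r.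
have [M HM] : exists M, smooth predT (CB0 M) k (chi * g).
  apply: (@CB_compact_support _ _ r'); first exact: is_CkM.
  by move=> x i j xr; rewrite fctE (chi0 x i j)// mul0r.
exists (chi * g), M; split=> // x xK.
rewrite fg// fctE chi1 ?mul1r// => i j; apply: Kr; exact/set_mem.
Qed.

(** * From bounded derivatives to Lipschitz bounds *)

Lemma dist1_ge0 {p' q'} (x y : 'M[R]_(p', q')) : 0 <= dist1 x y.
Proof. by apply: sumr_ge0 => i _; apply: sumr_ge0. Qed.

(** The mean value theorem along a coordinate line; it replaces
differentiability in several variables everywhere below. *)
Lemma line_MVT f ij (x : mx) (t : R) :
  (forall x, derivable f x (delta_mx ij.1 ij.2)) ->
  exists2 c, `|c| <= `|t| & f (t *: delta_mx ij.1 ij.2 + x) - f x =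
    t * pderiv ij f (c *: delta_mx ij.1 ij.2 + x).
Proof.
move=> df; pose v : mx := delta_mx ij.1 ij.2.
have pos y s : 0 <= s -> exists2 c, 0 <= c <= s &
    f (s *: v + y) - f y = s * pderiv ij f (c *: v + y).
  move=> s0; pose g (u : R) := f (u *: v + y).
  have dg (u : R) : is_derive u 1 g (pderiv ij f (u *: v + y)).
    have E : (fun h : R => h^-1 *: (g (h *: 1 + u) - g u)) =
        (fun h : R => h^-1 *: (f (h *: v + (u *: v + y)) - f (u *: v + y))).
      by apply/funext => h; rewrite /g [h%:A]mulr1 scalerDl addrA.
    apply: DeriveDef.
      by have := df (u *: v + y); rewrite /derivable -E.
    by rewrite /pderiv /derive -E.
  have [|c] := @MVT_segment R g (fun u => pderiv ij f (u *: v + y)) 0 s s0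
      (fun u _ => dg u).
    apply: derivable_within_continuous => u _.
    exact: ex_derive.
  rewrite in_itv/= => cs; rewrite /g scale0r add0r subr0 mulrC => E.
  by exists c.
have [t0|/ltW t0] := leP 0 t.
  have [c /andP[c0 ct] E] := pos x t t0.
  by exists c => //; rewrite !ger0_norm.
have [|c /andP[c0 ct] E] := pos (t *: v + x) (- t); first by rewrite oppr_ge0.
exists (c + t); first by rewrite !ler0_norm; move: t0 c0 ct; lra.
move: E; rewrite !addrA -!scalerDl addNr scale0r add0r => E.
by rewrite -opprB E mulNr opprK.
Qed.

Lemma line_Lip (M : R) f ij (x : mx) (t : R) :
  (forall x, derivable f x (delta_mx ij.1 ij.2)) ->
  (forall x, `|pderiv ij f x| <= M) ->
  `|f (t *: delta_mx ij.1 ij.2 + x) - f x| <= M * `|t|.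
Proof.
move=> df bf; have [c _ ->] := line_MVT x t df.
by rewrite normrM mulrC ler_wpM2r.
Qed.

(** Changing the entries one at a time leads from [y] to [x], and each change is
controlled by one partial derivative. *)
Lemma bounded_deriv_Lip (M : R) f : (forall ij x, derivable f x (delta_mx ij.1 ij.2)) ->
  (forall ij x, `|pderiv ij f x| <= M) ->
  forall x y, `|f x - f y| <= M * dist1 x y.
Proof.
move=> df bf x y.
(* the entries listed in [s] are those of [x], the others those of [y] *)
pose mix (s : seq ('I_p * 'I_q)) : mx :=
  \matrix_(i, j) if (i, j) \in s then x i j else y i j.
have H s : uniq s -> `|f (mix s) - f y| <= M * \sum_(ij <- s) `|x ij.1 ij.2 - y ij.1 ij.2|.
  elim: s => [_|ij s IH /= /andP[ijs us]].
    rewrite big_nil mulr0 (_ : mix [::] = y) ?subrr ?normr0//.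
    by apply/matrixP => i j; rewrite mxE.
  rewrite big_cons mulrDr.
  have -> : mix (ij :: s) = (x ij.1 ij.2 - y ij.1 ij.2) *: delta_mx ij.1 ij.2 + mix s.
    apply/matrixP => i j; rewrite !mxE inE.
    case: ij ijs => a b /= ijs; rewrite xpair_eqE.
    have [/= ia|] := eqVneq i a; last by rewrite mulr0 add0r.
    have [/= jb|] := eqVneq j b; last by rewrite mulr0 add0r.
    by subst a b; rewrite (negPf ijs) mulr1 subrK.
  rewrite -[X in X - f y](subrK (f (mix s))) -addrA (le_trans (ler_normD _ _))//.
  by apply: lerD; [exact: line_Lip|exact: IH].
have := H (enum {: 'I_p * 'I_q}) (enum_uniq _).
rewrite (_ : mix _ = x); last first.
  by apply/matrixP => i j; rewrite mxE mem_enum.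
rewrite big_enum/= /dist1 pair_big/=; exact.
Qed.

(** One derivative is traded for a Lipschitz bound. This is where the cost is
needed to be one order smoother than the potentials. *)
Lemma CB_BL S M k f : smooth predT (CB0 M) k.+1 f -> smooth S (BL M) k f.
Proof.
have base f' : smooth predT (CB0 M) 1 f' -> BL M f'.
  move=> [[_ bf] df]; split=> //; apply: bounded_deriv_Lip => ij.
    exact: (df ij isT).1.
  by move=> x; have [_ [[_ H] _]] := df ij isT; exact: H.
elim: k f => [|k IH] f sf; first by split=> //; exact: base.
split.
  exact: smooth0 (IH _ (smoothW sf)).
by move=> ij _; have [df sdf] := smooth_deriv sf (isT : predT ij); split=> //; exact: IH.
Qed.

Lemma BL_continuous M f : BL M f -> continuous f.
Proof.
move=> [bf lf] x; have M0 : 0 <= M by rewrite (le_trans _ (bf 0)).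
pose D : R := M * (p * q)%:R + 1.
have D0 : 0 < D by rewrite ltr_wpDl// mulr_ge0.
move=> A /nbhs_ballP[e /= e0 eA]; apply/nbhs_ballP.
exists (e / D) => [|y [_ xy]]; first by rewrite /= divr_gt0.
apply: eA; rewrite /ball/=; apply: (le_lt_trans (lf x y)).
apply: (@le_lt_trans _ _ (M * \sum_(i < p) \sum_(j < q) (e / D))).
  rewrite ler_wpM2l//; apply: ler_sum => i _; apply: ler_sum => j _.
  exact: ltW (xy i j).
have -> : \sum_(i < p) \sum_(j < q) (e / D) = (p * q)%:R * (e / D).
  by rewrite !sumr_const !card_ord -mulrnA mulr_natl mulnC.
rewrite mulrA mulrA ltr_pdivrMr//.
have -> : e * D = M * ((p * q)%:R * e) + e by rewrite /D; ring.
by rewrite ltrDl.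
Qed.

Lemma BL_smooth_CB S M k f : smooth S (BL M) k f -> smooth S (CB0 M) k f.
Proof.
by apply: smooth_impl => // g bg; split; [exact: BL_continuous bg|exact: bg.1].
Qed.

(** Any extension whose derivatives up to order [k] are bounded by [M] competes in
the infimum; a multi-index derivative is an iteration of first-order ones, each
lowering by one the remaining order of smoothness. *)
Lemma Ck_norm_le k (K : set mx) f g (M : R) : {in K, f =1 g} ->
  smooth predT (CB0 M) k g -> (Ck_norm k K f <= M%:E)%E.
Proof.
move=> fg sg.
have M0 := smooth_CB_ge0 sg.
have it n ij h l : (n <= l)%N -> smooth predT (CB0 M) l h ->
    smooth predT (CB0 M) (l - n) (iter n (pderiv ij) h).
  elim: n => [|n IH] nl sh; first by rewrite subn0.
  have := IH (ltnW nl) sh; rewrite subnS; case: (l - n)%N (subn_gt0 n l) => [|m _].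
    by rewrite nl.
  by move=> /(@smooth_deriv _ _ _ _ ij)/(_ isT)[_].
have P (alpha : @multi_index p q) s : (\sum_(ij <- s) alpha ij <= k)%N ->
    smooth predT (CB0 M) (k - \sum_(ij <- s) alpha ij)
      (foldr (fun ij g => iter (alpha ij) (pderiv ij) g) g s).
  elim: s => [|ij s IH]; first by rewrite big_nil subn0.
  rewrite big_cons /= => H; rewrite addnC subnDA; apply: it.
    by rewrite leq_subRL ?(leq_trans _ H) ?leq_addl// addnC.
  by apply: IH; rewrite (leq_trans _ H)// leq_addl.
apply: (@le_trans _ _ (ereal_sup
      [set `|partial a.1 g a.2|%:E | a in
        [set a : @multi_index p q * mx | (mi_order a.1 <= k)%N]])).
  apply: ereal_inf_lbound; exists g => //; split=> //.
  by apply/is_CkE; move: sg; apply: smooth_impl => // ? [].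
apply: ge_ereal_sup => _ [[alpha x] /= ak <-]; rewrite lee_fin.
have := P alpha (enum {: 'I_p * 'I_q}).
rewrite big_enum/= => /(_ ak) /smooth0[_]; exact.
Qed.

End smooth_classes.

(** * Elementary bounds on the exponential *)

Section exp_bounds.
Context {R : realType}.
Implicit Types a b B : R.

Lemma expRB_ge a b B : `|a| <= B -> `|b| <= B ->
  expR (- B) * `|a - b| <= `|expR a - expR b|.
Proof.
wlog ba : a b / b <= a.
  move=> H; have [ba|/ltW ab] := leP b a; first exact: H.
  by move=> aB bB; rewrite distrC (distrC (expR a)); exact: H.
move=> aB bB; rewrite !ger0_norm ?subr_ge0 ?ler_expR//.
apply: (@le_trans _ _ (expR b * (a - b))).
  by rewrite ler_wpM2r ?subr_ge0// ler_expR; move: bB; rewrite ler_norml => /andP[].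
have -> : expR a = expR b * expR (a - b) by rewrite -expRD addrC subrK.
rewrite -[X in _ <= _ - X]mulr1 -mulrBr ler_wpM2l ?expR_ge0//.
by rewrite lerBrDl expR_ge1Dx.
Qed.

Lemma expRB_le a b B : `|a| <= B -> `|b| <= B ->
  `|expR a - expR b| <= expR B * `|a - b|.
Proof.
wlog ba : a b / b <= a.
  move=> H; have [ba|/ltW ab] := leP b a; first exact: H.
  by move=> aB bB; rewrite distrC (distrC a); exact: H.
move=> aB bB; rewrite !ger0_norm ?subr_ge0 ?ler_expR//.
apply: (@le_trans _ _ (expR a * (a - b))); last first.
  by rewrite ler_wpM2r ?subr_ge0// ler_expR (le_trans (ler_norm _)).
have -> : expR b = expR a * expR (b - a) by rewrite -expRD addrC subrK.
rewrite -[X in X - _ <= _]mulr1 -mulrBr ler_wpM2l ?expR_ge0//.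
by have := expR_ge1Dx (b - a); lra.
Qed.

(** Strong monotonicity of the exponential on [-B, B], the source of the stability
of the potentials. *)
Lemma expRB_monotone a b B : `|a| <= B -> `|b| <= B ->
  expR (- B) * (a - b) ^+ 2 <= (expR a - expR b) * (a - b).
Proof.
move=> aB bB; have -> : (expR a - expR b) * (a - b) = `|expR a - expR b| * `|a - b|.
  have [ba|/ltW ab] := leP b a.
    by rewrite !ger0_norm ?subr_ge0 ?ler_expR.
  by rewrite !ler0_norm ?subr_le0 ?ler_expR// mulrNN.
rewrite -[_ ^+ 2]real_normK ?num_real// expr2 mulrA ler_wpM2r//.
exact: expRB_ge.
Qed.

End exp_bounds.

(** * Bounded Lipschitz functions *)

Section BL_algebra.
Context {R : realType} {p q : nat}.
Notation mx := 'M[R]_(p, q).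
Implicit Types (f g h : mx -> R) (M : R).

Lemma BL_ge0 M f : BL M f -> 0 <= M.
Proof. by move=> [bf _]; rewrite (le_trans _ (bf 0)). Qed.

Lemma BLW M M' f : M <= M' -> BL M f -> BL M' f.
Proof.
move=> MM [bf lf]; split=> [x|x y]; first exact: le_trans (bf x) MM.
by rewrite (le_trans (lf x y))// ler_wpM2r// dist1_ge0.
Qed.

Lemma BL_cst (c : R) : BL `|c| (cst c : mx -> R).
Proof. by split=> // x y; rewrite /cst subrr normr0 mulr_ge0// dist1_ge0. Qed.

Lemma BLD M M' f g : BL M f -> BL M' g -> BL (M + M') (fun x => f x + g x).
Proof.
move=> [bf lf] [bg lg]; split=> [x|x y].
  by rewrite (le_trans (ler_normD _ _))// lerD.
by rewrite opprD addrACA (le_trans (ler_normD _ _))// mulrDl lerD.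
Qed.

Lemma BLN M f : BL M f -> BL M (fun x => - f x).
Proof.
move=> [bf lf]; split=> [x|x y]; first by rewrite normrN.
by rewrite -opprD normrN.
Qed.

Lemma BLB M M' f g : BL M f -> BL M' g -> BL (M + M') (fun x => f x - g x).
Proof. by move=> bf bg; apply: BLD => //; exact: BLN. Qed.

Lemma BLM M M' f g : BL M f -> BL M' g -> BL (2 * (M * M')) (fun x => f x * g x).
Proof.
move=> bf' bg'; have M0 := BL_ge0 bf'; have M'0 := BL_ge0 bg'.
move: bf' bg' => [bf lf] [bg lg]; split=> [x|x y].
  rewrite normrM; apply: (@le_trans _ _ (M * M')); first exact: ler_pM.
  by rewrite ler_peMl ?mulr_ge0// ler1n.
have -> : f x * g x - f y * g y = (f x - f y) * g x + f y * (g x - g y) by ring.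
rewrite (le_trans (ler_normD _ _))// !normrM.
have -> : 2 * (M * M') * dist1 x y = (M * dist1 x y) * M' + M * (M' * dist1 x y) by ring.
by apply: lerD; apply: ler_pM.
Qed.

(** Only the values of [u] on [-M, M] matter, so locally Lipschitz functions such
as the exponential preserve bounded Lipschitz functions. *)
Lemma BL_comp M H H' (u : R -> R) f : BL M f -> 0 <= H' ->
  (forall t, `|t| <= M -> `|u t| <= H) ->
  (forall s t, `|s| <= M -> `|t| <= M -> `|u s - u t| <= H' * `|s - t|) ->
  BL (H + H' * M) (fun x => u (f x)).
Proof.
move=> bl H'0 bu lu; have M0 := BL_ge0 bl; case: bl => bf lf.
have H0 : 0 <= H by rewrite (le_trans _ (bu 0 _))// normr0.
split=> [x|x y]; first by rewrite (le_trans (bu _ (bf x)))// lerDl mulr_ge0.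
rewrite (le_trans (lu _ _ (bf x) (bf y)))//.
apply: (@le_trans _ _ (H' * (M * dist1 x y))); first by rewrite ler_wpM2l.
by rewrite mulrA ler_wpM2r ?dist1_ge0// lerDr.
Qed.

Lemma BL_expR M f : BL M f -> BL (expR M + expR M * M) (fun x => expR (f x)).
Proof.
move=> bf; apply: (BL_comp (u := expR) bf (expR_ge0 M)).
  by move=> t tM; rewrite ger0_norm ?expR_ge0// ler_expR (le_trans (ler_norm _)).
by move=> s t sM tM; exact: expRB_le.
Qed.

Lemma BL_norm M f : BL M f -> BL M (fun x => `|f x|).
Proof.
move=> [bf lf]; split=> [x|x y]; first by rewrite normr_id.
exact: le_trans (ler_dist_dist _ _) (lf x y).
Qed.

Lemma BL_ext M f g : (forall x, f x = g x) -> BL M f -> BL M g.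
Proof. by move=> /funext ->. Qed.

Definition bl f := exists M, BL M f.

Lemma bl_cst c : bl (fun=> c). Proof. by exists `|c|; exact: BL_cst. Qed.
Lemma blD f g : bl f -> bl g -> bl (fun x => f x + g x).
Proof. by move=> [M bf] [M' bg]; exists (M + M'); exact: BLD. Qed.
Lemma blN f : bl f -> bl (fun x => - f x).
Proof. by move=> [M bf]; exists M; exact: BLN. Qed.
Lemma blB f g : bl f -> bl g -> bl (fun x => f x - g x).
Proof. by move=> [M bf] [M' bg]; exists (M + M'); exact: BLB. Qed.
Lemma blM f g : bl f -> bl g -> bl (fun x => f x * g x).
Proof. by move=> [M bf] [M' bg]; exists (2 * (M * M')); exact: BLM. Qed.
Lemma blX2 f : bl f -> bl (fun x => f x ^+ 2).
Proof. by move=> bf; exact: blM. Qed.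
Lemma bl_expR f : bl f -> bl (fun x => expR (f x)).
Proof. by move=> [M bf]; exists (expR M + expR M * M); exact: BL_expR. Qed.
Lemma bl_norm f : bl f -> bl (fun x => `|f x|).
Proof. by move=> [M bf]; exists M; exact: BL_norm. Qed.

Lemma BL_sum (I : Type) (s : seq I) (P : pred I) (F : I -> mx -> R) (M : I -> R) :
  (forall i, P i -> BL (M i) (F i)) ->
  BL (\sum_(i <- s | P i) M i) (fun x => \sum_(i <- s | P i) F i x).
Proof.
move=> H; elim: s => [|i s IH].
  rewrite big_nil; apply: (@BL_ext _ (fun=> 0)); first by move=> x; rewrite big_nil.
  by have := BL_cst 0; rewrite normr0.
rewrite big_cons; case: ifP => Pi.
  apply: (BL_ext _ (BLD (H i Pi) IH)) => x; by rewrite big_cons Pi.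
by apply: (BL_ext _ IH) => x; rewrite big_cons Pi.
Qed.

Lemma bl_sum (I : Type) (s : seq I) (P : pred I) (F : I -> mx -> R) :
  (forall i, P i -> bl (F i)) -> bl (fun x => \sum_(i <- s | P i) F i x).
Proof.
move=> H; have /choice[M HM] : forall i, exists M, P i -> BL M (F i).
  by move=> i; case: (boolP (P i)) => [/H[M HM]|_]; [exists M|exists 0].
by exists (\sum_(i <- s | P i) M i); exact: BL_sum.
Qed.

Lemma bl_continuous f : bl f -> continuous f.
Proof. by move=> [M]; exact: BL_continuous. Qed.

End BL_algebra.

(** * Borel measurability and expectations *)

Section Borel.
Context {R : realType} {p q : nat}.
Notation mx := 'M[R]_(p, q).

(** An open set of matrices is a countable union of boxes with rational corners.
Measurability of the entries therefore suffices, whatever the sigma-algebra on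
the source; in particular it may be a product of Borel sigma-algebras. *)
Lemma measurable_continuous_mx d (T : measurableType d) (U : T -> mx) (f : mx -> R) :
  (forall i j, measurable_fun setT (fun t => U t i j)) -> continuous f ->
  measurable_fun setT (fun t => f (U t)).
Proof.
move=> mU cf; apply: (measurability _ (measurable_realfun.RGenOpens.measurableE R)) => _ [_ [a
  [b ->]] <-].
rewrite setTI.
pose O : set mx := f @^-1` `]a, b[%classic.
have oO : open O by move/continuousP : cf; apply; exact: interval_open.
(* boxes with rational corners, of which there are countably many *)
pose box (c : {ffun 'I_p * 'I_q -> rat * rat}) : set mx :=
  [set x | forall ij, ratr (c ij).1 < x ij.1 ij.2 < ratr (c ij).2].
have -> : (fun t => f (U t)) @^-1` `]a, b[%classic =
    \bigcup_(c in [set c | box c `<=` O]) U @^-1` box c.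
  apply/seteqP; split=> [t /= Ot|t [c cO /cO]//].
  have /nbhs_ballP[e /= e0 eO] : nbhs (U t) O by exact: open_nbhs_nbhs.
  have /choice[c Hc] : forall ij, exists c : rat * rat,
      [/\ U t ij.1 ij.2 - e < ratr c.1, ratr c.1 < U t ij.1 ij.2,
       U t ij.1 ij.2 < ratr c.2 & ratr c.2 < U t ij.1 ij.2 + e].
    move=> ij; set u := U t ij.1 ij.2.
    have [|r1] := @rat_in_itvoo R (u - e) u; first by rewrite ltrBlDr ltrDl.
    have [|r2] := @rat_in_itvoo R u (u + e); first by rewrite ltrDl.
    by rewrite !in_itv/= => /andP[? ?] /andP[? ?]; exists (r1, r2).
  exists (finfun c); last by move=> ij; rewrite ffunE; have [_ -> ->] := Hc ij.
  move=> x /= xc; apply: eO; split=> // i j; rewrite /ball/=.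
  have := xc (i, j); rewrite ffunE => /andP[h1 h2]; have [h3 h4 h5 h6] := Hc (i, j).
  move: h1 h2 h3 h4 h5 h6 => /= h1 h2 h3 h4 h5 h6.
  by rewrite ltr_distlC; apply/andP; split; lra.
rewrite bigcup_mkcond; apply: countable_bigcupT_measurable; first exact: countableP.
move=> c; case: ifPn => // _.
have -> : U @^-1` box c = \bigcap_ij [set t | ratr (c ij).1 < U t ij.1 ij.2 < ratr (c ij).2].
  by apply/seteqP; split=> [t H ij _|t H ij]; exact: H.
apply: fin_bigcap_measurable => [|ij _]; first exact: finite_finset.
have := mU ij.1 ij.2 measurableT `]ratr (c ij).1, ratr (c ij).2[%classic.
rewrite setTI (_ : _ @^-1` _ = [set t | ratr (c ij).1 < U t ij.1 ij.2 < ratr (c ij).2]).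
  by apply; exact: measurable_itv.
by apply/seteqP; split=> t /=; rewrite in_itv.
Qed.

End Borel.

Section Borel_rV.
Context {R : realType} {d : nat}.

Lemma measurable_borel_coord i j :
  measurable_fun setT (fun x : borel_rV R d => (x : 'rV[R]_d) i j).
Proof.
apply: (measurability _ (measurable_realfun.RGenOpens.measurableE R)) => _ [_ [a [b ->]] <-].
rewrite setTI; apply: sub_sigma_algebra.
have /continuousP := @coord_continuous R 1 d i j; apply; exact: interval_open.
Qed.

Lemma measurable_borel_continuous (f : 'rV[R]_d -> R) : continuous f ->
  measurable_fun setT (f : borel_rV R d -> R).
Proof.
move=> cf; apply: (@measurable_continuous_mx R 1 d _ _ (fun x : borel_rV R d => x)) => //.
exact: measurable_borel_coord.
Qed.

End Borel_rV.

Section expectation.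
Context {d : measure_display} {T : measurableType d} {R : realType}.
Variable P : probability T R.
Implicit Types f g : T -> R.

(** On a probability space bounded measurable functions are integrable; they
contain all the integrands met below. *)
Definition bmeas f := measurable_fun setT f /\ exists M : R, forall x, `|f x| <= M.

Lemma bmeas_integrable f : bmeas f -> P.-integrable setT (EFin \o f).
Proof.
move=> [mf [M HM]]; apply: measurable_bounded_integrable => //.
  by rewrite [X in (X < _)%E]probability_setT ltry.
by exists M; split; rewrite ?num_real// => N MN x _; exact: le_trans (HM x) (ltW MN).
Qed.

Definition expect f : R := (\int[P]_x f x)%R.

Lemma expectE f : bmeas f -> (\int[P]_x (f x)%:E)%E = (expect f)%:E.
Proof.
move=> bf; rewrite /expect /Rintegral fineK//.
exact: (integrable_fin_num measurableT (bmeas_integrable bf)).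
Qed.

Lemma expectD f g : bmeas f -> bmeas g -> expect (fun x => f x + g x) = expect f + expect g.
Proof. by move=> bf bg; apply: RintegralD => //; exact: bmeas_integrable. Qed.

Lemma expectB f g : bmeas f -> bmeas g -> expect (fun x => f x - g x) = expect f - expect g.
Proof. by move=> bf bg; apply: RintegralB => //; exact: bmeas_integrable. Qed.

Lemma expectZ (c : R) f : bmeas f -> expect (fun x => c * f x) = c * expect f.
Proof. by move=> bf; apply: RintegralZl => //; exact: bmeas_integrable. Qed.

Lemma expect_cst (c : R) : expect (fun=> c) = c.
Proof.
rewrite /expect (Rintegral_cst P measurableT).
by rewrite -[RHS]mulr1; congr (c * _); exact: (congr1 fine (probability_setT P)).
Qed.

Lemma expect_le f g : bmeas f -> bmeas g -> (forall x, f x <= g x) -> expect f <= expect g.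
Proof. by move=> bf bg fg; apply: le_Rintegral => //; exact: bmeas_integrable. Qed.

Lemma expect_norm f M : bmeas f -> (forall x, `|f x| <= M) -> `|expect f| <= M.
Proof.
move=> bf fM; apply: (le_trans (le_normr_Rintegral measurableT (bmeas_integrable bf))).
rewrite -[leRHS]expect_cst; apply: le_Rintegral => //.
- apply: (@bmeas_integrable (fun x => `|f x|)); split.
    by apply: measurableT_comp => //; exact: bf.1.
  by exists M => x; rewrite normr_id.
- by apply: (@bmeas_integrable (fun=> M)); split => //; exists `|M|.
Qed.

End expectation.

Section expectation_fubini.
Context {d1 d2 : measure_display} {T1 : measurableType d1} {T2 : measurableType d2}
  {R : realType}.
Variables (P : probability T1 R) (Q : probability T2 R) (f : T1 * T2 -> R).
Hypothesis bf : bmeas f.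

Let PQi : (P \x Q)%E.-integrable setT (EFin \o f).
Proof. exact: (bmeas_integrable (P \x Q)%E bf). Qed.

Lemma bmeas_sect1 x : bmeas (fun y => f (x, y)).
Proof.
case: bf => mf [M HM]; split; last by exists M.
by apply: (measurableT_comp mf); exact: measurable_pair1.
Qed.

Lemma bmeas_sect2 y : bmeas (fun x => f (x, y)).
Proof.
case: bf => mf [M HM]; split; last by exists M.
by apply: (measurableT_comp mf); exact: measurable_pair2.
Qed.

Lemma expect_prod1 : (\int[(P \x Q)%E]_z (f z)%:E)%E =
  (\int[P]_x (expect Q (fun y => f (x, y)))%:E)%E.
Proof.
rewrite -(integral12_prod_meas1 PQi); apply: eq_integral => x _.
by rewrite -(expectE Q (bmeas_sect1 x)).
Qed.

Lemma expect_fubini : expect P (fun x => expect Q (fun y => f (x, y))) =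
  expect Q (fun y => expect P (fun x => f (x, y))).
Proof.
rewrite /expect /Rintegral; congr fine.
transitivity (\int[P]_x \int[Q]_y (f (x, y))%:E)%E.
  by apply: eq_integral => x _; rewrite (expectE Q (bmeas_sect1 x)).
rewrite (Fubini PQi); apply: eq_integral => y _.
by rewrite /= (expectE P (bmeas_sect2 y)).
Qed.

End expectation_fubini.

(** * Averaging over rows *)

Section partial_expectation.
Context {R : realType} {N d : nat}.
Notation mx := 'M[R]_(N, d).
Notation rv := 'rV[R]_d.
Notation prob := (probability (borel_rV R d) R).
Implicit Types (f g h : mx -> R) (mu nu : 'I_N -> prob) (x y : mx) (i j : 'I_N).

Definition set_row x j (y : rv) : mx := \matrix_(i, l) if i == j then y ord0 l else x i l.

Lemma set_rowE x j (y : rv) : row j (set_row x j y) = y.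
Proof. by apply/rowP => l; rewrite !mxE eqxx. Qed.

Lemma set_row_ne x i j (y : rv) : i != j -> row i (set_row x j y) = row i x.
Proof. by move=> /negPf ij; apply/rowP => l; rewrite !mxE ij. Qed.

Lemma set_row_set_row x j (y z : rv) : set_row (set_row x j y) j z = set_row x j z.
Proof. by apply/matrixP => i l; rewrite !mxE; case: eqP. Qed.

Lemma set_rowC x i j (y z : rv) : i != j ->
  set_row (set_row x i y) j z = set_row (set_row x j z) i y.
Proof.
move=> ij; apply/matrixP => k l; rewrite !mxE.
by have [->|//] := eqVneq k j; rewrite eq_sym (negPf ij).
Qed.

Lemma set_row_id x j : set_row x j (row j x) = x.
Proof. by apply/matrixP => i l; rewrite !mxE; case: eqP => // ->. Qed.

Lemma dist1_set_row x x' j (y : rv) : dist1 (set_row x j y) (set_row x' j y) <= dist1 x x'.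
Proof.
apply: ler_sum => i _; apply: ler_sum => l _; rewrite !mxE.
by case: eqP => // _; rewrite subrr normr0.
Qed.

Lemma dist1_set_row_same x j (y y' : rv) : dist1 (set_row x j y) (set_row x j y') = dist1 y y'.
Proof.
rewrite /dist1 big_ord1 (bigD1 j)//= [X in _ + X]big1 ?addr0.
  by apply: eq_bigr => l _; rewrite !mxE eqxx.
by move=> i /negPf ij; rewrite big1// => l _; rewrite !mxE ij subrr normr0.
Qed.

Lemma dist1_row x y i : dist1 (row i x) (row i y) <= dist1 x y.
Proof.
rewrite /dist1 big_ord1 (bigD1 i)//=.
under eq_bigr => l _ do rewrite !mxE.
by rewrite lerDl; apply: sumr_ge0 => k _; apply: sumr_ge0.
Qed.

Lemma BL_set_row M f x j : BL M f -> BL M (fun y : rv => f (set_row x j y)).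
Proof.
by move=> [bf lf]; split=> // y z; rewrite (le_trans (lf _ _))// dist1_set_row_same.
Qed.

Lemma BL_row M (u : rv -> R) i : BL M u -> BL M (fun x => u (row i x)).
Proof.
move=> bu; have M0 := BL_ge0 bu; case: bu => bf lf; split=> // x y.
by rewrite (le_trans (lf _ _))// ler_wpM2l// dist1_row.
Qed.

Lemma bl_row (u : rv -> R) i : bl u -> bl (fun x => u (row i x)).
Proof. by move=> [M bu]; exists M; exact: BL_row. Qed.

Lemma bl_bmeas (u : rv -> R) : bl u -> bmeas (u : borel_rV R d -> R).
Proof.
move=> [M bu]; split; last by exists M; exact: bu.1.
by apply: measurable_borel_continuous; exact: BL_continuous bu.
Qed.

Lemma bl_set_row_bmeas f x j : bl f -> bmeas (fun y : borel_rV R d => f (set_row x j y)).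
Proof.
move=> [M bf]; have := @bl_bmeas (fun y : rv => f (set_row x j y)); apply.
by exists M; exact: BL_set_row.
Qed.

(** The [j]-th marginal acts on functions of the whole point, leaving a function of
the whole point that no longer depends on row [j]. Keeping all functions on
the same space avoids transporting them between partial products. *)
Definition avg mu j f x : R := expect (mu j) (fun y : borel_rV R d => f (set_row x j y)).

Lemma avg_ext mu j f g : (forall x, f x = g x) -> forall x, avg mu j f x = avg mu j g x.
Proof. by move=> /funext ->. Qed.

Lemma avgB mu j f g x : bl f -> bl g ->
  avg mu j (fun x => f x - g x) x = avg mu j f x - avg mu j g x.
Proof. by move=> bf bg; rewrite /avg expectB//; exact: bl_set_row_bmeas. Qed.

Lemma avgD mu j f g x : bl f -> bl g ->
  avg mu j (fun x => f x + g x) x = avg mu j f x + avg mu j g x.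
Proof. by move=> bf bg; rewrite /avg expectD//; exact: bl_set_row_bmeas. Qed.

Lemma avgZ mu j (c : R) f x : bl f ->
  avg mu j (fun x => c * f x) x = c * avg mu j f x.
Proof. by move=> bf; rewrite /avg expectZ//; exact: bl_set_row_bmeas. Qed.

Lemma avg_cst mu j (c : R) x : avg mu j (fun=> c) x = c.
Proof. exact: expect_cst. Qed.

Lemma avg_le mu j f g x : bl f -> bl g -> (forall x, f x <= g x) ->
  avg mu j f x <= avg mu j g x.
Proof. by move=> bf bg fg; apply: expect_le => //; exact: bl_set_row_bmeas. Qed.

(** Averaging preserves bounded Lipschitz functions with the same constant, because
replacing the same row of two points does not increase their distance. *)
Lemma BL_avg mu j M f : BL M f -> BL M (avg mu j f).
Proof.
move=> bf; have bf' : bl f by exists M.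
split=> [x|x y].
  by apply: expect_norm; [exact: bl_set_row_bmeas|move=> z; exact: bf.1].
rewrite /avg -expectB; [|exact: bl_set_row_bmeas..].
have bfx z := bl_set_row_bmeas z j bf'.
apply: expect_norm.
  have : bl (fun z : rv => f (set_row x j z) - f (set_row y j z)).
    by apply: blB; exists M; exact: BL_set_row.
  exact: bl_bmeas.
move=> z; rewrite (le_trans (bf.2 _ _))// ler_wpM2l ?(BL_ge0 bf)//.
exact: dist1_set_row.
Qed.

(** This is the Fubini theorem for the function of two rows obtained by freezing
all the others. *)
Lemma avgC mu i j f x : bl f ->
  avg mu i (avg mu j f) x = avg mu j (avg mu i f) x.
Proof.
move=> bf; have [->//|ij] := eqVneq i j.
pose F (z : borel_rV R d * borel_rV R d) := f (set_row (set_row x i z.1) j z.2).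
have bF : bmeas F.
  split; last by case: bf => M [HM _]; exists M => z; exact: HM.
  apply: (@measurable_continuous_mx R N d _ _
    (fun z : borel_rV R d * borel_rV R d => set_row (set_row x i z.1) j z.2));
      last exact: bl_continuous.
  move=> k l; under eq_fun do rewrite !mxE.
  case: (k == j).
    by apply: (measurableT_comp (measurable_borel_coord ord0 l)); exact: measurable_snd.
  case: (k == i); last exact: measurable_cst.
  by apply: (measurableT_comp (measurable_borel_coord ord0 l)); exact: measurable_fst.
have := expect_fubini (mu i) (mu j) bF; rewrite /F /avg /= => ->.
by congr expect; apply/funext => y; congr expect; apply/funext => z; rewrite set_rowC.
Qed.

Definition row_indep j h := forall x (y : rv), h (set_row x j y) = h x.

Lemma row_indep_avg mu j f : row_indep j (avg mu j f).
Proof. by move=> x y; rewrite /avg; congr expect; apply/funext => z; rewrite set_row_set_row. Qed.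

Lemma row_indep_avg_ne mu i j f : row_indep i f -> row_indep i (avg mu j f).
Proof.
move=> fi; have [->|ij] := eqVneq i j; first exact: row_indep_avg.
by move=> x y; rewrite /avg; congr expect; apply/funext => z; rewrite set_rowC.
Qed.

Lemma avg_pull mu j h f x : bl f -> row_indep j h ->
  avg mu j (fun x => h x * f x) x = h x * avg mu j f x.
Proof.
move=> bf hj; rewrite /avg -expectZ; last exact: bl_set_row_bmeas.
by congr expect; apply/funext => y; rewrite hj.
Qed.

Definition avgs mu (s : seq 'I_N) f : mx -> R := foldr (avg mu) f s.

Lemma BL_avgs mu s M f : BL M f -> BL M (avgs mu s f).
Proof. by move=> bf; elim: s => //= j s IH; exact: BL_avg. Qed.

Lemma bl_avgs mu s f : bl f -> bl (avgs mu s f).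
Proof. by move=> [M bf]; exists M; exact: BL_avgs. Qed.

Lemma avgs_ext mu s f g x : (forall x, f x = g x) -> avgs mu s f x = avgs mu s g x.
Proof. by move=> /funext ->. Qed.

Lemma avgsB mu s f g x : bl f -> bl g ->
  avgs mu s (fun x => f x - g x) x = avgs mu s f x - avgs mu s g x.
Proof.
move=> bf bg; elim: s x => //= j s IH x.
by rewrite (avg_ext _ _ IH) avgB//; exact: bl_avgs.
Qed.

Lemma avgsD mu s f g x : bl f -> bl g ->
  avgs mu s (fun x => f x + g x) x = avgs mu s f x + avgs mu s g x.
Proof.
move=> bf bg; elim: s x => //= j s IH x.
by rewrite (avg_ext _ _ IH) avgD//; exact: bl_avgs.
Qed.

Lemma avgs_pull mu s h f x : bl f -> (forall j, j \in s -> row_indep j h) ->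
  avgs mu s (fun x => h x * f x) x = h x * avgs mu s f x.
Proof.
move=> bf; elim: s x => //= j s IH x hs.
rewrite (avg_ext _ _ (g := fun x => h x * avgs mu s f x)); last first.
  by move=> z; apply: IH => k ks; apply: hs; rewrite inE ks orbT.
by rewrite avg_pull//; [exact: bl_avgs|apply: hs; rewrite inE eqxx].
Qed.

Lemma avgs_cst mu s (c : R) x : avgs mu s (fun=> c) x = c.
Proof.
elim: s x => //= j s IH x; by rewrite (avg_ext _ _ IH) avg_cst.
Qed.

Lemma avgsZ mu s (c : R) f x : bl f -> avgs mu s (fun x => c * f x) x = c * avgs mu s f x.
Proof. by move=> bf; apply: (@avgs_pull mu s (fun=> c)). Qed.

Lemma avgs_row_indep mu s h x : (forall j, j \in s -> row_indep j h) -> avgs mu s h x = h x.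
Proof.
move=> hs; transitivity (avgs mu s (fun x => h x * 1) x).
  by apply: avgs_ext => z; rewrite mulr1.
by rewrite avgs_pull ?avgs_cst ?mulr1//; exact: bl_cst.
Qed.

Lemma avgs_le mu s f g x : bl f -> bl g -> (forall x, f x <= g x) ->
  avgs mu s f x <= avgs mu s g x.
Proof.
move=> bf bg fg; elim: s x => //= j s IH x.
by apply: avg_le => //; exact: bl_avgs.
Qed.

Lemma avgs_norm mu s f x : bl f -> `|avgs mu s f x| <= avgs mu s (fun x => `|f x|) x.
Proof.
move=> bf; rewrite ler_norml; apply/andP; split.
  rewrite -[_ f x]opprK lerN2 -mulN1r -avgsZ//.
  apply: avgs_le; [|exact: bl_norm|by move=> z; rewrite mulN1r -normrN ler_norm].
  by apply: blM => //; exact: bl_cst.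
by apply: avgs_le => //; [exact: bl_norm|move=> z; exact: ler_norm].
Qed.

Lemma avgs_sum mu s (I : Type) (r : seq I) (F : I -> mx -> R) x : (forall a : I, bl (F a)) ->
  avgs mu s (fun x => \sum_(a <- r) F a x) x = \sum_(a <- r) avgs mu s (F a) x.
Proof.
move=> bF; elim: r => [|i r IH].
  by rewrite big_nil (avgs_ext _ _ (g := fun=> 0)) ?avgs_cst// => z; rewrite big_nil.
rewrite big_cons -IH -avgsD//; last exact: bl_sum.
by apply: avgs_ext => z; rewrite big_cons.
Qed.

Lemma row_indep_avgs mu s j f : (j \in s) || `[<row_indep j f>] -> row_indep j (avgs mu s f).
Proof.
elim: s => /= [/asboolP//|k s IH].
rewrite inE -orbA => /orP[/eqP ->|/IH H]; first exact: row_indep_avg.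
exact: row_indep_avg_ne.
Qed.

Lemma avgs_cat mu s s' f : avgs mu (s ++ s') f = avgs mu s (avgs mu s' f).
Proof. by rewrite /avgs foldr_cat. Qed.

Lemma avgs_rcons mu s j f x : bl f -> avgs mu (rcons s j) f x = avgs mu (j :: s) f x.
Proof.
move=> bf; rewrite -cats1 avgs_cat; elim: s x => //= k s IH x.
rewrite (avg_ext _ _ IH) /= avgC//.
exact: bl_avgs.
Qed.

(** Commutation makes iterated averages independent of the order of the rows. *)
Lemma avgs_perm mu s s' f x : bl f -> perm_eq s s' -> avgs mu s f x = avgs mu s' f x.
Proof.
move=> bf; elim: s s' x => [|j s IH] s' x.
  by rewrite perm_sym => /perm_nilP ->.
move=> pss'; have js' : j \in s' by rewrite -(perm_mem pss') inE eqxx.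
case/splitPr: js' pss' => s1 s2 pss'.
rewrite -cat_rcons avgs_cat avgs_rcons; last exact: bl_avgs.
rewrite /= ; apply: avg_ext => z; rewrite -avgs_cat; apply: IH.
by rewrite -(perm_cons j) (perm_trans pss')// -cat1s perm_catCA.
Qed.

Definition others i : seq 'I_N := rem i (enum 'I_N).

Lemma mem_others i j : (j \in others i) = (j != i).
Proof. by rewrite mem_rem_uniq ?enum_uniq// inE/= mem_enum andbT. Qed.

Lemma perm_others i : perm_eq (enum 'I_N) (i :: others i).
Proof. by apply: perm_to_rem; rewrite mem_enum. Qed.

(** Two points are linked by replacing the rows one after the other. *)
Lemma row_indep_all h x y : (forall j, row_indep j h) -> h x = h y.
Proof.
move=> hj.
have H s : h (foldr (fun j z => set_row z j (row j x)) y s) = h y.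
  by elim: s => //= j s IH; rewrite hj.
(* replacing all the rows of [y] by those of [x] yields [x] *)
rewrite -(H (enum 'I_N)); congr h; apply/matrixP => i l.
have E s : i \in s -> foldr (fun j z => set_row z j (row j x)) y s i l = x i l.
  elim: s => //= j s IH; rewrite inE !mxE; case: eqVneq => [-> //|ij /=].
  by move=> is_; rewrite IH.
by rewrite E// mem_enum.
Qed.

(** The full expectation; the base point 0 is immaterial, since averaging over all
rows leaves a constant function. *)
Definition avg_all mu f : R := avgs mu (enum 'I_N) f 0.

Lemma avg_all_ext mu f g : (forall x, f x = g x) -> avg_all mu f = avg_all mu g.
Proof. exact: avgs_ext. Qed.

Lemma avg_allD mu f g : bl f -> bl g ->
  avg_all mu (fun x => f x + g x) = avg_all mu f + avg_all mu g.
Proof. exact: avgsD. Qed.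

Lemma avg_allB mu f g : bl f -> bl g ->
  avg_all mu (fun x => f x - g x) = avg_all mu f - avg_all mu g.
Proof. exact: avgsB. Qed.

Lemma avg_allZ mu (c : R) f : bl f -> avg_all mu (fun x => c * f x) = c * avg_all mu f.
Proof. exact: avgsZ. Qed.

Lemma avg_all_cst mu (c : R) : avg_all mu (fun=> c) = c.
Proof. exact: avgs_cst. Qed.

Lemma avg_all_le mu f g : bl f -> bl g -> (forall x, f x <= g x) -> avg_all mu f <= avg_all mu g.
Proof. exact: avgs_le. Qed.

Lemma avg_all_norm mu f : bl f -> `|avg_all mu f| <= avg_all mu (fun x => `|f x|).
Proof. exact: avgs_norm. Qed.

Lemma avg_all_norm_ge0 mu f : bl f -> 0 <= avg_all mu (fun x => `|f x|).
Proof. by move=> bf; apply: le_trans (avg_all_norm mu bf). Qed.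

Lemma avg_all_sum mu (I : Type) (r : seq I) (F : I -> mx -> R) : (forall a : I, bl (F a)) ->
  avg_all mu (fun x => \sum_(a <- r) F a x) = \sum_(a <- r) avg_all mu (F a).
Proof. exact: avgs_sum. Qed.

(** Averaging first over the rows other than [i] does not change the expectation:
the tower property of conditional expectations. *)
Lemma avg_all_tower mu i f : bl f -> avg_all mu (avgs mu (others i) f) = avg_all mu f.
Proof.
move=> bf; rewrite /avg_all (avgs_perm _ _ bf (perm_others i)).
rewrite (avgs_perm _ _ (bl_avgs _ _ bf) (perm_others i)) /=; apply: avg_ext => z.
by apply: avgs_row_indep => j js; apply: row_indep_avgs; rewrite js.
Qed.

(** Against a function of row [i] alone, [f] can be replaced by its average over
the other rows. *)
Lemma avg_all_pull mu i h f : bl h -> bl f -> (forall j, j != i -> row_indep j h) ->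
  avg_all mu (fun x => h x * f x) = avg_all mu (fun x => h x * avgs mu (others i) f x).
Proof.
move=> bh bf hi; rewrite -(avg_all_tower mu i (blM bh bf)); apply: avg_all_ext => x.
by rewrite avgs_pull// => j; rewrite mem_others; exact: hi.
Qed.

Lemma row_indep_other_row (u : rv -> R) i j : j != i -> row_indep j (fun x => u (row i x)).
Proof. by move=> ji x y; rewrite set_row_ne// eq_sym. Qed.

Lemma avgs_others_row mu (u : rv -> R) i j x : bl u -> j != i ->
  avgs mu (others i) (fun x => u (row j x)) x = avg_all mu (fun x => u (row j x)).
Proof.
move=> bu ji; have bru := bl_row j bu.
have H z : avgs mu (others i) (fun x => u (row j x)) z =
    avgs mu (others i) (fun x => u (row j x)) 0.
  apply: row_indep_all => l; apply: row_indep_avgs; rewrite mem_others.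
  have [->|//] := eqVneq l i; apply/asboolP.
  by apply: row_indep_other_row; rewrite eq_sym.
by rewrite H -(avg_all_tower mu i bru) (avg_all_ext _ H) avg_all_cst.
Qed.

(** With a the mean of |f|, this is the nonnegativity of the expectation of
(|f| - a)^2. *)
Lemma avg_all_norm_sqr mu f : bl f ->
  avg_all mu (fun x => `|f x|) ^+ 2 <= avg_all mu (fun x => f x ^+ 2).
Proof.
move=> bf; set a := avg_all mu (fun x => `|f x|).
have bn := bl_norm bf.
have : 0 <= avg_all mu (fun x => f x ^+ 2 + (- (2 * a) * `|f x| + a ^+ 2)).
  rewrite -(avg_all_cst mu 0); apply: avg_all_le; first exact: bl_cst.
    by apply: blD; [exact: blX2|apply: blD; [apply: blM => //; exact: bl_cst|exact: bl_cst]].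
  move=> x; rewrite -real_normK ?num_real//.
  have -> : `|f x| ^+ 2 + (- (2 * a) * `|f x| + a ^+ 2) = (`|f x| - a) ^+ 2 by ring.
  exact: sqr_ge0.
rewrite avg_allD; [|exact: blX2|apply: blD; [apply: blM => //; exact: bl_cst|exact: bl_cst]].
rewrite avg_allD; [|apply: blM => //; exact: bl_cst|exact: bl_cst].
rewrite avg_allZ// avg_all_cst -/a => H; rewrite -subr_ge0.
by apply: le_trans H _; rewrite le_eqVlt; apply/orP; left; apply/eqP; ring.
Qed.

(** An upper bound for the bounded Lipschitz (Fortet-Mourier) distance: the only
information on two marginals used in the stability estimate. *)
Definition BL_dist_le (P Q : prob) (e : R) := forall (u : rv -> R) M, BL M u ->
  `|expect P (u : borel_rV R d -> R) - expect Q (u : borel_rV R d -> R)| <= M * e.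

(** The marginals are replaced one at a time. Each replacement acts on an average
of [f], which is bounded Lipschitz with the same constant as [f]. *)
Lemma avgs_BL_dist mu nu (e : 'I_N -> R) s M f x :
  (forall j, BL_dist_le (mu j) (nu j) (e j)) -> BL M f ->
  `|avgs mu s f x - avgs nu s f x| <= M * \sum_(j <- s) e j.
Proof.
move=> mn bf; have bf' : bl f by exists M.
elim: s x => [|j s IH] x /=; first by rewrite subrr normr0 big_nil mulr0.
have b1 := bl_avgs mu s bf'; have b2 := bl_avgs nu s bf'.
have -> : avg mu j (avgs mu s f) x - avg nu j (avgs nu s f) x =
  (avg mu j (avgs mu s f) x - avg mu j (avgs nu s f) x) +
  (avg mu j (avgs nu s f) x - avg nu j (avgs nu s f) x) by ring.
rewrite big_cons mulrDr addrC (le_trans (ler_normD _ _))//; apply: lerD.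
  by apply: mn; apply: BL_set_row; exact: BL_avgs.
rewrite -avgB//; apply: expect_norm; last by move=> y; exact: IH.
by apply: (@bl_set_row_bmeas (fun x => avgs mu s f x - avgs nu s f x)); exact: blB.
Qed.

(** * Derivatives in one row *)

Definition rowdir i : pred ('I_N * 'I_d) := fun ij => ij.1 == i.

Lemma set_rowD_delta (t : R) x i l j (y : rv) : i != j ->
  set_row (t *: delta_mx i l + x) j y = t *: delta_mx i l + set_row x j y.
Proof.
move=> ij; apply/matrixP => k m; rewrite !mxE.
by have [->|//] := eqVneq k j; rewrite eq_sym (negPf ij) mulr0 add0r.
Qed.

(** Differentiation under the integral. As the derivative is Lipschitz, the mean
value theorem bounds the difference between the difference quotient and the
derivative by M|h|, uniformly in the averaged row; this uniformity takes the
place of dominated convergence. *)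
Lemma pderiv_avg mu M il j f : il.1 != j -> bl f ->
  (forall x, derivable f x (delta_mx il.1 il.2)) -> BL M (pderiv il f) ->
  (forall x, derivable (avg mu j f) x (delta_mx il.1 il.2)) /\
  pderiv il (avg mu j f) = avg mu j (pderiv il f).
Proof.
move=> ilj bf df bdf; have M0 := BL_ge0 bdf.
have bdf' : bl (pderiv il f) by exists M.
set v : mx := delta_mx il.1 il.2.
have H x : h^-1 *: (avg mu j f (h *: v + x) - avg mu j f x) @[h --> 0^'] -->
    avg mu j (pderiv il f) x.
  apply/cvgrPdist_le => e e0; near=> h.
  have h0 : h != 0 by near: h; exact: nbhs_dnbhs_neq.
  (* [M + 1] instead of [M], which may vanish *)
  have he : `|h| <= e / (M + 1).
    near: h; apply: dnbhs0_le; by rewrite divr_gt0// ltr_wpDl.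
  apply: (@le_trans _ _ (M * `|h|)); last first.
    rewrite (le_trans (ler_wpM2l M0 he))// mulrCA ler_piMr ?(ltW e0)//.
    by rewrite ler_pdivrMr ?mul1r ?lerDl// ltr_wpDl.
  have -> : avg mu j (pderiv il f) x - h^-1 *: (avg mu j f (h *: v + x) - avg mu j f x) =
     avg mu j (fun x => pderiv il f x - h^-1 * (f (h *: v + x) - f x)) x.
    (* translation preserves bounded Lipschitz functions *)
    have bsh : bl (fun x => f (h *: v + x)).
      case: bf => M' [b1 b2]; exists M'; split=> // y z; rewrite (le_trans (b2 _ _))//.
      rewrite /dist1; under eq_bigr => ? _ do under eq_bigr => ? _ do
        rewrite !mxE opprD addrACA subrr add0r.
      exact: lexx.
    rewrite avgB//; last by apply: blM; [exact: bl_cst|exact: blB].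
    rewrite avgZ; last exact: blB.
    rewrite avgB// /avg.
    rewrite (_ : (fun y : borel_rV R d => f (set_row (h *: v + x) j y)) =
      (fun y : borel_rV R d => f (h *: v + set_row x j y)))//.
    by apply/funext => y; rewrite set_rowD_delta.
  apply: expect_norm.
    apply: (@bl_set_row_bmeas (fun x => pderiv il f x - h^-1 * (f (h *: v + x) - f x))).
    apply: blB => //; apply: blM; [exact: bl_cst|apply: blB => //].
    case: bf => M' [b1 b2]; exists M'; split=> // y z; rewrite (le_trans (b2 _ _))//.
    rewrite /dist1; under eq_bigr => ? _ do under eq_bigr => ? _ do
      rewrite !mxE opprD addrACA subrr add0r.
    exact: lexx.
  move=> y; have [c ch E] := line_MVT (set_row x j y) h df.
  rewrite E mulKf// distrC (le_trans (bdf.2 _ _))// ler_wpM2l// (le_trans _ ch)//.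
  rewrite /dist1 (bigD1 il.1)//= (bigD1 il.2)//= !mxE !eqxx mulr1 addrK.
  rewrite big1 ?addr0; last first.
    by move=> l /negPf ll; rewrite !mxE ll andbF mulr0 add0r subrr normr0.
  rewrite big1 ?addr0// => i /negPf ii; rewrite big1// => l _.
  by rewrite !mxE ii mulr0 add0r subrr normr0.
split=> [x|]; first by apply/cvg_ex; exists (avg mu j (pderiv il f) x); exact: H.
by apply/funext => x; apply: cvg_lim => //; exact: H.
Unshelve. all: by end_near. Qed.

Lemma smooth_avg mu M i j k f : i != j -> smooth (rowdir i) (BL M) k f ->
  smooth (rowdir i) (BL M) k (avg mu j f).
Proof.
move=> ij; elim: k f => [|k IH] f sf; have bf := smooth0 sf.
  by split=> //; exact: BL_avg.
split; first exact: BL_avg.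
move=> il /[dup] ili /eqP ili'; have [df sdf] := smooth_deriv sf ili.
have ilj : il.1 != j by rewrite ili'.
have [dE ->] := pderiv_avg mu ilj (ex_intro _ M bf) df (smooth0 sdf).
by split; [exact: dE|exact: IH].
Qed.

Lemma smooth_avgs mu M i s k f : i \notin s -> smooth (rowdir i) (BL M) k f ->
  smooth (rowdir i) (BL M) k (avgs mu s f).
Proof.
move=> is_ sf; elim: s is_ => //= j s IH; rewrite inE negb_or => /andP[ij is_].
by apply: smooth_avg => //; exact: IH.
Qed.

Lemma pderiv_avgs mu M i s k f il : il.1 = i -> i \notin s ->
  smooth (rowdir i) (BL M) k.+1 f ->
  pderiv il (avgs mu s f) = avgs mu s (pderiv il f).
Proof.
move=> ili is_ sf; elim: s is_ => //= j s IH; rewrite inE negb_or => /andP[ij is_].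
have sE := smooth_avgs mu is_ sf.
have [dE sdE] := smooth_deriv sE (introT eqP ili : rowdir i il).
have ilj : il.1 != j by rewrite ili.
have [_ ->] := pderiv_avg mu ilj (ex_intro _ M (smooth0 sE)) dE (smooth0 sdE).
by rewrite IH.
Qed.

End partial_expectation.

Section row_smoothness.
Context {R : realType} {N d : nat}.
Notation mx := 'M[R]_(N, d).
Notation rv := 'rV[R]_d.
Notation prob := (probability (borel_rV R d) R).
Implicit Types (f g h : mx -> R) (mu nu : 'I_N -> prob) (x y : mx) (i j : 'I_N).

Lemma avgs_set_row mu s i f x (y : rv) : i \notin s ->
  avgs mu s f (set_row x i y) = avgs mu s (fun x => f (set_row x i y)) x.
Proof.
elim: s x => //= j s IH x; rewrite inE negb_or => /andP[ij is_].
by rewrite /avg; congr expect; apply/funext => z; rewrite set_rowC// IH.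
Qed.

(** In the directions of row [i], a factor that does not depend on that row behaves
as a constant. *)
Lemma pderiv_indepM i h f il : il.1 = i -> row_indep i h ->
  (forall x, derivable f x (delta_mx il.1 il.2)) ->
  (forall x, derivable (fun x => h x * f x) x (delta_mx il.1 il.2)) /\
  pderiv il (fun x => h x * f x) = (fun x => h x * pderiv il f x).
Proof.
move=> ili hi df; set v : mx := delta_mx il.1 il.2.
have hv (t : R) x : h (t *: v + x) = h x.
  rewrite -[RHS](hi x (row i (t *: v + x))); congr h.
  apply/matrixP => k l; rewrite !mxE /v ili.
  by have [->|ki] := eqVneq k i; rewrite ?eqxx// mulr0 add0r.
have E x : (fun t : R => t^-1 *: (h (t *: v + x) * f (t *: v + x) - h x * f x)) =
    (fun t : R => t^-1 *: ((h x *: f) (t *: v + x) - (h x *: f) x)).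
  by apply/funext => t; rewrite hv.
split=> [x|].
  by have := derivableZ (k := h x) (df x); rewrite /derivable -E.
apply/funext => x; rewrite /pderiv.
transitivity ('D_v (h x *: f) x); last by rewrite deriveZ.
by rewrite /derive -E.
Qed.

Lemma smooth_indepM M M' i k h f : BL M' h -> row_indep i h ->
  smooth (rowdir i) (BL M) k f ->
  smooth (rowdir i) (BL (2 * (M' * M))) k (fun x => h x * f x).
Proof.
move=> bh hi; elim: k f => [|k IH] f sf; have bf := smooth0 sf.
  by split=> //; exact: BLM.
split; first exact: BLM.
move=> il ili; have [df sdf] := smooth_deriv sf ili.
have [dhf ->] := pderiv_indepM (eqP ili) hi df.
by split; [exact: dhf|exact: IH].
Qed.

Lemma sum_others (F : 'I_N -> R) i : \sum_(j <- others i) F j = \sum_(j | j != i) F j.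
Proof.
have := perm_big (op := +%R) (x := 0) (F := F) (P := predT) _ (perm_others i).
by rewrite big_cons/= big_enum/= (bigD1 i)//= => /addrI.
Qed.

(** Both the marginals and the weights change. Splitting the difference into
E_mu[(h1 - h2) f] and (E_mu - E_nu)[h2 f] bounds it, and since the
weights do not depend on row [i] the same splitting applies to each of the
derivatives in that row, which only affect [f]. *)
Lemma smooth_avgs_diff mu nu (e : 'I_N -> R) i k h1 h2 (M M' t : R) f :
  (forall j, BL_dist_le (mu j) (nu j) (e j)) -> (forall j, 0 <= e j) ->
  BL M' h1 -> BL M' h2 -> row_indep i h1 -> row_indep i h2 ->
  (forall x, avgs mu (others i) (fun x => `|h1 x - h2 x|) x <= t) ->
  smooth (rowdir i) (BL M) k f ->
  smooth (rowdir i) (CB0 (M * t + 2 * (M' * M) * \sum_j e j)) k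
    (fun x => avgs mu (others i) (fun x => h1 x * f x) x -
              avgs nu (others i) (fun x => h2 x * f x) x).
Proof.
move=> mn e0 b1 b2 i1 i2 ht.
have iothers : i \notin others i by rewrite mem_others eqxx.
have bl1 : bl h1 by exists M'.
have bl2 : bl h2 by exists M'.
have base g : BL M g -> CB0 (M * t + 2 * (M' * M) * \sum_j e j)
    (fun x => avgs mu (others i) (fun x => h1 x * g x) x -
              avgs nu (others i) (fun x => h2 x * g x) x).
  move=> bg; have blg : bl g by exists M.
  split.
    by apply: bl_continuous; apply: blB; apply: bl_avgs; exact: blM.
  move=> x.
  have -> : avgs mu (others i) (fun x => h1 x * g x) x - avgs nu (others i) (fun x => h2 x * g
    x) x =
     avgs mu (others i) (fun x => (h1 x - h2 x) * g x) x +
     (avgs mu (others i) (fun x => h2 x * g x) x - avgs nu (others i) (fun x => h2 x * g x) x).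
    rewrite addrA -avgsD; [|by apply: blM => //; exact: blB|exact: blM].
    by congr (_ - _); apply: avgs_ext => z; rewrite mulrBl subrK.
  rewrite (le_trans (ler_normD _ _))//; apply: lerD.
    apply: (le_trans (avgs_norm _ _ _ _)); first by apply: blM => //; exact: blB.
    apply: (@le_trans _ _ (avgs mu (others i) (fun x => M * `|h1 x - h2 x|) x)).
      apply: avgs_le.
      - by apply: bl_norm; apply: blM => //; exact: blB.
      - by apply: blM; [exact: bl_cst|apply: bl_norm; exact: blB].
      - by move=> z; rewrite normrM mulrC ler_wpM2r//; exact: bg.1.
    rewrite avgsZ; last by apply: bl_norm; exact: blB.
    by rewrite ler_wpM2l// (BL_ge0 bg).
  apply: (le_trans (avgs_BL_dist _ _ mn (BLM b2 bg))).
  rewrite ler_wpM2l ?(BL_ge0 (BLM b2 bg))//.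
  by rewrite sum_others [leRHS](bigD1 i)//= lerDr.
elim: k f => [|k IH] f sf; first by split=> //; exact: base (smooth0 sf).
split; first exact: base (smooth0 sf).
move=> il ili; have [df sdf] := smooth_deriv sf ili.
have s1 := smooth_indepM b1 i1 sf; have s2 := smooth_indepM b2 i2 sf.
have [dE1 _] := smooth_deriv (smooth_avgs mu iothers s1) ili.
have [dE2 _] := smooth_deriv (smooth_avgs nu iothers s2) ili.
split=> [x|]; first by apply: derivableB; [exact: dE1|exact: dE2].
rewrite (pderivB dE1 dE2) (pderiv_avgs mu (eqP ili) iothers s1) (pderiv_avgs nu (eqP ili)
  iothers s2).
have [_ ->] := pderiv_indepM (eqP ili) i1 df.
have [_ ->] := pderiv_indepM (eqP ili) i2 df.
exact: IH sdf.
Qed.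

(** Puts a vector in row [i] and zeros elsewhere, which turns functions that
depend on row [i] only into functions of a vector. *)
Definition row_only i (y : rv) : mx := set_row 0 i y.

Lemma smooth_row_only (P : (mx -> R) -> Prop) (Q : (rv -> R) -> Prop) i k f :
  (forall g, P g -> Q (fun y : rv => g (row_only i y))) ->
  smooth (rowdir i) P k f -> smooth predT Q k (fun y : rv => f (row_only i y)).
Proof.
move=> PQ; elim: k f => [|k IH] f sf; first by split=> //; exact: PQ (smooth0 sf).
split; first exact: PQ (smooth0 sf).
move=> [z l] _ /=; rewrite (ord1 z) => {z}.
have [/= df sdf] := smooth_deriv sf (eqxx i : rowdir i (i, l)).
have E (y : rv) : (fun t : R => t^-1 *: (f (row_only i (t *: delta_mx 0 l +
  y)) - f (row_only i y))) =
    (fun t : R => t^-1 *: (f (t *: delta_mx i l + row_only i y) - f (row_only i y))).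
  apply/funext => t; congr (_ *: (f _ - _)); apply/matrixP => k' l'; rewrite !mxE.
  by have [_|ki] := eqVneq k' i; rewrite /= ?mulr0 ?addr0 ?eqxx.
split=> [y|]; first by have := df (row_only i y); rewrite /derivable -E.
rewrite (_ : pderiv _ _ = (fun y : rv => pderiv (i, l) f (row_only i y))); first exact: IH.
by apply/funext => y; rewrite /pderiv /derive -E.
Qed.

Lemma row_only_continuous i : continuous (row_only i).
Proof.
move=> y A /nbhs_ballP[e e0 eA]; apply/nbhs_ballP; exists e => // z [_ yz].
apply: eA; split=> // k l; rewrite !mxE; case: eqP => _; first exact: yz.
exact: ballxx.
Qed.

Lemma CB0_row_only M i f : CB0 M f -> CB0 M (fun y : rv => f (row_only i y)).
Proof.
move=> [cf bf]; split=> // y.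
by apply: continuous_comp; [exact: row_only_continuous|exact: cf].
Qed.

End row_smoothness.

(** * The Schrodinger system on the whole space *)

Section potentials.
Context {R : realType} {N d : nat}.
Notation mx := 'M[R]_(N, d).
Notation rv := 'rV[R]_d.
Notation prob := (probability (borel_rV R d) R).
Implicit Types (mu nu : 'I_N -> prob) (x : mx) (y : rv) (i j : 'I_N).
Implicit Types (phi psi : 'I_N -> rv -> R).

Variables (c : mx -> R) (kappa MK : R).
Hypothesis N0 : (0 < N)%N.
Hypothesis c_bl : bl c.
Hypothesis c_kappa : forall x, `|c x| <= kappa.
Let K x := expR (- c x).
Hypothesis K_BL : BL MK K.

Definition bl_family phi := forall i, bl (phi i).
Definition potsum phi x : R := \sum_j phi j (row j x).
Definition potsum_but phi i x : R := \sum_(j | j != i) phi j (row j x).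

(** For a solution, the density of the optimal entropic plan with respect to the
product of the marginals. *)
Definition density phi x : R := expR (potsum phi x - c x).

(** The integral of the Schrodinger system for the [i]-th component, without the
factor [expR (phi i y)]. It is defined for all [y], inside the compact set or not. *)
Definition kernel_int mu phi i y : R :=
  avgs mu (others i) (fun x => expR (potsum_but phi i x) * expR (- c (set_row x i y))) 0.

Lemma kappa_ge0 : 0 <= kappa. Proof. by rewrite (le_trans _ (c_kappa 0)). Qed.

Lemma K_bl : bl K. Proof. by exists MK. Qed.

Lemma K_ge x : expR (- kappa) <= K x.
Proof. by rewrite ler_expR lerN2 (le_trans (ler_norm _)). Qed.

Lemma K_le x : K x <= expR kappa.
Proof. by rewrite ler_expR (le_trans (ler_norm _))// normrN. Qed.

Lemma potsumE phi i x : potsum phi x = phi i (row i x) + potsum_but phi i x.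
Proof. by rewrite /potsum (bigD1 i). Qed.

Lemma row_indep_potsum_but phi i : row_indep i (potsum_but phi i).
Proof. by move=> x y; apply: eq_bigr => j ji; rewrite set_row_ne. Qed.

Lemma row_indep_exp_potsum_but phi i : row_indep i (fun x => expR (potsum_but phi i x)).
Proof. by move=> x y; rewrite row_indep_potsum_but. Qed.

Lemma bl_potsum phi : bl_family phi -> bl (potsum phi).
Proof. by move=> bp; apply: bl_sum => j _; exact: bl_row. Qed.

Lemma bl_potsum_but phi i : bl_family phi -> bl (potsum_but phi i).
Proof. by move=> bp; apply: bl_sum => j _; exact: bl_row. Qed.

Lemma bl_density phi : bl_family phi -> bl (density phi).
Proof. by move=> bp; apply: bl_expR; apply: blB => //; exact: bl_potsum. Qed.

Lemma bl_K_set_row i y : bl (fun x => K (set_row x i y)).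
Proof.
have [M [bK lK]] := K_bl; exists M; split=> // x x'.
rewrite (le_trans (lK _ _))// ler_wpM2l ?dist1_set_row//.
by rewrite (le_trans _ (bK 0)).
Qed.

Lemma bl_integrand phi i y : bl_family phi ->
  bl (fun x => expR (potsum_but phi i x) * K (set_row x i y)).
Proof.
by move=> bp; apply: blM; [apply: bl_expR; exact: bl_potsum_but|exact: bl_K_set_row].
Qed.

Lemma kernel_int_any mu phi i y x :
  avgs mu (others i) (fun x => expR (potsum_but phi i x) * K (set_row x i y)) x =
    kernel_int mu phi i y.
Proof.
apply: row_indep_all => j; apply: row_indep_avgs; rewrite mem_others.
have [->/=|//] := eqVneq j i; apply/asboolP => z w.
by rewrite row_indep_potsum_but set_row_set_row.
Qed.

Lemma kernel_int_row_only mu phi i y :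
  kernel_int mu phi i y = avgs mu (others i) (fun x => expR (potsum_but phi i x) * K x)
    (row_only i y).
Proof.
rewrite /row_only avgs_set_row ?mem_others ?eqxx//; apply: avgs_ext => x.
by rewrite row_indep_potsum_but.
Qed.

(** The factor [expR (phi i _)] depends on row [i] only and leaves the average
over the other rows. *)
Lemma avgs_density mu phi i x : bl_family phi ->
  avgs mu (others i) (density phi) x = expR (phi i (row i x)) * kernel_int mu phi i (row i x).
Proof.
move=> bp; rewrite -(kernel_int_any mu phi i (row i x) x).
rewrite (avgs_ext _ _ (g := fun x => expR (phi i (row i x)) * (expR (potsum_but phi i x) * K
  x))); last first.
  by move=> z; rewrite /density (potsumE _ i) /K -!expRD addrA.
rewrite (@avgs_pull _ _ _ mu (others i) (fun x => expR (phi i (row i x)))).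
- congr (_ * _); rewrite -[in LHS](set_row_id x i) avgs_set_row ?mem_others ?eqxx//.
  by apply: avgs_ext => z; rewrite row_indep_potsum_but.
- by apply: blM; [apply: bl_expR; exact: bl_potsum_but|exact: K_bl].
- by move=> j; rewrite mem_others => ji z w; rewrite set_row_ne// eq_sym.
Qed.

(** The mass left when the kernel is removed from [kernel_int]. It can take
any positive value, but [kernel_int] and its modulus of continuity are both
comparable to it, so it cancels in the regularity of the update. *)
Definition exp_mass mu phi i : R := avgs mu (others i) (fun x => expR (potsum_but phi i x)) 0.

Lemma bl_exp_potsum_but phi i : bl_family phi -> bl (fun x => expR (potsum_but phi i x)).
Proof. by move=> bp; apply: bl_expR; exact: bl_potsum_but. Qed.

Lemma exp_mass_gt0 mu phi i : bl_family phi -> 0 < exp_mass mu phi i.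
Proof.
move=> bp; have [M [bM _]] := bl_potsum_but i bp.
apply: (@lt_le_trans _ _ (expR (- M))); first exact: expR_gt0.
rewrite -[leLHS](avgs_cst mu (others i) _ 0); apply: avgs_le; first exact: bl_cst.
  exact: bl_exp_potsum_but.
by move=> x; rewrite ler_expR; have := bM x; rewrite ler_norml => /andP[].
Qed.

Lemma kernel_int_ge mu phi i y : bl_family phi ->
  expR (- kappa) * exp_mass mu phi i <= kernel_int mu phi i y.
Proof.
move=> bp; rewrite /exp_mass -avgsZ; last exact: bl_exp_potsum_but.
apply: avgs_le; [|exact: bl_integrand|].
  by apply: blM; [exact: bl_cst|exact: bl_exp_potsum_but].
by move=> x; rewrite mulrC ler_wpM2l ?expR_ge0//; exact: K_ge.
Qed.

Lemma kernel_int_le mu phi i y : bl_family phi ->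
  kernel_int mu phi i y <= expR kappa * exp_mass mu phi i.
Proof.
move=> bp; rewrite /exp_mass -avgsZ; last exact: bl_exp_potsum_but.
apply: avgs_le; [exact: bl_integrand| |].
  by apply: blM; [exact: bl_cst|exact: bl_exp_potsum_but].
by move=> x; rewrite mulrC ler_wpM2r ?expR_ge0//; exact: K_le.
Qed.

Lemma kernel_int_gt0 mu phi i y : bl_family phi -> 0 < kernel_int mu phi i y.
Proof.
move=> bp; apply: lt_le_trans (kernel_int_ge mu i y bp).
by rewrite mulr_gt0 ?expR_gt0// exp_mass_gt0.
Qed.

Lemma kernel_int_Lip mu phi i y y' : bl_family phi ->
  `|kernel_int mu phi i y - kernel_int mu phi i y'| <= MK * exp_mass mu phi i * dist1 y y'.
Proof.
move=> bp; rewrite /kernel_int -avgsB; [|exact: bl_integrand..].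
apply: le_trans (avgs_norm _ _ _ _) _; first by apply: blB; exact: bl_integrand.
rewrite mulrAC /exp_mass -avgsZ; last exact: bl_exp_potsum_but.
apply: avgs_le.
- by apply: bl_norm; apply: blB; exact: bl_integrand.
- by apply: blM; [exact: bl_cst|exact: bl_exp_potsum_but].
- move=> x; rewrite -mulrBr normrM (ger0_norm (expR_ge0 _)) mulrC ler_wpM2r ?expR_ge0//.
  by rewrite (le_trans (K_BL.2 _ _))// dist1_set_row_same.
Qed.

(** One step of the Sinkhorn algorithm: the value of the [i]-th potential that
solves the [i]-th equation, the others being given. *)
Definition sinkhorn mu phi i y : R := - ln (kernel_int mu phi i y).

(** The regularity that every Sinkhorn update enjoys, with constants independent of
the potentials and of the marginals. *)
Definition regular (u : rv -> R) :=
  (forall y y', `|u y - u y'| <= 2 * kappa) /\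
  (forall y y', `|u y - u y'| <= expR kappa * MK * dist1 y y').

Definition admissible phi := forall i, regular (phi i).

(** Since the kernel lies between exp(-kappa) and exp kappa, [kernel_int] varies
by a factor of at most exp(2 kappa), and its Lipschitz constant relative to its
minimum is bounded; [exp_mass] cancels in both ratios. *)
Lemma sinkhorn_regular mu phi i : bl_family phi -> regular (sinkhorn mu phi i).
Proof.
move=> bp; have m0 := exp_mass_gt0 mu i bp.
have l0 : 0 < expR (- kappa) * exp_mass mu phi i by rewrite mulr_gt0 ?expR_gt0.
have E y y' : `|sinkhorn mu phi i y - sinkhorn mu phi i y'| =
  `|ln (kernel_int mu phi i y) - ln (kernel_int mu phi i y')|.
  by rewrite /sinkhorn -opprD normrN.
split=> y y'; rewrite E.
  have H z z' : ln (kernel_int mu phi i z) - ln (kernel_int mu phi i z') <= 2 * kappa.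
    rewrite -ln_div ?posrE ?kernel_int_gt0// -[leRHS]expRK ler_ln ?posrE ?expR_gt0 ?divr_gt0
      ?kernel_int_gt0//.
    rewrite ler_pdivrMr ?kernel_int_gt0// (le_trans (kernel_int_le mu i z bp))//.
    rewrite (le_trans _ (ler_wpM2l (expR_ge0 _) (kernel_int_ge mu i z' bp)))// mulrA -expRD.
    by rewrite (_ : 2 * kappa + - kappa = kappa)//; ring.
  by rewrite ler_norml H andbT lerNl opprB.
apply: le_trans (ln_Lip l0 (kernel_int_ge _ _ _ bp) (kernel_int_ge _ _ _ bp)) _.
apply: le_trans (ler_wpM2l _ (kernel_int_Lip mu i y y' bp)) _.
  by rewrite invr_ge0 ltW.
have /gt_eqF/negbT mn := m0.
rewrite expRN invfM invrK le_eqVlt; apply/orP; left; apply/eqP; field.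
exact: mn.
Qed.

Lemma admissible_bl phi : admissible phi -> bl_family phi.
Proof.
move=> ap i; have [osc lip] := ap i; exists (`|phi i 0| + 2 * kappa + expR kappa * MK).
have k0 := kappa_ge0; have MK0 := BL_ge0 K_BL.
have eM : 0 <= expR kappa * MK by rewrite mulr_ge0 ?expR_ge0.
split=> [y|y y'].
  rewrite -[phi i y](subrK (phi i 0)) addrC (le_trans (ler_normD _ _))//.
  by rewrite -addrA lerD// (le_trans (osc _ _))// lerDl.
rewrite (le_trans (lip _ _))// ler_wpM2r ?dist1_ge0// lerDr.
by rewrite addr_ge0// mulr_ge0.
Qed.

Definition solves mu phi := forall i y, expR (phi i y) * kernel_int mu phi i y = 1.

Lemma expR_sinkhorn mu phi i y : bl_family phi ->
  expR (sinkhorn mu phi i y) * kernel_int mu phi i y = 1.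
Proof.
move=> bp; rewrite /sinkhorn expRN lnK ?posrE ?kernel_int_gt0// mulVf//.
by rewrite gt_eqF// kernel_int_gt0.
Qed.

Lemma solves_sinkhorn mu phi : bl_family phi -> solves mu phi ->
  forall i y, phi i y = sinkhorn mu phi i y.
Proof.
move=> bp sp i y; apply: expR_inj.
have /gt_eqF/negbT An := kernel_int_gt0 mu i y bp.
by apply: (mulIf An); rewrite sp expR_sinkhorn.
Qed.

(** A solution coincides with its own update, hence inherits its regularity. *)
Lemma solves_admissible mu phi : bl_family phi -> solves mu phi -> admissible phi.
Proof.
move=> bp sp i; rewrite (_ : phi i = sinkhorn mu phi i); first exact: sinkhorn_regular.
by apply/funext => y; exact: solves_sinkhorn.
Qed.

Lemma solves_avgs_density mu phi i x : bl_family phi -> solves mu phi ->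
  avgs mu (others i) (density phi) x = 1.
Proof. by move=> bp sp; rewrite avgs_density. Qed.

Lemma avg_all_density mu phi i : bl_family phi ->
  (forall x, avgs mu (others i) (density phi) x = 1) ->
  avg_all mu (density phi) = 1.
Proof.
by move=> bp H; rewrite -(avg_all_tower mu i (bl_density bp)) (avg_all_ext _ H) avg_all_cst.
Qed.

Definition shift_pots (k : 'I_N -> R) phi i y : R := phi i y + k i.

Lemma potsum_shift k phi x : \sum_i k i = 0 -> potsum (shift_pots k phi) x = potsum phi x.
Proof. by move=> k0; rewrite /potsum /shift_pots big_split/= k0 addr0. Qed.

Lemma density_shift k phi : \sum_i k i = 0 -> density (shift_pots k phi) = density phi.
Proof. by move=> k0; apply/funext => x; rewrite /density potsum_shift. Qed.

Lemma bl_family_shift k phi : bl_family phi -> bl_family (shift_pots k phi).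
Proof. by move=> bp i; apply: blD => //; exact: bl_cst. Qed.

Lemma admissible_shift k phi : admissible phi -> admissible (shift_pots k phi).
Proof.
move=> ap i; have [osc lip] := ap i.
by split=> y y'; rewrite /shift_pots opprD addrACA subrr addr0.
Qed.

Lemma solves_shift k mu phi : bl_family phi -> \sum_i k i = 0 -> solves mu phi ->
  solves mu (shift_pots k phi).
Proof.
move=> bp k0 sp i y; have := avgs_density mu i (row_only i y) (bl_family_shift k bp).
rewrite density_shift// solves_avgs_density// => H.
by rewrite [RHS]H /row_only set_rowE.
Qed.

(** A normalization of the family within its class: constants of zero sum
can be added to the components to give them all the same mean. *)
Definition equal_means mu phi := exists m, forall i, avg_all mu (fun x => phi i (row i x)) = m.

Lemma normalize mu phi : bl_family phi -> exists2 k : 'I_N -> R, \sum_i k i = 0 &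
  equal_means mu (shift_pots k phi).
Proof.
move=> bp; pose m i := avg_all mu (fun x => phi i (row i x)).
pose mb := (\sum_i m i) / N%:R.
have Nn : (N%:R : R) != 0 by rewrite pnatr_eq0 -lt0n.
(* [mb] is the mean of the [N] means *)
exists (fun i => mb - m i).
  rewrite sumrB sumr_const card_ord -mulr_natl mulrC /mb mulfVK// subrr//.
exists mb => i; rewrite /shift_pots avg_allD ?avg_all_cst; [|exact: bl_row|exact: bl_cst].
by rewrite -/(m i) addrC subrK.
Qed.

Definition pot_bound : R := (2 * N%:R + 3) * kappa.

Lemma pot_bound_ge0 : 0 <= pot_bound.
Proof. by rewrite /pot_bound mulr_ge0 ?kappa_ge0// addr_ge0// mulr_ge0. Qed.

(** Each component is within 2 kappa of the common mean m, so the logarithm of the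
density is within (2N + 1) kappa of N m; having expectation 1, the density
cannot stay on one side of 1, and m is bounded as well. The means and the
mass may refer to different marginals: this serves to normalize with respect to
[mu] a solution associated with [nu]. *)
Lemma admissible_bound mu mu' phi : admissible phi -> equal_means mu phi ->
  avg_all mu' (density phi) = 1 ->
  forall i y, `|phi i y| <= pot_bound.
Proof.
move=> ap [m Hm] E1; have bp := admissible_bl ap; have k0 := kappa_ge0.
have H i y : `|phi i y - m| <= 2 * kappa.
  rewrite -(Hm i) -[X in `|X - _|](avg_all_cst mu).
  rewrite -avg_allB; [|exact: bl_cst|exact: bl_row].
  apply: le_trans (avg_all_norm _ _) _; first by apply: blB; [exact: bl_cst|exact: bl_row].
  rewrite -[leRHS](avg_all_cst mu); apply: avg_all_le; [|exact: bl_cst|by move=> x;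
    exact: (ap i).1].
  by apply: bl_norm; apply: blB; [exact: bl_cst|exact: bl_row].
have HS x : `|potsum phi x - N%:R * m| <= 2 * N%:R * kappa.
  rewrite mulr_natl -[in X in _ - X](card_ord N) -sumr_const /potsum -sumrB.
  apply: le_trans (ler_norm_sum _ _ _) _.
  apply: (@le_trans _ _ (\sum_(i < N) 2 * kappa)); first exact: ler_sum.
  by rewrite sumr_const card_ord -[leLHS]mulr_natr mulrAC.
have HN : `|N%:R * m| <= (2 * N%:R + 1) * kappa.
  rewrite ler_norml; apply/andP; split.
    rewrite -subr_ge0 opprK -ler_expR expR0.
    rewrite -[leLHS]E1 -[leRHS](avg_all_cst mu'); apply: avg_all_le;
      [exact: bl_density|exact: bl_cst|].
    move=> x; rewrite ler_expR; have := HS x; have := c_kappa x; rewrite !ler_norml; lra.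
  rewrite -subr_le0 -expR_le1.
  rewrite -[leRHS]E1 -[leLHS](avg_all_cst mu'); apply: avg_all_le;
    [exact: bl_cst|exact: bl_density|].
  move=> x; rewrite ler_expR; have := HS x; have := c_kappa x; rewrite !ler_norml; lra.
have Hm' : `|m| <= (2 * N%:R + 1) * kappa.
  apply: le_trans HN; rewrite normrM ler_peMl// ger0_norm// ler1n//.
move=> i y; rewrite -[phi i y](subrK m) (le_trans (ler_normD _ _))//.
rewrite (le_trans (lerD (H i y) Hm'))// /pot_bound le_eqVlt; apply/orP; left; apply/eqP; ring.
Qed.

(** * Strong monotonicity *)

Definition pdiff phi psi i x : R := phi i (row i x) - psi i (row i x).
Definition pdiff_sum phi psi x : R := potsum phi x - potsum psi x.

Lemma pdiff_sumE phi psi x : pdiff_sum phi psi x = \sum_i pdiff phi psi i x.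
Proof. by rewrite /pdiff_sum /potsum -sumrB. Qed.

Lemma bl_pdiff phi psi i : bl_family phi -> bl_family psi -> bl (pdiff phi psi i).
Proof. by move=> bp bq; apply: blB; exact: bl_row. Qed.

Lemma bl_pdiff_sum phi psi : bl_family phi -> bl_family psi -> bl (pdiff_sum phi psi).
Proof. by move=> bp bq; apply: blB; exact: bl_potsum. Qed.

Lemma potsum_cost_bound phi (B : R) x : (forall i y, `|phi i y| <= B) ->
  `|potsum phi x - c x| <= N%:R * B + kappa.
Proof.
move=> pB; rewrite (le_trans (ler_normB _ _))// lerD//.
rewrite (le_trans (ler_norm_sum _ _ _))//.
rewrite mulr_natl -[in X in _ <= X](card_ord N) -sumr_const; exact: ler_sum.
Qed.

Lemma potsum_but_bound phi (B : R) i x : (forall i y, `|phi i y| <= B) ->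
  `|potsum_but phi i x| <= N%:R * B.
Proof.
move=> pB; rewrite (le_trans (ler_norm_sum _ _ _))//.
have B0 : 0 <= B by rewrite (le_trans _ (pB i 0)).
rewrite mulr_natl -[in X in _ <= X](card_ord N) -sumr_const [leRHS](bigD1 i)//=.
by apply: ler_wpDl => //; exact: ler_sum.
Qed.

(** Strong monotonicity of the exponential bounds the square of U by a
multiple of (exp s - exp s') U, where s - s' = U is the sum of the u_i; each
u_i depends on row [i] only, so the densities may be averaged over the
other rows. *)
Lemma key_inequality mu phi psi (B : R) : bl_family phi -> bl_family psi ->
  (forall i y, `|phi i y| <= B) -> (forall i y, `|psi i y| <= B) ->
  expR (- (N%:R * B + kappa)) * avg_all mu (fun x => `|pdiff_sum phi psi x|) ^+ 2 <=
  \sum_i avg_all mu (fun x => pdiff phi psi i x *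
     (avgs mu (others i) (density phi) x - avgs mu (others i) (density psi) x)).
Proof.
move=> bp bq pB qB; have bU := bl_pdiff_sum bp bq; have bpp := bl_density bp;
  have bpq := bl_density bq.
apply: (@le_trans _ _ (avg_all mu (fun x => (density phi x - density psi x) * pdiff_sum phi psi
  x))).
  apply: (@le_trans _ _ (expR (- (N%:R * B +
    kappa)) * avg_all mu (fun x => pdiff_sum phi psi x ^+ 2))).
    by rewrite ler_wpM2l ?expR_ge0// avg_all_norm_sqr.
  rewrite -avg_allZ; last exact: blX2.
  apply: avg_all_le; [by apply: blM; [exact: bl_cst|exact: blX2]|by apply: blM => //; exact: blB|].
  move=> x; have := expRB_monotone (potsum_cost_bound x pB) (potsum_cost_bound x qB).
  by rewrite (_ : _ - c x - (_ - c x) = pdiff_sum phi psi x)// /pdiff_sum; ring.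
rewrite (avg_all_ext _ (g := fun x => \sum_i pdiff phi psi i x * (density phi x - density psi
  x))); last first.
  by move=> x; rewrite pdiff_sumE mulrC mulr_suml.
rewrite avg_all_sum; last by move=> i; apply: blM; [exact: bl_pdiff|exact: blB].
rewrite le_eqVlt; apply/orP; left; apply/eqP; apply: eq_bigr => i _.
rewrite (avg_all_pull mu (i := i)); [|exact: bl_pdiff|exact: blB|]; last first.
  by move=> j ji x y; rewrite /pdiff set_row_ne// eq_sym.
by apply: avg_all_ext => x; rewrite avgsB.
Qed.

(** Let m be the common mean of the differences u_j. Averaging the sum U of the
u_j over the rows other than [i] gives u_i + (N - 1) m, while N |m| is at most
E|U|; hence E|u_i| <= E|U| + (N - 1) |m| <= 2 E|U|. *)
Lemma equal_means_pdiff mu phi psi i : bl_family phi -> bl_family psi ->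
  equal_means mu phi -> equal_means mu psi ->
  avg_all mu (fun x => `|pdiff phi psi i x|) <= 2 * avg_all mu (fun x => `|pdiff_sum phi psi x|).
Proof.
move=> bp bq [m1 H1] [m2 H2]; have bU := bl_pdiff_sum bp bq.
set a := avg_all mu (fun x => `|pdiff_sum phi psi x|).
pose m := m1 - m2; pose u j y := phi j y - psi j y.
have bu j : bl (u j) by exact: blB.
have Hm j : avg_all mu (pdiff phi psi j) = m by rewrite avg_allB ?H1 ?H2//; exact: bl_row.
have EU : avg_all mu (pdiff_sum phi psi) = N%:R * m.
  rewrite (avg_all_ext _ (pdiff_sumE phi psi)) avg_all_sum; last by move=> j; exact: bl_pdiff.
  by rewrite (eq_bigr (fun=> m))// sumr_const card_ord mulr_natl.
have Nm : N%:R * `|m| <= a.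
  by rewrite -[N%:R]ger0_norm// -normrM -EU avg_all_norm.
have E x : avgs mu (others i) (pdiff_sum phi psi) x = pdiff phi psi i x + (N%:R - 1) * m.
  rewrite (avgs_ext mu (others i) x (pdiff_sumE phi psi)) avgs_sum; last by move=> j;
    exact: bl_pdiff.
  rewrite (bigD1 i)//=; congr (_ + _).
    rewrite avgs_row_indep// => j; rewrite mem_others => ji z w.
    by rewrite /pdiff set_row_ne// eq_sym.
  rewrite (eq_bigr (fun=> m)).
    rewrite mulrBl mul1r mulr_natl -[in RHS](card_ord N) -sumr_const [in RHS](bigD1 i)//=.
    by rewrite [in RHS]addrAC subrr add0r.
  by move=> j ji; rewrite (avgs_others_row mu x (bu j) ji) -(Hm j).
have bN : bl (fun x => `|avgs mu (others i) (pdiff_sum phi psi) x|) by apply: bl_norm;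
  exact: bl_avgs.
have H : avg_all mu (fun x => `|avgs mu (others i) (pdiff_sum phi psi) x|) <= a.
  rewrite /a -(avg_all_tower mu i (bl_norm bU)); apply: avg_all_le => //.
    by apply: bl_avgs; exact: bl_norm.
  by move=> x; exact: avgs_norm.
apply: (@le_trans _ _ (avg_all mu (fun x => `|avgs mu (others i) (pdiff_sum phi psi) x| +
  (N%:R - 1) * `|m|))).
  apply: avg_all_le; [by apply: bl_norm; exact: bl_pdiff|by apply: blD => //; exact: bl_cst|].
  have N1 : 0 <= N%:R - 1 :> R by rewrite subr_ge0 ler1n.
  move=> x; rewrite E -[X in X * `|m|]ger0_norm// -normrM.
  by rewrite -{1}[pdiff phi psi i x](addrK ((N%:R - 1) * m)) ler_normB.
rewrite avg_allD ?avg_all_cst//; last exact: bl_cst.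
by have m0 := normr_ge0 m; move: H Nm m0; lra.
Qed.

Lemma avgs_exp_potsum_butB mu phi psi (B : R) i x : bl_family phi -> bl_family psi ->
  (forall i y, `|phi i y| <= B) -> (forall i y, `|psi i y| <= B) ->
  avgs mu (others i) (fun x => `|expR (potsum_but phi i x) - expR (potsum_but psi i x)|) x <=
  expR (N%:R * B) * \sum_(j | j != i) avg_all mu (fun x => `|pdiff phi psi j x|).
Proof.
move=> bp bq pB qB.
have bs : bl (fun x => \sum_(j <- others i) `|pdiff phi psi j x|).
  by apply: bl_sum => j _; apply: bl_norm; exact: bl_pdiff.
apply: (@le_trans _ _ (avgs mu (others i) (fun x => expR (N%:R * B) * \sum_(j <- others i)
  `|pdiff phi psi j x|) x)).
  apply: avgs_le; [by apply: bl_norm; apply: blB;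
    exact: bl_exp_potsum_but|by apply: blM => //; exact: bl_cst|].
  move=> z; rewrite (le_trans (expRB_le (potsum_but_bound i z pB) (potsum_but_bound i z qB)))//.
  rewrite ler_wpM2l ?expR_ge0// /potsum_but -sumrB (sum_others (fun j => `|pdiff phi psi j z|)).
  exact: ler_norm_sum.
rewrite avgsZ// ler_wpM2l ?expR_ge0// avgs_sum; last by move=> j; apply: bl_norm; exact: bl_pdiff.
rewrite (sum_others (fun j => avgs mu (others i) (fun x => `|pdiff phi psi j x|) x)).
apply: ler_sum => j ji.
rewrite (@avgs_others_row _ _ _ mu (fun y => `|phi j y - psi j y|) i j x)//.
by apply: bl_norm; exact: blB.
Qed.

(** A pointwise estimate in [y] from an estimate in mean on the potentials: this is
how averaging upgrades the control on the differences. *)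
Lemma kernel_intB mu phi psi (B : R) i y : bl_family phi -> bl_family psi ->
  (forall i y, `|phi i y| <= B) -> (forall i y, `|psi i y| <= B) ->
  `|kernel_int mu phi i y - kernel_int mu psi i y| <=
  expR kappa * (expR (N%:R * B) * \sum_(j | j != i) avg_all mu (fun x => `|pdiff phi psi j x|)).
Proof.
move=> bp bq pB qB; rewrite /kernel_int -avgsB; [|exact: bl_integrand..].
apply: le_trans (avgs_norm _ _ _ _) _; first by apply: blB; exact: bl_integrand.
have bd : bl (fun x => `|expR (potsum_but phi i x) - expR (potsum_but psi i x)|).
  by apply: bl_norm; apply: blB; exact: bl_exp_potsum_but.
apply: le_trans (ler_wpM2l (expR_ge0 kappa) (avgs_exp_potsum_butB mu i 0 bp bq pB qB)).
rewrite -avgsZ//; apply: avgs_le.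
- by apply: bl_norm; apply: blB; exact: bl_integrand.
- by apply: blM => //; exact: bl_cst.
- move=> x; rewrite -mulrBl normrM mulrC ler_wpM2r//.
  by rewrite ger0_norm ?expR_ge0//; exact: K_le.
Qed.

Lemma BL_regular (u : rv -> R) (B : R) : regular u -> (forall y, `|u y| <= B) ->
  BL (B + expR kappa * MK) u.
Proof.
move=> [_ lip] uB; have MK0 := BL_ge0 K_BL.
have B0 : 0 <= B by rewrite (le_trans _ (uB 0)).
split=> [y|y y']; first by rewrite (le_trans (uB y))// lerDl mulr_ge0 ?expR_ge0.
by rewrite (le_trans (lip _ _))// ler_wpM2r ?dist1_ge0// lerDr.
Qed.

Lemma BL_potsum phi (B : R) : (forall i, BL B (phi i)) -> BL (N%:R * B) (potsum phi).
Proof.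
move=> pB; rewrite mulr_natl -[in X in BL X](card_ord N) -sumr_const.
by apply: BL_sum => i _; exact: BL_row.
Qed.

Lemma BL_potsum_but phi (B : R) i : (forall i, BL B (phi i)) -> BL (N%:R * B) (potsum_but phi i).
Proof.
move=> pB; have B0 := BL_ge0 (pB i).
apply: (@BLW _ _ _ (\sum_(j | j != i) B)).
  rewrite mulr_natl -[in leRHS](card_ord N) -sumr_const [leRHS](bigD1 i)//=.
  by rewrite lerDr.
by apply: BL_sum => j _; exact: BL_row.
Qed.

Lemma dist_triangle4 (a b a' b' : R) :
  `|a - b| <= `|a' - b'| + (`|a - a'| + `|b - b'|).
Proof.
have -> : a - b = (a' - b') + ((a - a') - (b - b')) by ring.
by rewrite (le_trans (ler_normD _ _))// lerD2l ler_normB.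
Qed.

Lemma le_of_fractions (a b D : R) : (forall n, a <= b + D / n.+1%:R) -> a <= b.
Proof.
move=> H; apply/ler_addgt0Pr => e e0.
have D0 : 0 <= `|D| := normr_ge0 D.
have [n Hn] : exists n : nat, `|D| / e < n.+1%:R.
  exists (Num.truncn (`|D| / e)); exact: truncnS_gt.
apply: le_trans (H n) _; rewrite lerD2l ler_pdivrMr//.
move: Hn; rewrite ltr_pdivrMr// mulrC => /ltW; exact: le_trans (ler_norm D).
Qed.

(** * Stability of solutions *)

Section stability.
Variable k : nat.
Hypothesis K_smooth : forall i, smooth (rowdir i) (BL MK) k K.

Lemma smooth_integrand phi i (M : R) : BL M (fun x => expR (potsum_but phi i x)) ->
  smooth (rowdir i) (BL (2 * (M * MK))) k (fun x => expR (potsum_but phi i x) * K x).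
Proof.
move=> bM; apply: smooth_indepM => // x y; by rewrite row_indep_potsum_but.
Qed.

Lemma smooth_kernel_int mu phi i (M : R) : BL M (fun x => expR (potsum_but phi i x)) ->
  smooth predT (CB0 (2 * (M * MK))) k (kernel_int mu phi i).
Proof.
move=> bM; rewrite (_ : kernel_int mu phi i = fun y : rv =>
  avgs mu (others i) (fun x => expR (potsum_but phi i x) * K x) (row_only i y)); last first.
  by apply/funext => y; exact: kernel_int_row_only.
apply: smooth_row_only; last first.
  apply: BL_smooth_CB; apply: smooth_avgs (smooth_integrand bM).
  by rewrite mem_others eqxx.
by move=> g; exact: CB0_row_only.
Qed.

(** A solution is minus the logarithm of [kernel_int], and the derivatives of
[kernel_int] are averages of derivatives of the kernel. *)
Lemma solves_smooth mu phi i : bl_family phi -> solves mu phi ->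
  exists M, smooth predT (CB0 M) k (phi i).
Proof.
move=> bp sp; have [Mh bMh] := bl_exp_potsum_but i bp.
have [B [pB _]] := bp i.
have [|M' HM'] := CB_ln (expR_gt0 (- B)) (smooth_kernel_int mu bMh).
  move=> y; have -> : kernel_int mu phi i y = expR (- phi i y).
    apply: (mulfI (lt0r_neq0 (expR_gt0 (phi i y)))).
    by rewrite sp -expRD subrr expR0.
  by rewrite ler_expR lerN2 (le_trans (ler_norm _)).
exists (`|0 : R| + M'); rewrite (_ : phi i = cst 0 - (@ln R \o kernel_int mu phi i)).
  by apply: CBB => //; exact: CB0_cst.
by apply/funext => y; rewrite !fctE/= sub0r (solves_sinkhorn bp sp).
Qed.

(** Both solutions are first normalized to have equal means under [mu], which makes
them bounded by a universal constant. The key inequality then bounds a = E|U|: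
it reads delta a^2 <= const * eta * a, where eta sums the distances between
the marginals. The bound on a controls the weights in [kernel_int], and
[smooth_avgs_diff] followed by the logarithm gives the estimate with
derivatives. The constants [kp] come from the two normalizations. *)
Lemma stability : exists2 C : R, 0 < C & forall mu nu (e : 'I_N -> R) phi psi,
  (forall j, BL_dist_le (mu j) (nu j) (e j)) -> (forall j, 0 <= e j) ->
  bl_family phi -> bl_family psi -> solves mu phi -> solves nu psi ->
  exists2 kp : 'I_N -> R, \sum_i kp i = 0 & forall i,
    smooth predT (CB0 (C * \sum_j e j)) k (fun y => phi i y - psi i y - kp i).
Proof.
have [Mc c_BL] := c_bl.
(* [B1] bounds the normalized potentials, [Mp] their densities and [Mh] the
   weights of [kernel_int], all as bounded Lipschitz functions; [Ca] is the constant
   in the bound on [a], [Ct] the one for the weights, and [D] the one for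
   [kernel_int] *)
pose B1 := pot_bound + expR kappa * MK.
pose s1 := N%:R * B1 + Mc.
pose Mp := expR s1 + expR s1 * s1.
pose s2 := N%:R * B1.
pose Mh := expR s2 + expR s2 * s2.
pose dl := expR (- (N%:R * pot_bound + kappa)).
have dl0 : 0 < dl by exact: expR_gt0.
pose Ca := 2 * N%:R * Mp / dl.
pose Ct := expR (N%:R * pot_bound) * (N%:R * (2 * Ca)).
pose D := MK * Ct + 2 * (Mh * MK).
pose MA := 2 * (Mh * MK).
have [C1 C10 HC1] := @CB_lnB R 1 d (expR (- pot_bound)) MA k (expR_gt0 _).
have B10 : 0 <= B1 by rewrite addr_ge0 ?pot_bound_ge0// mulr_ge0 ?expR_ge0// (BL_ge0 K_BL).
have s20 : 0 <= s2 by rewrite mulr_ge0.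
have s10 : 0 <= s1 by rewrite addr_ge0// (BL_ge0 c_BL).
have Mp0 : 0 <= Mp by rewrite addr_ge0 ?mulr_ge0 ?expR_ge0.
have Mh0 : 0 <= Mh by rewrite addr_ge0 ?mulr_ge0 ?expR_ge0.
have Ca0 : 0 <= Ca by rewrite /Ca divr_ge0 ?(ltW dl0)// !mulr_ge0.
have Ct0 : 0 <= Ct.
  by apply: mulr_ge0; [exact: expR_ge0|apply: mulr_ge0 => //; exact: mulr_ge0].
have MK0 := BL_ge0 K_BL.
have D0 : 0 <= D by apply: addr_ge0; [exact: mulr_ge0|apply: mulr_ge0 => //; exact: mulr_ge0].
exists (C1 * D + 1); first by rewrite ltr_wpDl// mulr_ge0.
move=> mu nu e phi0 psi0 mn e0 bp0 bq0 sp0 sq0.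
have eta0 : 0 <= \sum_j e j by apply: sumr_ge0.
set eta := \sum_j e j in eta0 *.
have [k1 k10 m1] := normalize mu bp0; have [k2 k20 m2] := normalize mu bq0.
set phi := shift_pots k1 phi0 in m1; set psi := shift_pots k2 psi0 in m2.
have bp : bl_family phi := bl_family_shift k1 bp0;
  have bq : bl_family psi := bl_family_shift k2 bq0.
have sp : solves mu phi := solves_shift bp0 k10 sp0.
have sq : solves nu psi := solves_shift bq0 k20 sq0.
have ap := solves_admissible bp sp; have aq := solves_admissible bq sq.
pose i0 := Ordinal N0.
have pB := admissible_bound ap m1 (avg_all_density (i := i0) bp (fun x => solves_avgs_density
  i0 x bp sp)).
have qB := admissible_bound aq m2 (avg_all_density (i := i0) bq (fun x => solves_avgs_density
  i0 x bq sq)).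
have BLp i : BL B1 (phi i) := BL_regular (ap i) (pB i).
have BLq i : BL B1 (psi i) := BL_regular (aq i) (qB i).
set a := avg_all mu (fun x => `|pdiff_sum phi psi x|).
have a0 : 0 <= a by apply: avg_all_norm_ge0; exact: bl_pdiff_sum.
have du i : avg_all mu (fun x => `|pdiff phi psi i x|) <= 2 * a by exact: equal_means_pdiff.
have aeta : a <= Ca * eta.
  have key := key_inequality mu bp bq pB qB.
  have : dl * a ^+ 2 <= \sum_(i < N) (Mp * eta) * (2 * a).
    apply: le_trans key _; apply: ler_sum => i _.
    have bdi : bl (pdiff phi psi i) := bl_pdiff i bp bq.
    have bpo : bl (avgs mu (others i) (density phi)) by apply: bl_avgs; exact: bl_density.
    have bqo : bl (avgs mu (others i) (density psi)) by apply: bl_avgs; exact: bl_density.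
    apply: le_trans (ler_norm _) _; apply: le_trans (avg_all_norm _ _) _.
      by apply: blM => //; exact: blB.
    apply: le_trans (ler_wpM2l _ (du i)); last by rewrite mulr_ge0.
    rewrite -avg_allZ; last exact: bl_norm.
    apply: avg_all_le.
    - by apply: bl_norm; apply: blM => //; exact: blB.
    - by apply: blM; [exact: bl_cst|exact: bl_norm].
    - move=> x; rewrite normrM mulrC ler_wpM2r// solves_avgs_density//.
      rewrite -(solves_avgs_density i x bq sq) distrC.
      have bpot : BL Mp (density psi) by apply: BL_expR; apply: BLB => //; exact: BL_potsum.
      apply: le_trans (avgs_BL_dist (others i) x mn bpot) _.
      rewrite ler_wpM2l// sum_others /eta [leRHS](bigD1 i)//= lerDr//.
  rewrite sumr_const card_ord -[X in _ <= X]mulr_natl => H.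
  (* one factor [a] is cancelled in the key inequality *)
  have [a_eq0|an0] := eqVneq a 0; first by rewrite a_eq0 mulr_ge0.
  have ap0 : 0 < a by rewrite lt_neqAle eq_sym an0.
  rewrite /Ca mulrAC ler_pdivlMr//.
  rewrite -(ler_pM2r ap0); move: H; rewrite expr2.
  by congr (_ <= _); ring.
exists (fun i => k2 i - k1 i); first by rewrite sumrB k10 k20 subrr.
move=> i.
have bh1 : BL Mh (fun x => expR (potsum_but phi i x)) by apply: BL_expR; exact: BL_potsum_but.
have bh2 : BL Mh (fun x => expR (potsum_but psi i x)) by apply: BL_expR; exact: BL_potsum_but.
have Hdiff : smooth predT (CB0 (D * eta)) k (kernel_int mu phi i - kernel_int nu psi i).
  have ht x : avgs mu (others i) (fun x => `|expR (potsum_but phi i x) - expR (potsum_but psi i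
    x)|) x
      <= Ct * eta.
    apply: le_trans (avgs_exp_potsum_butB mu i x bp bq pB qB) _.
    rewrite /Ct -mulrA ler_wpM2l ?expR_ge0//.
    apply: (@le_trans _ _ (\sum_(j < N) 2 * (Ca * eta))).
      rewrite [leRHS](bigD1 i)//=; apply: ler_wpDl; first by apply: mulr_ge0 => //; exact: mulr_ge0.
      apply: ler_sum => j _; apply: le_trans (du j) _.
      by rewrite ler_wpM2l.
    by rewrite sumr_const card_ord -[leLHS]mulr_natl !mulrA.
  have H := smooth_avgs_diff mn e0 bh1 bh2 (row_indep_exp_potsum_but phi i)
    (row_indep_exp_potsum_but psi i)
    ht (K_smooth i).
  have -> : kernel_int mu phi i - kernel_int nu psi i = (fun y : rv =>
    avgs mu (others i) (fun x => expR (potsum_but phi i x) * K x) (row_only i y) -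
    avgs nu (others i) (fun x => expR (potsum_but psi i x) * K x) (row_only i y)).
    by apply/funext => y; rewrite !fctE !kernel_int_row_only.
  apply: smooth_row_only H => g bg; apply: CB0_row_only; apply: CB0W bg.
  by have -> : D * eta = MK * (Ct * eta) + 2 * (Mh * MK) * eta by rewrite /D; ring.
have lowA (mu' : 'I_N -> prob) phi' : solves mu' phi' -> (forall i y, `|phi' i y| <= pot_bound) ->
    forall y, expR (- pot_bound) <= kernel_int mu' phi' i y.
  move=> s' b' y; have -> : kernel_int mu' phi' i y = expR (- phi' i y).
    apply: (mulfI (lt0r_neq0 (expR_gt0 (phi' i y)))).
    by rewrite s' -expRD subrr expR0.
  by rewrite ler_expR lerN2 (le_trans (ler_norm _)).
have := HC1 predT _ _ _ (smooth_kernel_int mu bh1) (smooth_kernel_int nu bh2) (lowA _ _ sp pB)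
  (lowA _ _ sq qB) Hdiff.
move=> /(CBB (CB0_cst predT k 0)).
rewrite (_ : cst 0 - _ = fun y : rv => phi0 i y - psi0 i y - (k2 i - k1 i)); last first.
  apply/funext => y; rewrite !fctE/= sub0r opprB.
  have := solves_sinkhorn bp sp i y; have := solves_sinkhorn bq sq i y.
  by rewrite /sinkhorn /phi /psi /shift_pots => Eq Ep; lra.
by apply: CBW; rewrite normr0 add0r [leRHS]mulrDl mul1r mulrA lerDl.
Qed.

End stability.

(** * Existence of solutions *)

Section existence.
Variable mu : 'I_N -> prob.

(** The objective of the dual of entropic optimal transport; it is concave in the
potentials, and its stationarity conditions are the equations of the system. *)
Definition dual_value phi : R := avg_all mu (potsum phi) - avg_all mu (density phi).

Definition update_pot phi i (u : rv -> R) : 'I_N -> rv -> R :=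
  fun j => if j == i then u else phi j.

Definition sinkhorn_step phi i := update_pot phi i (sinkhorn mu phi i).

(** How far the [i]-th equation is from being satisfied. *)
Definition gap phi i x : R := sinkhorn mu phi i (row i x) - phi i (row i x).

(** Pointwise, s - exp(s - c) <= c - 1. *)
Lemma dual_value_le phi : bl_family phi -> dual_value phi <= kappa.
Proof.
move=> bp; rewrite /dual_value -avg_allB; [|exact: bl_potsum|exact: bl_density].
rewrite -[leRHS](avg_all_cst mu); apply: avg_all_le; [|exact: bl_cst|].
  by apply: blB; [exact: bl_potsum|exact: bl_density].
move=> x; rewrite /density; have := expR_ge1Dx (potsum phi x - c x).
have := c_kappa x; rewrite ler_norml => /andP[_]; lra.
Qed.

Lemma potsum_but_step phi i x : potsum_but (sinkhorn_step phi i) i x = potsum_but phi i x.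
Proof. by apply: eq_bigr => j /negPf ji; rewrite /sinkhorn_step /update_pot ji. Qed.

Lemma kernel_int_step phi i y : kernel_int mu (sinkhorn_step phi i) i y = kernel_int mu phi i y.
Proof. by apply: avgs_ext => x; rewrite potsum_but_step. Qed.

Lemma admissible_step phi i : admissible phi -> admissible (sinkhorn_step phi i).
Proof.
move=> ap j; rewrite /sinkhorn_step /update_pot; case: eqP => // _.
exact: sinkhorn_regular (admissible_bl ap).
Qed.

Lemma bl_sinkhorn phi i : bl_family phi -> bl (sinkhorn mu phi i).
Proof.
move=> bp; have H : admissible (fun=> sinkhorn mu phi i) by move=> j; exact: sinkhorn_regular.
exact: (admissible_bl H i).
Qed.

Lemma bl_gap phi i : bl_family phi -> bl (gap phi i).
Proof. by move=> bp; apply: blB; apply: bl_row => //; exact: bl_sinkhorn. Qed.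

(** The defect in the [i]-th equation is a function of the increment of the
Sinkhorn update alone. *)
Lemma avgs_density_gap phi i x : bl_family phi ->
  avgs mu (others i) (density phi) x = expR (- gap phi i x).
Proof.
move=> bp; rewrite avgs_density// /gap opprB expRD expRN.
congr (_ * _); apply: (mulfI (lt0r_neq0 (expR_gt0 (sinkhorn mu phi i (row i x))))).
by rewrite expR_sinkhorn// divff// gt_eqF// expR_gt0.
Qed.

Lemma bl_family_step phi i : bl_family phi -> bl_family (sinkhorn_step phi i).
Proof. by move=> bp j; rewrite /sinkhorn_step /update_pot; case: eqP => // _;
  exact: bl_sinkhorn. Qed.

Lemma avg_all_density_step phi i : bl_family phi -> avg_all mu (density (sinkhorn_step phi i)) = 1.
Proof.
move=> bp; apply: (avg_all_density (i := i)); first exact: bl_family_step.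
move=> x; rewrite avgs_density; last exact: bl_family_step.
by rewrite kernel_int_step /sinkhorn_step /update_pot eqxx expR_sinkhorn.
Qed.

(** After the update the density has expectation 1, and before it the expectation
of exp(-s), where s is the increment of the [i]-th potential. *)
Lemma dual_value_step phi i : bl_family phi -> dual_value (sinkhorn_step phi i) - dual_value phi =
  avg_all mu (fun x => gap phi i x + expR (- gap phi i x) - 1).
Proof.
move=> bp; have bg := bl_gap i bp.
have beg : bl (fun x => expR (- gap phi i x)) by apply: bl_expR; exact: blN.
rewrite /dual_value avg_all_density_step// -(avg_all_tower mu i (bl_density bp)).
rewrite (avg_all_ext mu (fun x => avgs_density_gap i x bp)).
rewrite avg_allB; [|exact: blD|exact: bl_cst]; rewrite avg_allD// avg_all_cst.
rewrite (avg_all_ext mu (g := fun x => potsum phi x + gap phi i x)); last first.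
  move=> x; rewrite (potsumE _ i) potsum_but_step (potsumE phi i) /gap /sinkhorn_step
    /update_pot eqxx.
  by ring.
rewrite avg_allD//; last exact: bl_potsum.
by ring.
Qed.

(** Put v = exp(-s/2): the claim reads 2 v - 2 + s >= 0, that is, v >= 1 - s/2. *)
Lemma entropy_ge (s : R) : (1 - expR (- s / 2)) ^+ 2 <= s + expR (- s) - 1.
Proof.
have -> : expR (- s) = expR (- s / 2) ^+ 2 by rewrite expr2 -expRD -splitr.
by have := expR_ge1Dx (- s / 2); lra.
Qed.

Lemma dual_value_step_ge phi i : bl_family phi ->
  avg_all mu (fun x => (1 - expR (- gap phi i x / 2)) ^+ 2) <=
    dual_value (sinkhorn_step phi i) - dual_value phi.
Proof.
move=> bp; have bg := bl_gap i bp; rewrite dual_value_step//.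
have beg : bl (fun x => expR (- gap phi i x)) by apply: bl_expR; exact: blN.
apply: avg_all_le; last by move=> x; exact: entropy_ge.
  apply: blX2; apply: blB; first exact: bl_cst.
  apply: bl_expR; apply: blM; [exact: blN|exact: bl_cst].
by apply: blB; [exact: blD|exact: bl_cst].
Qed.

Lemma dual_value_shift k phi : \sum_i k i = 0 -> dual_value (shift_pots k phi) = dual_value phi.
Proof.
move=> k0; rewrite /dual_value density_shift//; congr (_ - _).
by apply: avg_all_ext => x; rewrite potsum_shift.
Qed.

(** A single update of an almost optimal admissible family makes its density a
probability density without lowering the functional. After normalization the
family is bounded by a universal constant, and each further update gains at
most the remaining distance to the supremum. *)
Lemma near_maximizer (e : R) : 0 < e -> exists phi, [/\ admissible phi, equal_means mu phi,
  (forall i y, `|phi i y| <= pot_bound) &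
  forall i, avg_all mu (fun x => (1 - expR (- gap phi i x / 2)) ^+ 2) <= e].
Proof.
move=> e0; pose S := [set dual_value phi | phi in admissible].
have S0 : has_sup S.
  split; last by exists kappa => _ [phi ap <-]; exact: dual_value_le (admissible_bl ap).
  exists (dual_value (fun _ _ => 0)), (fun _ _ => 0) => // i.
  have k0 := kappa_ge0; split=> y y'; rewrite subrr normr0; first by rewrite mulr_ge0.
  by rewrite !mulr_ge0 ?expR_ge0 ?(BL_ge0 K_BL) ?dist1_ge0.
have [_ [phi0 ap0 <-] H0] := sup_adherent e0 S0.
pose i0 := Ordinal N0; have bp0 := admissible_bl ap0.
have ap1 : admissible (sinkhorn_step phi0 i0) := admissible_step i0 ap0;
  have bp1 := admissible_bl ap1.
have [k k0 m2] := normalize mu bp1.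
have ap2 := admissible_shift k ap1.
set phi := shift_pots k (sinkhorn_step phi0 i0) in m2 ap2.
have bp := admissible_bl ap2.
exists phi; split=> //.
  by apply: (admissible_bound (mu' := mu) ap2 m2); rewrite density_shift// avg_all_density_step.
move=> i; apply: le_trans (dual_value_step_ge i bp) _.
have h1 : dual_value (sinkhorn_step phi i) <= sup S.
  by apply: (sup_upper_bound S0); exists (sinkhorn_step phi i) => //; exact: admissible_step.
have h2 : dual_value phi0 <= dual_value phi.
  rewrite dual_value_shift// -subr_ge0; apply: le_trans (dual_value_step_ge i0 bp0).
  rewrite -(avg_all_cst mu 0); apply: avg_all_le; [exact: bl_cst| |by move=> x; exact: sqr_ge0].
  apply: blX2; apply: blB; first exact: bl_cst.
  by apply: bl_expR; apply: blM; [apply: blN; exact: bl_gap|exact: bl_cst].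
by move: h1 h2 H0; lra.
Qed.

Definition sinkhorn_bound : R := N%:R * pot_bound + kappa.

Lemma kernel_int_range phi i y : bl_family phi -> (forall i y, `|phi i y| <= pot_bound) ->
  expR (- sinkhorn_bound) <= kernel_int mu phi i y /\ kernel_int mu phi i y <= expR sinkhorn_bound.
Proof.
move=> bp pB; have H x : `|potsum_but phi i x - c (set_row x i y)| <= sinkhorn_bound.
  by rewrite (le_trans (ler_normB _ _))// lerD//; exact: potsum_but_bound.
have bi := bl_integrand i y bp.
split.
  rewrite -[leLHS](avgs_cst mu (others i) _ 0); apply: avgs_le => //; first exact: bl_cst.
  by move=> x; rewrite -expRD ler_expR; have := H x; rewrite ler_norml => /andP[].
rewrite -[leRHS](avgs_cst mu (others i) _ 0); apply: avgs_le => //; first exact: bl_cst.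
by move=> x; rewrite -expRD ler_expR; have := H x; rewrite ler_norml => /andP[].
Qed.

Lemma sinkhorn_bounded phi i y : bl_family phi -> (forall i y, `|phi i y| <= pot_bound) ->
  `|sinkhorn mu phi i y| <= sinkhorn_bound.
Proof.
move=> bp pB; have [h1 h2] := kernel_int_range i y bp pB; have A0 := kernel_int_gt0 mu i y bp.
rewrite /sinkhorn normrN ler_norml -[X in X <= _]expRK -[X in _ && (_ <= X)]expRK.
by rewrite !ler_ln ?posrE ?expR_gt0// h1 h2.
Qed.

Definition gap_max : R := sinkhorn_bound + pot_bound.

Lemma gap_bound phi i x : bl_family phi -> (forall i y, `|phi i y| <= pot_bound) ->
  `|gap phi i x| <= gap_max.
Proof.
by move=> bp pB; rewrite (le_trans (ler_normB _ _))// lerD//; exact: sinkhorn_bounded.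
Qed.

Lemma sinkhorn_bound_ge0 : 0 <= sinkhorn_bound.
Proof. by apply: addr_ge0; [apply: mulr_ge0 => //; exact: pot_bound_ge0|exact: kappa_ge0]. Qed.

Lemma gap_max_ge0 : 0 <= gap_max.
Proof. by apply: addr_ge0; [exact: sinkhorn_bound_ge0|exact: pot_bound_ge0]. Qed.

(** As the increments are uniformly bounded, the smallness of the gain, which is
quadratic in 1 - exp(-s/2), gives that of E|s|. *)
Lemma approx_solution (t : R) : 0 < t -> exists phi, [/\ admissible phi, equal_means mu phi,
  (forall i y, `|phi i y| <= pot_bound) &
  forall i, avg_all mu (fun x => `|gap phi i x|) <= t].
Proof.
(* chosen so that Cauchy-Schwarz returns exactly [t] *)
move=> t0; pose e : R := (expR (- gap_max) * (t / 2)) ^+ 2.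
have e0 : 0 < e by rewrite exprn_gt0// mulr_gt0 ?expR_gt0// divr_gt0.
have [phi [ap m pB H]] := near_maximizer e0; have bp := admissible_bl ap.
exists phi; split=> // i; have bg := bl_gap i bp.
have h : bl (fun x => 1 - expR (- gap phi i x / 2)).
  apply: blB; first exact: bl_cst.
  by apply: bl_expR; apply: blM; [exact: blN|exact: bl_cst].
have H1 : avg_all mu (fun x => `|1 - expR (- gap phi i x / 2)|) <= expR (- gap_max) * (t / 2).
  rewrite -(@ler_pXn2r _ 2)// ?nnegrE ?avg_all_norm_ge0//; last first.
    by rewrite mulr_ge0 ?expR_ge0// ltW// divr_gt0.
  exact: le_trans (avg_all_norm_sqr mu h) (H i).
have H2 : avg_all mu (fun x => expR (- gap_max) / 2 * `|gap phi i x|) <= expR (- gap_max) * (t / 2).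
  apply: le_trans H1; apply: avg_all_le; [|exact: bl_norm|].
    by apply: blM; [exact: bl_cst|exact: bl_norm].
  move=> x; rewrite -[in X in X - _]expR0.
  have gb : `|- gap phi i x / 2| <= gap_max.
    rewrite normrM normrN (ger0_norm (_ : 0 <= 2^-1)) ?invr_ge0// ler_pdivrMr//.
    rewrite (le_trans (gap_bound i x bp pB))// ler_peMr ?gap_max_ge0//; lra.
  apply: le_trans (expRB_ge _ gb); last by rewrite normr0 gap_max_ge0.
  rewrite sub0r mulNr opprK normrM (ger0_norm (_ : 0 <= 2^-1)) ?invr_ge0//.
  by rewrite le_eqVlt; apply/orP; left; apply/eqP; ring.
move: H2; rewrite avg_allZ; last exact: bl_norm.
rewrite mulrAC -mulrA ler_pM2l ?expR_gt0// ler_pM2r ?invr_gt0//.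
Qed.

(** For approximate solutions the right-hand side of the key inequality is bounded
by the two defects. The defects are taken of the form s^2 and t^2, because the
inequality controls the square of the difference. *)
Lemma approx_cauchy : exists2 C : R, 0 <= C & forall (s t : R) phi psi, 0 <= s -> 0 <= t ->
  admissible phi -> admissible psi -> equal_means mu phi -> equal_means mu psi ->
  (forall i y, `|phi i y| <= pot_bound) -> (forall i y, `|psi i y| <= pot_bound) ->
  (forall i, avg_all mu (fun x => `|gap phi i x|) <= s ^+ 2) ->
  (forall i, avg_all mu (fun x => `|gap psi i x|) <= t ^+ 2) ->
  forall i y, `|kernel_int mu phi i y - kernel_int mu psi i y| <= C * (s + t).
Proof.
pose dl := expR (- (N%:R * pot_bound + kappa)).
have dl0 : 0 < dl by exact: expR_gt0.
pose E := N%:R * (2 * pot_bound * expR gap_max).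
have E0 : 0 <= E.
  by apply: mulr_ge0 => //; apply: mulr_ge0; [apply: mulr_ge0 => //;
    exact: pot_bound_ge0|exact: expR_ge0].
pose Ca := 1 + E / dl.
have Edl0 : 0 <= E / dl by rewrite divr_ge0// ltW.
have Ca1 : 1 <= Ca by rewrite lerDl.
have Ca0 : 0 <= Ca by exact: le_trans Ca1.
pose C := expR kappa * (expR (N%:R * pot_bound) * (N%:R * (2 * Ca))).
exists C.
  by rewrite /C; repeat (apply: mulr_ge0 => //; try exact: expR_ge0).
move=> s t phi psi s0 t0 ap aq m1 m2 pB qB hp hq i y.
have bp := admissible_bl ap; have bq := admissible_bl aq.
set a := avg_all mu (fun x => `|pdiff_sum phi psi x|).
have a0 : 0 <= a by apply: avg_all_norm_ge0; exact: bl_pdiff_sum.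
have du j : avg_all mu (fun x => `|pdiff phi psi j x|) <= 2 * a by exact: equal_means_pdiff.
have st2 : s ^+ 2 + t ^+ 2 <= (s + t) ^+ 2.
  have := mulr_ge0 s0 t0; rewrite !expr2 mulrDl !mulrDr; lra.
have ast : a <= Ca * (s + t).
  have key := key_inequality mu bp bq pB qB.
  have : dl * a ^+ 2 <= \sum_(i < N) 2 * pot_bound * expR gap_max * (s ^+ 2 + t ^+ 2).
    apply: le_trans key _; apply: ler_sum => j _.
    have bdi : bl (pdiff phi psi j) := bl_pdiff j bp bq.
    have bg1 := bl_gap j bp; have bg2 := bl_gap j bq.
    have bpo : bl (avgs mu (others j) (density phi)) by apply: bl_avgs; exact: bl_density.
    have bqo : bl (avgs mu (others j) (density psi)) by apply: bl_avgs; exact: bl_density.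
    apply: le_trans (ler_norm _) _; apply: le_trans (avg_all_norm _ _) _.
      by apply: blM => //; exact: blB.
    have c0 : 0 <= 2 * pot_bound * expR gap_max.
      by apply: mulr_ge0; [apply: mulr_ge0 => //; exact: pot_bound_ge0|exact: expR_ge0].
    apply: le_trans (ler_wpM2l c0 (lerD (hp j) (hq j))).
    rewrite -avg_allD; [|exact: bl_norm|exact: bl_norm].
    have bs : bl (fun x => `|gap phi j x| + `|gap psi j x|) by apply: blD; exact: bl_norm.
    rewrite -avg_allZ//; apply: avg_all_le.
    - by apply: bl_norm; apply: blM => //; exact: blB.
    - by apply: blM => //; exact: bl_cst.
    - move=> x; rewrite normrM -mulrA; apply: ler_pM => //.
        rewrite (le_trans (ler_normB _ _))// mulr2n mulrDl mul1r lerD//.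
      rewrite !avgs_density_gap//.
      apply: le_trans (expRB_le _ _) _; rewrite ?normrN; [exact: gap_bound|exact: gap_bound|].
      rewrite ler_wpM2l ?expR_ge0// opprK addrC (le_trans (ler_normB _ _))// addrC.
      exact: lexx.
  rewrite sumr_const card_ord -[X in _ <= X]mulr_natl => H.
  rewrite -(@ler_pXn2r _ 2)// ?nnegrE//; last by rewrite mulr_ge0// addr_ge0.
  rewrite exprMn; apply: (@le_trans _ _ (Ca * (s + t) ^+ 2)); last first.
    by rewrite ler_wpM2r ?sqr_ge0// expr2 ler_peMl.
  apply: (@le_trans _ _ (E / dl * (s + t) ^+ 2)); last first.
    by rewrite ler_wpM2r ?sqr_ge0// lerDr.
  rewrite mulrAC ler_pdivlMr// mulrC (le_trans H)//.
  by rewrite mulrA ler_wpM2l.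
apply: le_trans (kernel_intB mu i y bp bq pB qB) _.
rewrite /C -!mulrA ler_wpM2l ?expR_ge0// ler_wpM2l ?expR_ge0//.
apply: (@le_trans _ _ (\sum_(j < N) 2 * (Ca * (s + t)))).
  rewrite [leRHS](bigD1 i)//=; apply: ler_wpDl.
    by apply: mulr_ge0 => //; apply: mulr_ge0 => //; exact: addr_ge0.
  apply: ler_sum => j _; apply: le_trans (du j) _.
  by rewrite ler_wpM2l.
by rewrite sumr_const card_ord -[leLHS]mulr_natl.
Qed.

(** Along a sequence of approximate solutions the functions [kernel_int] form a
Cauchy sequence for the uniform norm. Minus the logarithm of the limit is close
to the updates of the approximate solutions, hence in mean to these solutions
themselves, so its own [kernel_int] is the limit. *)
Lemma solution_exists : exists phi, bl_family phi /\ solves mu phi.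
Proof.
have [C C0 HC] := approx_cauchy.
pose tau n : R := n.+1%:R^-1.
have tau0 n : 0 <= tau n by rewrite /tau invr_ge0.
have tau1 n : tau n <= 1 by rewrite /tau invf_le1// ler1n.
have /choice[F HF] : forall n, exists phi, [/\ admissible phi, equal_means mu phi,
    (forall i y, `|phi i y| <= pot_bound) &
    forall i, avg_all mu (fun x => `|gap phi i x|) <= tau n ^+ 2].
  by move=> n; apply: approx_solution; rewrite exprn_gt0// invr_gt0.
have aF n : admissible (F n) by case: (HF n).
have bF n : bl_family (F n) := admissible_bl (aF n).
have FB n : forall i y, `|F n i y| <= pot_bound by case: (HF n).
have gF n i : avg_all mu (fun x => `|gap (F n) i x|) <= tau n ^+ 2 by case: (HF n).
have Hc n m i y : `|kernel_int mu (F n) i y - kernel_int mu (F m) i y| <= C * (tau n + tau m).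
  have [? ? ? ?] := HF n; have [? ? ? ?] := HF m.
  exact: HC.
(* with the error bounds added, every term lies above the limit, which is
   therefore their infimum *)
pose S i y := [set kernel_int mu (F n) i y + C * tau n | n in [set: nat]].
pose Al i y := inf (S i y).
have Slb n i y : lbound (S i y) (kernel_int mu (F n) i y - C * tau n).
  move=> _ [m _ <-]; have := Hc n m i y; rewrite ler_norml => /andP[_]; lra.
have SI i y : has_inf (S i y).
  split; last by exists (kernel_int mu (F 0%N) i y - C * tau 0%N); exact: Slb.
  by exists (kernel_int mu (F 0%N) i y + C * tau 0%N); exists 0%N.
have Hl n i y : `|Al i y - kernel_int mu (F n) i y| <= C * tau n.
  rewrite ler_distl; apply/andP; split.
    by apply: lb_le_inf; [exact: (SI i y).1|exact: Slb].
  by apply: ge_inf; [exact: (SI i y).2|exists n].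
have Al_ge i y : expR (- sinkhorn_bound) <= Al i y.
  apply: lb_le_inf; first exact: (SI i y).1.
  move=> _ [n _ <-]; apply: ler_wpDr; first exact: mulr_ge0.
  by have [] := kernel_int_range i y (bF n) (FB n).
have Al_gt0 i y : 0 < Al i y by rewrite (lt_le_trans _ (Al_ge i y))// expR_gt0.
pose phi i y := - ln (Al i y).
have Hphi n i y : `|phi i y - sinkhorn mu (F n) i y| <= expR sinkhorn_bound * (C * tau n).
  rewrite /phi /sinkhorn -opprD normrN.
  have [h _] := kernel_int_range i y (bF n) (FB n).
  apply: le_trans (ln_Lip (expR_gt0 (- sinkhorn_bound)) (Al_ge i y) h) _.
  by rewrite expRN invrK ler_wpM2l ?expR_ge0.
have ap : admissible phi.
  move=> i.
  have tri n y y' : `|phi i y - phi i y'| <= `|sinkhorn mu (F n) i y - sinkhorn mu (F n) i y'| +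
      (2 * expR sinkhorn_bound * C) / n.+1%:R.
    have h1 := Hphi n i y; have h2 := Hphi n i y'.
    apply: le_trans (dist_triangle4 (phi i y) (phi i y') (sinkhorn mu (F n) i y) (sinkhorn mu
      (F n) i y')) _.
    rewrite lerD2l (le_trans (lerD h1 h2))// -mulr2n -[leLHS]mulr_natl.
    by rewrite !mulrA.
  split=> y y'; apply: (@le_of_fractions _ _ (2 * expR sinkhorn_bound * C)) => n;
    apply: le_trans (tri n y y') _; rewrite lerD2r.
    exact: (sinkhorn_regular mu i (bF n)).1.
  exact: (sinkhorn_regular mu i (bF n)).2.
have bp := admissible_bl ap; exists phi; split=> //.
have TF n i y : `|sinkhorn mu (F n) i y| <= sinkhorn_bound := sinkhorn_bounded i y (bF n) (FB n).
(* a common bound for the limit and for the whole sequence *)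
pose B3 := pot_bound + sinkhorn_bound + expR sinkhorn_bound * C.
have T0 := sinkhorn_bound_ge0; have Bd0 := pot_bound_ge0.
have eC0 : 0 <= expR sinkhorn_bound * C by rewrite mulr_ge0 ?expR_ge0.
have pB3 i y : `|phi i y| <= B3.
  rewrite -[phi i y](subrK (sinkhorn mu (F 0%N) i y)) (le_trans (ler_normD _ _))//.
  have := Hphi 0%N i y; have := TF 0%N i y; rewrite /tau invr1 mulr1 /B3; lra.
have FB3 n i y : `|F n i y| <= B3.
  by rewrite (le_trans (FB n i y))// /B3 -addrA lerDl addr_ge0.
have difB n j : avg_all mu (fun x => `|pdiff phi (F n) j x|) <=
  (expR sinkhorn_bound * C + 1) * tau n.
  have bd : bl (fun x => phi j (row j x) - sinkhorn mu (F n) j (row j x)).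
    by apply: blB; apply: bl_row => //; exact: bl_sinkhorn.
  have bg := bl_gap j (bF n).
  apply: (@le_trans _ _ (avg_all mu (fun x => expR sinkhorn_bound * (C * tau n) +
    `|gap (F n) j x|))).
    apply: avg_all_le.
    - by apply: bl_norm; exact: bl_pdiff.
    - by apply: blD; [exact: bl_cst|exact: bl_norm].
    - move=> x; rewrite /pdiff -[phi j (row j x)](subrK (sinkhorn mu (F n) j (row j x))) -addrA.
      by rewrite (le_trans (ler_normD _ _))// lerD2r.
  rewrite avg_allD ?avg_all_cst; [|exact: bl_cst|exact: bl_norm].
  rewrite mulrDl mul1r mulrA lerD2l (le_trans (gF n j))//.
  by rewrite expr2 ler_piMl.
pose D := expR kappa * (expR (N%:R * B3) * (N%:R * (expR sinkhorn_bound * C + 1))) + C.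
have AAl i y : kernel_int mu phi i y = Al i y.
  apply/eqP; rewrite -subr_eq0 -normr_le0.
  apply: (@le_of_fractions _ _ D) => n; rewrite add0r.
  rewrite -[kernel_int mu phi i y](subrK (kernel_int mu (F n) i y)) -addrA.
  rewrite (le_trans (ler_normD _ _))// /D mulrDl lerD//; last first.
    by rewrite distrC; exact: Hl.
  apply: le_trans (kernel_intB mu i y bp (bF n) pB3 (FB3 n)) _.
  rewrite -!mulrA ler_wpM2l ?expR_ge0// ler_wpM2l ?expR_ge0//.
  apply: (@le_trans _ _ (\sum_(j < N) (expR sinkhorn_bound * C + 1) * tau n)).
    rewrite [leRHS](bigD1 i)//=; apply: ler_wpDl; last by apply: ler_sum.
    by rewrite mulr_ge0// addr_ge0.
  by rewrite sumr_const card_ord -[leLHS]mulr_natl.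
by move=> i y; rewrite AAl /phi expRN lnK ?posrE// mulVf// gt_eqF.
Qed.

End existence.

End potentials.

(** * Product probabilities as iterated averages *)

Section full_measure.
Context {d : measure_display} {T : measurableType d} {R : realType}.
Variable P : probability T R.

Lemma integral_full (D : set T) (f : T -> R) : measurable D -> P D = 1%E -> bmeas f ->
  (\int[P]_(x in D) (f x)%:E)%E = (expect P f)%:E.
Proof.
move=> mD PD bf; rewrite -expectE//.
have PN : P (~` D) = 0%E by rewrite probability_setC// PD subee.
rewrite [RHS](negligible_integral (N := ~` D))//; first by rewrite setTD setCK.
- exact: measurableC.
- exact: (bmeas_integrable P bf).
Qed.

End full_measure.

Section tuple_integral.
Context {R : realType} {N d : nat}.
Notation mx := 'M[R]_(N, d).
Notation rv := 'rV[R]_d.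
Notation prob := (probability (borel_rV R d) R).
Implicit Types (mu nu : 'I_N -> prob) (x : mx).

(** Places the entries of the tuple in the rows listed by [s], leaving the other
rows of [x] unchanged; being stated for any [s], it goes through the induction
that defines product probabilities. *)
Definition fill n (s : 'I_n -> 'I_N) x (t : n.-tuple (borel_rV R d)) : mx :=
  \matrix_(i, l) if [pick j | s j == i] is Some j
                 then (tnth t j : rv) ord0 l else x i l.

Lemma bmeas_fill n (s : 'I_n -> 'I_N) x (f : mx -> R) : bl f ->
  bmeas (fun t => f (fill s x t)).
Proof.
move=> bf; split; last by case: bf => M [b _]; exists M => t; exact: b.
apply: measurable_continuous_mx; last exact: bl_continuous.
move=> i l; under eq_fun do rewrite mxE.
case: pickP => [j _|_]; last exact: measurable_cst.
by apply: (measurableT_comp (measurable_borel_coord ord0 l)); exact: measurable_tnth.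
Qed.

Lemma fill_cons n (s : 'I_n.+1 -> 'I_N) x (y : borel_rV R d) (t : n.-tuple (borel_rV R d)) :
  injective s ->
  fill s x (tuple_cons (y, t)) = fill (s \o lift ord0) (set_row x (s ord0) y) t.
Proof.
move=> injs; apply/matrixP => i l; rewrite !mxE.
case: pickP => [j /eqP <-|H].
  case: pickP => [j' /= /eqP /injs E|H'].
    by rewrite -E tnthS.
  case: (unliftP ord0 j) => [j'' E|->]; last by rewrite eqxx.
  by have := H' j''; rewrite /= -E eqxx.
case: pickP => [j' /= E|_]; first by have := H (lift ord0 j'); rewrite E.
by have := H ord0; rewrite eq_sym => ->.
Qed.

(** The product probability is built from its first factor and the product of the
others, so its integral unfolds into an average over the first listed row
followed by the averages over the remaining ones. *)
Lemma tuple_prob_integral mu n (s : 'I_n -> 'I_N) x (f : mx -> R) : injective s -> bl f ->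
  expect (tuple_prob (fun j => mu (s j))) (fun t => f (fill s x t)) =
  avgs mu [seq s j | j <- enum 'I_n] f x.
Proof.
move=> injs bf; apply: EFin_inj; rewrite -expectE; last exact: bmeas_fill.
elim: n s x injs => [|n IH] s x injs.
  have /measurable_realfun.measurable_EFinP H := (bmeas_fill s x bf).1.
  apply: etrans (integral_dirac _ measurableT H) _; rewrite diracT mul1e.
  rewrite (_ : enum 'I_0 = [::]) /=; last by apply: size0nil; rewrite size_enum_ord.
  congr (f _)%:E; apply/matrixP => i l; rewrite mxE.
  by case: pickP => [[]|].
have inj' : injective (s \o lift ord0) by move=> j j' /injs /lift_inj.
pose Q := tuple_prob (fun j => mu ((s \o lift ord0) j)).
pose F z := f (fill s x (tuple_cons z)).
have bF : bmeas F.
  have [m1 [M HM]] := bmeas_fill s x bf; split; last by exists M => z; exact: HM.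
  exact: (measurableT_comp m1 (measurable_tuple_cons (n := n))).
transitivity (\int[(mu (s ord0) \x Q)%E]_z (F z)%:E)%E.
  rewrite /= integral_distribution//.
    by apply/measurable_realfun.measurable_EFinP; exact: (bmeas_fill s x bf).1.
  exact: (bmeas_integrable (mu (s ord0) \x Q)%E bF).
rewrite (expect_prod1 (mu (s ord0)) Q bF).
rewrite enum_ordSl /= -map_comp.
rewrite -(expectE (mu (s ord0))); last by apply: bl_set_row_bmeas; exact: bl_avgs.
apply: eq_integral => y _; apply: etrans (esym (expectE Q (bmeas_sect1 bF y))) _.
apply: etrans (IH _ (set_row x (s ord0) y) inj').
by apply: eq_integral => t _; rewrite /F fill_cons.
Qed.

Lemma insert_at_fill (i : 'I_N) (xi : rv) (t : N.-1.-tuple (borel_rV R d)) :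
  insert_at i xi t = fill (lift i) (row_only i xi) t.
Proof.
apply/matrixP => j l; rewrite !mxE.
case: (unliftP i j) => [j' ->|->] /=.
  case: pickP => [j'' /eqP /lift_inj -> //|H].
  by have := H j'; rewrite eqxx.
case: pickP => [j' /eqP E|_]; last by rewrite eqxx.
by have := neq_lift i j'; rewrite E eqxx.
Qed.

Lemma perm_lift (i : 'I_N) : perm_eq [seq lift i j | j <- enum 'I_N.-1] (others i).
Proof.
apply: uniq_perm.
- by rewrite map_inj_uniq ?enum_uniq//; exact: lift_inj.
- by rewrite rem_uniq// enum_uniq.
move=> j; rewrite mem_others; apply/mapP/idP => [[j' _ ->]|ij].
  by rewrite eq_sym neq_lift.
have : i != j by rewrite eq_sym.
by move=> /unlift_some[j' jE _]; exists j' => //; rewrite mem_enum.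
Qed.

Lemma prod_prob_but_integral mu (i : 'I_N) (xi : rv) (f : mx -> R) : bl f ->
  expect (prod_prob_but mu i) (fun t => f (insert_at i xi t)) =
  avgs mu (others i) f (row_only i xi).
Proof.
move=> bf; rewrite -(avgs_perm _ _ bf (perm_lift i)).
rewrite -tuple_prob_integral//; last exact: lift_inj.
by congr expect; apply/funext => t; rewrite insert_at_fill.
Qed.

Lemma measurable_tuple_box n (A : 'I_n -> set (borel_rV R d)) :
  (forall j, measurable (A j)) ->
  measurable [set t : n.-tuple (borel_rV R d) | forall j, A j (tnth t j)].
Proof.
move=> mA.
have -> : [set t : n.-tuple (borel_rV R d) | forall j, A j (tnth t j)] =
    \bigcap_j (@tnth _ _ ^~ j) @^-1` A j.
  by apply/seteqP; split=> [t H j _|t H j]; exact: H.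
apply: fin_bigcap_measurable => [|j _]; first exact: finite_finset.
by rewrite -[X in measurable X]setTI; exact: measurable_tnth.
Qed.

Lemma tuple_prob_box n (Q : 'I_n -> prob) (A : 'I_n -> set (borel_rV R d)) :
  (forall j, measurable (A j)) -> (forall j, Q j (A j) = 1%E) ->
  tuple_prob Q [set t | forall j, A j (tnth t j)] = 1%E.
Proof.
elim: n Q A => [|n IH] Q A mA QA.
  rewrite /= diracE mem_set//=; by move=> [].
rewrite /= /distribution /pushforward.
have -> : @tuple_cons _ _ n @^-1` [set t | forall j, A j (tnth t j)] =
    A ord0 `*` [set t : n.-tuple _ | forall j : 'I_n, A (lift ord0 j) (tnth t j)].
  apply/seteqP; split=> [[y t] /= H|[y t] /= [H0 H] j].
    by split=> [|j]; [have := H ord0|have := H (lift ord0 j); rewrite tnthS].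
  by case: (unliftP ord0 j) => [j' ->|->//]; rewrite tnthS.
have mB := @measurable_tuple_box n (fun j => A (lift ord0 j)) (fun j => mA _).
rewrite product_measure1E// -[RHS]mule1; congr (_ * _)%E; first exact: QA.
by apply: (IH (fun j => Q (lift ord0 j)) (fun j => A (lift ord0 j))) => j; [exact: mA|exact: QA].
Qed.

Lemma prod_prob_but_box (X : 'I_N -> set rv) mu (i : 'I_N) :
  (forall j, measurable (X j : set (borel_rV R d))) ->
  (forall j, prob_on (X j) (mu j)) ->
  measurable (prod_set_but X i) /\ prod_prob_but mu i (prod_set_but X i) = 1%E.
Proof.
move=> mX muX; split.
  exact: (measurable_tuple_box (A := fun j => X (lift i j)) (fun j => mX _)).
exact: (tuple_prob_box (Q := fun j => mu (lift i j)) (A := fun j => X (lift i j))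
  (fun j => mX _) (fun j => muX _)).
Qed.

(** The averages do not see what happens in row [l] outside the set [X l] on which
the [l]-th marginal is concentrated. *)
Lemma avgs_eq_on (X : 'I_N -> set rv) mu s (f g : mx -> R) x :
  (forall j, measurable (X j : set (borel_rV R d))) ->
  (forall j, prob_on (X j) (mu j)) -> bl f -> bl g ->
  (forall z, (forall l, l \notin s -> row l z = row l x) ->
     (forall l, l \in s -> X l (row l z)) -> f z = g z) ->
  avgs mu s f x = avgs mu s g x.
Proof.
move=> mX muX bf bg; elim: s x => [|j s IH] x H /=; first exact: H.
apply: EFin_inj; rewrite /avg.
rewrite -(integral_full (mX j) (muX j)); last by apply: bl_set_row_bmeas; exact: bl_avgs.
rewrite -(integral_full (mX j) (muX j)); last by apply: bl_set_row_bmeas; exact: bl_avgs.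
apply: eq_integral => y /set_mem Xy; congr (_%:E); apply: IH => z h1 h2.
apply: H => l; rewrite inE.
  by rewrite negb_or => /andP[lj ls]; rewrite h1// set_row_ne.
have [ls _|ls] := boolP (l \in s); first exact: h2.
by rewrite orbF => /eqP lj; rewrite h1// lj set_rowE.
Qed.

End tuple_integral.

(** * The Wasserstein distance *)

Section wasserstein.
Context {R : realType} {d : nat}.
Notation rv := 'rV[R]_d.
Notation prob := (probability (borel_rV R d) R).
Implicit Types (mu nu : prob).

Lemma measurable_sqdist :
  measurable_fun setT (fun z : borel_rV R d * borel_rV R d => sqdist z.1 z.2).
Proof.
apply: measurable_sum => l; apply: measurable_funX; apply: measurable_funB.
  by apply: (measurableT_comp (measurable_borel_coord ord0 l)); exact: measurable_fst.
by apply: (measurableT_comp (measurable_borel_coord ord0 l)); exact: measurable_snd.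
Qed.

Lemma sqdist_ge0 (x y : rv) : 0 <= sqdist x y.
Proof. by apply: sumr_ge0 => l _; exact: sqr_ge0. Qed.

(** Each entry satisfies |a| <= w/2 + a^2/(2w). With [w] at the scale of the
transport cost, this plays the role of the Cauchy-Schwarz inequality. *)
Lemma dist1_sqdist (x y : rv) (w : R) : 0 < w ->
  dist1 x y <= d%:R * (w / 2) + (2 * w)^-1 * sqdist x y.
Proof.
move=> w0; rewrite /dist1 big_ord1 /sqdist mulr_sumr mulr_natl.
rewrite -[in X in _ *+ X](card_ord d) -sumr_const -big_split/=; apply: ler_sum => l _.
set a := x ord0 l - y ord0 l.
have := sqr_ge0 (`|a| - w); rewrite sqrrB real_normK ?num_real// => H.
rewrite -(ler_pM2l (_ : 0 < 2 * w)) ?mulr_gt0// mulrDr mulVKf ?gt_eqF ?mulr_gt0//.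
have -> : 2 * w * (w / 2) = w ^+ 2 by field.
by move: H; lra.
Qed.

(** The difference of the two expectations is the expectation of u(x) - u(y) under
the coupling, and the Lipschitz bound is linearized by [dist1_sqdist] at the
scale [w] of the transport cost. *)
Lemma coupling_BL_dist mu nu (P : probability (borel_rV R d * borel_rV R d)%type R) (w : R) :
  coupling mu nu P -> 0 < w ->
  (\int[P]_z (sqdist z.1 z.2)%:E <= (w ^+ 2)%:E)%E ->
  BL_dist_le mu nu ((d%:R + 1) / 2 * w).
Proof.
move=> cP w0 PV u M bu; have M0 := BL_ge0 bu.
have bmu : bmeas (u : borel_rV R d -> R) by apply: bl_bmeas; exists M.
have b1 : bmeas (fun z : borel_rV R d * borel_rV R d => u z.1).
  split; last by case: bmu => _ [M' HM']; exists M' => z.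
  by apply: (measurableT_comp bmu.1); exact: measurable_fst.
have b2 : bmeas (fun z : borel_rV R d * borel_rV R d => u z.2).
  split; last by case: bmu => _ [M' HM']; exists M' => z.
  by apply: (measurableT_comp bmu.1); exact: measurable_snd.
have mu_int : measurable_fun setT (EFin \o (u : borel_rV R d -> R)).
  by apply/measurable_EFinP; exact: bmu.1.
have E1 : expect mu (u : borel_rV R d -> R) = expect P (fun z => u z.1).
  apply: EFin_inj; rewrite -!expectE//.
  transitivity (\int[pushforward P fst]_x (u x)%:E)%E.
    by apply: eq_measure_integral => A mA _; have [E _] := cP A mA; exact: esym E.
  rewrite (integral_pushforward measurable_fst mu_int)//.
  exact: (bmeas_integrable P b1).
have E2 : expect nu (u : borel_rV R d -> R) = expect P (fun z => u z.2).
  apply: EFin_inj; rewrite -!expectE//.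
  transitivity (\int[pushforward P snd]_x (u x)%:E)%E.
    by apply: eq_measure_integral => A mA _; have [_ E] := cP A mA; exact: esym E.
  rewrite (integral_pushforward measurable_snd mu_int)//.
  exact: (bmeas_integrable P b2).
rewrite E1 E2 -expectB//.
have b12 : bmeas (fun z : borel_rV R d * borel_rV R d => u z.1 - u z.2).
  split; first by apply: measurable_funB; [exact: b1.1|exact: b2.1].
  exists (M + M) => z; rewrite (le_trans (ler_normB _ _))// lerD//; exact: bu.1.
rewrite -lee_fin -abse_EFin -expectE//.
apply: le_trans (le_abse_integral _ measurableT _) _.
  by apply/measurable_EFinP; exact: b12.1.
pose A := M * (d%:R * (w / 2)); pose B := M * (2 * w)^-1.
have A0 : 0 <= A by rewrite mulr_ge0// mulr_ge0// divr_ge0// ltW.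
have B0 : 0 <= B by rewrite mulr_ge0// invr_ge0 mulr_ge0// ltW.
have msq : measurable_fun setT (fun z : borel_rV R d * borel_rV R d => (sqdist z.1 z.2)%:E).
  by apply/measurable_EFinP; exact: measurable_sqdist.
apply: (@le_trans _ _ (\int[P]_z (A%:E + B%:E * (sqdist z.1 z.2)%:E))%E).
  apply: ge0_le_integral => //.
  - by apply: measurableT_comp => //; apply/measurable_EFinP; exact: b12.1.
  - by apply: emeasurable_funD => //; exact: measurable_funeM.
  - move=> z _; rewrite abse_EFin -EFinM -EFinD lee_fin.
    apply: le_trans (bu.2 _ _) _; apply: le_trans (ler_wpM2l M0 (dist1_sqdist _ _ w0)) _.
    by rewrite mulrDr /A /B (mulrA M (2 * w)^-1).
rewrite ge0_integralD//; last 2 first.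
- by move=> z _; rewrite mule_ge0// lee_fin// sqdist_ge0.
- exact: measurable_funeM.
rewrite ge0_integralZl_EFin//; last by move=> z _; rewrite lee_fin sqdist_ge0.
rewrite integral_cst// [X in (_ * X)%E]probability_setT mule1.
apply: le_trans (leeD2l _ (lee_wpmul2l _ PV)) _; first by rewrite lee_fin.
rewrite -EFinM -EFinD lee_fin le_eqVlt; apply/orP; left; apply/eqP.
by rewrite /A /B; field; rewrite gt_eqF.
Qed.

Lemma W2_ge0 mu nu : (0 <= W2 mu nu)%E.
Proof. exact: poweR_ge0. Qed.

Lemma W2_BL_dist mu nu (w : R) : (W2 mu nu < w%:E)%E ->
  BL_dist_le mu nu ((d%:R + 1) / 2 * w).
Proof.
move=> Ww; have w0 : 0 < w by rewrite -lte_fin (le_lt_trans (W2_ge0 mu nu)).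
set S := [set \int[P]_z (sqdist z.1 z.2)%:E | P in coupling mu nu]%E.
have S0 : (0 <= ereal_inf S)%E.
  apply: le_ereal_inf_tmp => _ [P _ <-]; apply: integral_ge0 => z _.
  by rewrite lee_fin sqdist_ge0.
have : (ereal_inf S < (w ^+ 2)%:E)%E.
  rewrite ltNge; apply/negP => H; move: Ww; rewrite ltNge => /negP; apply.
  rewrite /W2 -/S poweR12_sqrt//.
  have -> : w%:E = sqrte (w ^+ 2)%:E by rewrite /= sqrtr_sqr ger0_norm// ltW.
  by rewrite lee_sqrt.
move=> /ereal_inf_lt [_ [P cP <-] /ltW H].
exact: coupling_BL_dist cP w0 H.
Qed.

Lemma W2_le_prod N (mu nu : 'I_N -> prob) i : (W2 (mu i) (nu i) <= prod_W2 mu nu)%E.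
Proof.
have S0 (P : pred 'I_N) : (0 <= \sum_(j | P j) W2 (mu j) (nu j) ^+ 2)%E.
  by apply: sume_ge0 => j _; rewrite expe_ge0// W2_ge0.
rewrite /prod_W2 poweR12_sqrt; last exact: S0.
have -> : W2 (mu i) (nu i) = sqrte (W2 (mu i) (nu i) ^+ 2).
  by rewrite sqrte_sqr gee0_abs// W2_ge0.
rewrite lee_sqrt; last exact: S0.
by rewrite (bigD1 i)//= leeDl// S0.
Qed.

End wasserstein.

(** * From the compact sets to the whole space *)

Section compact_sets.
Context {R : realType} {d : nat}.
Notation rv := 'rV[R]_d.

Lemma compact_measurable_borel (X : set rv) : compact X ->
  measurable (X : set (borel_rV R d)).
Proof.
move=> cX; have clX : closed X by apply: compact_closed => //; exact: norm_hausdorff.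
rewrite -[X]setCK; apply: measurableC; apply: sub_sigma_algebra.
exact: closed_openC.
Qed.

Lemma compact_coord_bound (X : set rv) : compact X ->
  exists r : R, forall x i l, X x -> `|x i l| <= r.
Proof.
move=> /compact_bounded[M [_ HM]]; exists (M + 1) => x i l Xx.
have : `|x| <= M + 1 by apply: (HM (M + 1)); rewrite ?ltrDl.
apply: le_trans; change (`|x i l| <= mx_norm x); rewrite mx_normrE.
exact: (le_bigmax _ (fun ij : 'I_1 * 'I_d => `|x ij.1 ij.2|) (i, l)).
Qed.

End compact_sets.

Section system.
Context {R : realType} {N d : nat}.
Notation mx := 'M[R]_(N, d).
Notation rv := 'rV[R]_d.
Notation prob := (probability (borel_rV R d) R).
Variables (X : 'I_N -> set rv) (c g : mx -> R) (kappa MK : R) (mu : 'I_N -> prob).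
Hypothesis N0 : (0 < N)%N.
Hypothesis mX : forall j, measurable (X j : set (borel_rV R d)).
Hypothesis muX : forall j, prob_on (X j) (mu j).
Hypothesis cg : {in prod_set X, c =1 g}.
Hypothesis g_bl : bl g.
Hypothesis g_kappa : forall x, `|g x| <= kappa.
Hypothesis K_BL : BL MK (fun x => expR (- g x)).

Lemma row_insert_at i (xi : rv) t j : X i xi -> prod_set_but X i t ->
  X j (row j (insert_at i xi t)).
Proof.
move=> Xxi Xt; case: (unliftP i j) => [j' ->|->].
  suff -> : row (lift i j') (insert_at i xi t) = tnth t j' by exact: Xt.
  by apply/rowP => l; rewrite !mxE liftK.
suff -> : row i (insert_at i xi t) = xi by [].
by apply/rowP => l; rewrite !mxE unlift_none.
Qed.

(** On [X], where the marginals live, the cost and the potentials may be replaced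
by functions defined on the whole space. *)
Lemma system_integral (phi psi : 'I_N -> rv -> R) i xi : bl_family psi ->
  (forall j, {in X j, phi j =1 psi j}) -> X i xi ->
  (\int[prod_prob_but mu i]_(t in prod_set_but X i)
      (expR ((\sum_j phi j (row j (insert_at i xi t)))
             - c (insert_at i xi t)))%:E)%E =
  (avgs mu (others i) (density g psi) (row_only i xi))%:E.
Proof.
move=> bq pq Xxi; have bpot := bl_density g_bl bq.
rewrite -prod_prob_but_integral//.
have [mD PD] := prod_prob_but_box i mX muX.
have bm' : bmeas (fun t => density g psi (insert_at i xi t)).
  rewrite (_ : (fun t => _) = fun t => density g psi (fill (lift i) (row_only i xi) t)).
    exact: bmeas_fill.
  by apply/funext => t; rewrite insert_at_fill.
rewrite -(integral_full mD PD bm'); apply: eq_integral => t /set_mem Xt.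
rewrite /density cg; last by rewrite inE => j; exact: row_insert_at.
congr (_%:E); congr expR; congr (_ - _); apply: eq_bigr => j _; apply: pq.
by rewrite inE; exact: row_insert_at.
Qed.

Lemma solves_system (phi psi : 'I_N -> rv -> R) : bl_family psi ->
  (forall j, {in X j, phi j =1 psi j}) -> solves g mu psi ->
  Schrodinger_system X c mu phi.
Proof.
move=> bq pq sq i xi /set_mem Xxi; rewrite (system_integral bq pq Xxi).
by rewrite (solves_avgs_density K_BL)// lne1.
Qed.

(** On [X] the equation says that the potentials coincide with the update of any
extension of them. That update is defined everywhere; averages see only its
values on [X], so it is a fixed point of the update on the whole space. *)
Lemma system_solves (phi psi : 'I_N -> rv -> R) : bl_family psi ->
  (forall j, {in X j, phi j =1 psi j}) -> Schrodinger_system X c mu phi ->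
  exists phi', [/\ bl_family phi', forall j, {in X j, phi j =1 phi' j} & solves g mu phi'].
Proof.
move=> bq pq sp; pose phi' i := sinkhorn g mu psi i.
have E i xi : X i xi -> psi i xi = phi' i xi.
  move=> Xxi; have := sp i xi (mem_set Xxi); rewrite (system_integral bq pq Xxi).
  move=> /eqP; rewrite lne_eq0 => /eqP [].
  rewrite (avgs_density K_BL)// /row_only set_rowE => H.
  apply: expR_inj; have A0 := kernel_int_gt0 g_kappa K_BL mu i xi bq.
  by apply: (mulIf (lt0r_neq0 A0)); rewrite H (expR_sinkhorn g_kappa K_BL).
have b' : bl_family phi' by move=> i; exact: (bl_sinkhorn g_kappa K_BL).
exists phi'; split=> //.
  by move=> j y yX; rewrite pq// E//; exact/set_mem.
move=> i y; have -> : kernel_int g mu phi' i y = kernel_int g mu psi i y.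
  apply: (avgs_eq_on mX muX); [exact: (bl_integrand K_BL)|exact: (bl_integrand K_BL)|].
  move=> z _ zX; congr (expR _ * _); apply: eq_bigr => j ji.
  by rewrite E//; apply: zX; rewrite mem_others.
exact: (expR_sinkhorn g_kappa K_BL).
Qed.

Lemma system_bl_solution k (phi : Ck_prod k X) : (0 < k)%N ->
  (forall j, compact (X j)) -> Schrodinger_system X c mu phi ->
  exists phi', [/\ bl_family phi', forall j, {in X j, phi j =1 phi' j} & solves g mu phi'].
Proof.
move=> k0 cX sp.
have /choice[psi Hpsi] : forall j, exists u : rv -> R, bl u /\ {in X j, phi j =1 u}.
  (* as [k] is positive, a C^k function on a compact set extends to a bounded
     Lipschitz one *)
  move=> j; have [r Hr] := compact_coord_bound (cX j).
  have /asboolP/(_ j) Cj := valP phi.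
  have [u [M [pu sM]]] := Ck_bounded_extension Hr Cj.
  exists u; split=> //; case: k k0 phi sp Cj pu sM => // k _ phi sp Cj pu sM.
  by exists M; exact: smooth0 (CB_BL predT sM).
apply: (@system_solves phi psi) => // j.
- by have [] := Hpsi j.
- by have [] := Hpsi j.
Qed.

End system.

(** * Lipschitz continuity of the Schrodinger map *)

Lemma Ck_class_eq {R : realType} {N d k : nat} (X : 'I_N -> set 'rV[R]_d)
    (phi psi : Ck_prod k X) (kp : 'I_N -> R) : \sum_i kp i = 0 ->
  (forall i, {in X i, forall x, phi i x = psi i x + kp i}) ->
  Ck_class phi = Ck_class psi.
Proof.
move=> k0 E; apply/eqP; rewrite -Quotient.idealrBE; apply/asboolP; exists kp.
split=> // i x xX; have := E i x xX.
by rewrite [(phi - psi) i x](_ : _ = phi i x - psi i x)// => ->; rewrite addrC addKr.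
Qed.

(** The infimum defining the Wasserstein distance need not be attained, so the
estimate is proven for every value above it. *)
Lemma lee_scaled_eps {R : realType} (a : \bar R) (C w : R) : 0 < C ->
  (forall e : R, 0 < e -> (a <= (C * (w + e))%:E)%E) -> (a <= (C * w)%:E)%E.
Proof.
move=> C0 H; apply/lee_addgt0Pr => e e0.
have := H (e / C) (divr_gt0 e0 C0).
by rewrite mulrDr [C * (e / C)]mulrC divfK ?gt_eqF.
Qed.

Theorem corollary2p4 (R : realType) (N d : nat) (hN : (2 <= N)%N)
    (X : 'I_N -> set 'rV[R]_d)
    (hcompact : forall i, compact (X i))
    (hconvex : forall i, convex_set (X i : set (convex_lmodType 'rV[R]_d)))
    (k : nat) (hk : (0 < k)%N)
    (c : 'M[R]_(N, d) -> R) (hc : Ck_on k.+1 (prod_set X) c) :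
  exists C : R, 0 < C /\
    forall mu nu : 'I_N -> probability (borel_rV R d) R,
      (forall i, prob_on (X i) (mu i)) -> (forall i, prob_on (X i) (nu i)) ->
      (Ck_tilde_norm (Schrodinger_map k X c mu - Schrodinger_map k X c nu)%R
         <= C%:E * prod_W2 mu nu)%E.
Proof.
have N0 : (0 < N)%N by exact: ltnW.
have mX j : measurable (X j : set (borel_rV R d)) by exact: compact_measurable_borel.
have [g [kappa [cg sg]]] : exists g M, {in prod_set X, c =1 g} /\ smooth predT (CB0 M) k.+1 g.
  have /choice[r Hr] : forall j, exists r : R, forall x i l, X j x -> `|x i l| <= r.
    by move=> j; exact: compact_coord_bound.
  apply: (@Ck_bounded_extension R N d k.+1 (prod_set X) c (\sum_j `|r j|)) => // x i l Xx.
  have := Hr i (row i x) ord0 l (Xx i); rewrite mxE => /le_trans; apply.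
  by rewrite (bigD1 i)//= (le_trans (ler_norm _))// lerDl sumr_ge0.
have g_kappa x : `|g x| <= kappa by exact: (smooth0 sg).2.
have g_bl : bl g by exists kappa; exact: smooth0 (CB_BL predT sg).
have [MK HMK] := @CB_expR R N d (`|0 : R| + kappa) k.+1.
have sK : smooth predT (CB0 MK) k.+1 (fun x => expR (- g x)).
  have := HMK predT _ (CBB (CB0_cst predT k.+1 0) sg).
  by rewrite (_ : _ \o _ = fun x => expR (- g x))//; apply/funext => x /=; rewrite !fctE sub0r.
have K_BL : BL MK (fun x => expR (- g x)) := smooth0 (CB_BL predT sK).
have K_smooth i := CB_BL (rowdir i) sK.
have [C0 C00 HC0] := stability N0 g_bl g_kappa K_BL K_smooth.
pose C : R := N%:R * (C0 * (N%:R * ((d%:R + 1) / 2))).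
have Nr : 0 < (N%:R : R) by rewrite ltr0n.
have d0 : 0 < (d%:R + 1) / 2 :> R by rewrite divr_gt0// ltr_wpDl.
have Cp : 0 < C by rewrite /C !mulr_gt0.
exists C; split=> // mu nu muX nuX.
(* the class given by the map has a representative which extends to a solution
   on the whole space *)
have rep (m : 'I_N -> probability (borel_rV R d) R) : (forall i, prob_on (X i) (m i)) ->
    exists phi, [/\ bl_family phi, solves g m phi & exists2 p : Ck_prod k X,
      Ck_class p = Schrodinger_map k X c m & forall j, {in X j, p j =1 phi j}].
  move=> mm.
  have [phi0 [b0 s0]] := solution_exists N0 g_bl g_kappa K_BL m.
  have Cphi0 : phi0 \in Ck_family k X.
    apply/asboolP => i; exists (phi0 i); split=> //.
    have [M sM] := solves_smooth g_kappa K_BL K_smooth i b0 s0.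
    by apply/is_CkE; move: sM; apply: smooth_impl => // ? [].
  have /(@xgetPex _ 0)[p [pc psys]] : exists a : Ck_tilde k X, exists phi : Ck_prod k X,
      Ck_class phi = a /\ Schrodinger_system X c m phi.
    exists (Ck_class (MkCkProd Cphi0)), (MkCkProd Cphi0); split=> //.
    exact: (solves_system mX mm cg g_bl K_BL b0 (fun j x _ => erefl _) s0).
  have [phi [bp pp sp]] := system_bl_solution mX mm cg g_bl g_kappa K_BL hk hcompact psys.
  by exists phi; split=> //; exists p.
have [phi [bp sp [p pc pE]]] := rep mu muX.
have [psi [bq sq [q qc qE]]] := rep nu nuX.
have W0 : (0 <= prod_W2 mu nu)%E by exact: poweR_ge0.
move EW : (prod_W2 mu nu) W0 => [w| |] // W0; last by rewrite gt0_muley ?leey ?lte_fin.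
rewrite -EFinM; apply: lee_scaled_eps => // e e0.
pose ep := (d%:R + 1) / 2 * (w + e).
have w0 : 0 <= w by rewrite -lee_fin.
have ep0 : 0 <= ep by rewrite mulr_ge0 ?(ltW d0)// addr_ge0// ltW.
have mn j : BL_dist_le (mu j) (nu j) ep.
  apply: W2_BL_dist; apply: le_lt_trans (W2_le_prod mu nu j) _.
  by rewrite EW lte_fin ltrDl.
have [kp kp0 Hkp] := HC0 mu nu (fun=> ep) phi psi mn (fun=> ep0) bp bq sp sq.
(* the difference of the two global solutions, shifted by [kp], represents
   the difference of the classes *)
have Cdif : (fun i y => phi i y - psi i y - kp i) \in Ck_family k X.
  apply/asboolP => i; exists (fun y => phi i y - psi i y - kp i); split=> //.
  by apply/is_CkE; move: (Hkp i); apply: smooth_impl => // ? [].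
pose D := MkCkProd Cdif.
have DE : Ck_class D = Schrodinger_map k X c mu - Schrodinger_map k X c nu.
  rewrite -pc -qc; transitivity (Ck_class (p - q)); last exact: raddfB.
  apply: (@Ck_class_eq _ _ _ _ _ _ _ (fun i => - kp i)); first by rewrite sumrN kp0 oppr0.
  move=> i x xX; rewrite [(p - q) i x](_ : _ = p i x - q i x)//.
  by rewrite (pE i x xX) (qE i x xX).
apply: (@le_trans _ _ (\sum_i Ck_norm k (X i) (D i))%E).
  by apply: ereal_inf_lbound; exists D.
apply: (@le_trans _ _ (\sum_(i < N) (C0 * \sum_(j < N) ep)%:E)%E).
  by apply: lee_sum => i _; apply: Ck_norm_le (Hkp i) => x _.
have sumN (z : R) : \sum_(i < N) z = N%:R * z by rewrite sumr_const card_ord mulr_natl.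
by rewrite sumEFin lee_fin !sumN /C /ep !mulrA.
Qed.
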